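(* Let $N\ge3$, let $\Omega\subset\mathbb{R}^N$ be a bounded domain with $\partial\Omega\in C^2$, let $\lambda>0$, and for $\varepsilon>0$ let $J_\varepsilon$ (depending also on $\lambda$ and $\kappa$) be the functional defined in the context. Given $M>0$, set $$\kappa_\ast=\left(1-\frac{4}{N^2}\right)^{\frac{N}{N-2}}\kappa^\ast,\qquad\kappa^\ast=\left[\frac{S^{N/2}}{N(M+|\Omega|)}\right]^{\frac{2}{N-2}},$$ where $S$ is the best Sobolev constant defined in the context. If $0<\kappa<\kappa_\ast$, then there exists a constant $C>0$, depending on $M$, $\Omega$, $\kappa$ and $\lambda$, but not on $\varepsilon>0$, such that $\|u\|_{L^\infty(\Omega)}\le C$ whenever $u$ is a critical point of $J_\varepsilon$ with $J_\varepsilon(u)\le M$.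
   Context: Here $2^\ast=2N/(N-2)$, $t_+=\max\{t,0\}$, $|\Omega|$ is the Lebesgue measure of $\Omega$, and $$S=\inf_{u\in H^1_0(\Omega)\setminus\{0\}}\frac{\int_\Omega|\nabla u|^2dx}{\left(\int_\Omega|u|^{2^\ast}dx\right)^{2/2^\ast}}.$$ The functional is $$J_\varepsilon(u)=\int_\Omega\left[\tfrac12|\nabla u|^2+\mathcal{B}\left(\frac{u-1}{\varepsilon}\right)-\tfrac{\lambda}{2}(u-1)_+^2-\tfrac{\kappa}{2^\ast}(u-1)_+^{2^\ast}\right]dx,\quad u\in H^1_0(\Omega),$$ where $\mathcal{B}(t)=\int_0^t\beta(s)\,ds$ and $\beta:\mathbb{R}\to[0,2]$ is a fixed smooth function with $\beta(t)=0$ for $t\le0$, $\beta(t)>0$ for $0<t<1$, $\beta(t)=0$ for $t\ge1$, and $\int_0^1\beta(s)\,ds=1$. $J_\varepsilon$ is of class $C^1$ on $H^1_0(\Omega)$; a critical point is $u\in H^1_0(\Omega)$ with $J_\varepsilon'(u)=0$. *)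

(* Defs.v *)
From HB Require Import structures.
From mathcomp Require Import all_boot all_order all_algebra.
From mathcomp Require Import all_classical all_reals all_analysis.

Set Implicit Arguments.
Unset Strict Implicit.
Unset Printing Implicit Defensive.

Import Order.TTheory GRing.Theory Num.Theory.
Import numFieldNormedType.Exports.

Local Open Scope classical_set_scope.
Local Open Scope ring_scope.

(* The space R^n is ['rV[R]_n]; its sigma-algebra is the one generated by the
   coordinates, as for tuples in the library, i.e. the Borel sigma-algebra. *)
Definition measure_rV_display : measure_display.
Proof. exact: default_measure_display. Qed.

Section measurable_rV.
Variables (R : realType) (n : nat).

Let coords : 'I_n -> 'rV[R]_n -> measurableTypeR R := fun i x => x 0 i.

Let rV_set0 : g_sigma_preimage coords set0.
Proof. exact: sigma_algebra0. Qed.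

Let rV_setC A : g_sigma_preimage coords A -> g_sigma_preimage coords (~` A).
Proof. exact: sigma_algebraC. Qed.

Let rV_bigcup (F : _^nat) : (forall i, g_sigma_preimage coords (F i)) ->
  g_sigma_preimage coords (\bigcup_i (F i)).
Proof. exact: sigma_algebra_bigcup. Qed.

HB.instance Definition _ :=
  @isMeasurable.Build measure_rV_display
    'rV[R]_n (g_sigma_preimage coords) rV_set0 rV_setC rV_bigcup.

Lemma measurable_coord (i : 'I_n) :
  measurable_fun [set: 'rV[R]_n] (fun x : 'rV[R]_n => x 0 i : measurableTypeR R).
Proof.
move=> _ Y mY; rewrite setTI; apply: sub_sigma_algebra => /=.
rewrite -bigcup_seq/=; exists i => /=; first by rewrite mem_index_enum.
by exists Y => //; rewrite setTI.
Qed.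

Lemma measurable_fun_rVP d (T : measurableType d) (f : T -> 'rV[R]_n) :
  (forall i, measurable_fun [set: T] (fun x => f x 0 i : measurableTypeR R)) ->
  measurable_fun [set: T] f.
Proof.
move=> mf.
have sub : g_sigma_preimage coords `<=` [set B | measurable (f @^-1` B)].
  apply: smallest_sub.
    split => /=.
    - by rewrite preimage_set0; exact: measurable0.
    - by move=> A mA; rewrite setTD preimage_setC; exact: measurableC.
    - by move=> A mA; rewrite preimage_bigcup; exact: bigcupT_measurable.
  rewrite -bigcup_seq => B [i _ [C mC <-]] /=.
  have := mf i measurableT C mC.
  by rewrite !setTI.
by move=> _ B mB; rewrite setTI; exact: sub.
Qed.

End measurable_rV.

(* Lebesgue measure on R^n, by induction on n: Dirac measure on the one-point
   space R^0, and the image of the product of the Lebesgue measures of R and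
   R^n under (t, v) |-> (t, v_1, ..., v_n). *)
Section lebesgue_rV.
Variable R : realType.

Definition consrV n (p : measurableTypeR R * 'rV[R]_n) : 'rV[R]_n.+1 :=
  row_mx (const_mx p.1 : 'rV_1) p.2.

Lemma consrVE0 n p : @consrV n p 0 ord0 = p.1.
Proof. by rewrite mxE; case: splitP => // j _; rewrite mxE. Qed.

Lemma consrVES n p j : @consrV n p 0 (lift ord0 j) = p.2 0 j.
Proof.
rewrite mxE; case: splitP => [i|i /= [/ord_inj ->]//].
by move: (ltn_ord i) => /[swap] <-.
Qed.

Lemma measurable_consrV n : measurable_fun setT (@consrV n).
Proof.
apply: measurable_fun_rVP => i.
case: (unliftP ord0 i) => [j|] ->.
  under eq_fun do rewrite consrVES.
  exact: (measurableT_comp (measurable_coord j) measurable_snd).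
under eq_fun do rewrite consrVE0.
exact: measurable_fst.
Qed.

Section step.
Variables (n : nat) (m : {sigma_finite_measure set 'rV[R]_n -> \bar R}).

Definition lebesgue_rVS : set 'rV[R]_n.+1 -> \bar R :=
  pushforward (@lebesgue_measure R \x m)%E (@consrV n).

Let measurable_pre A : measurable A -> measurable (@consrV n @^-1` A).
Proof. by move=> mA; rewrite -[X in measurable X]setTI; exact: measurable_consrV. Qed.

Let lebesgue_rVS0 : lebesgue_rVS set0 = 0%E.
Proof. by rewrite /lebesgue_rVS /pushforward preimage_set0 measure0. Qed.

Let lebesgue_rVS_ge0 A : (0 <= lebesgue_rVS A)%E.
Proof. by rewrite /lebesgue_rVS /pushforward; exact: measure_ge0. Qed.

Let lebesgue_rVS_sigma_additive : semi_sigma_additive lebesgue_rVS.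
Proof.
move=> F mF tF mUF; rewrite /lebesgue_rVS /pushforward preimage_bigcup.
apply: measure_semi_sigma_additive.
- by move=> k; exact: measurable_pre.
- apply/trivIsetP => /= i j _ _ ij; rewrite -preimage_setI.
  by move/trivIsetP : tF => /(_ _ _ _ _ ij) ->//; rewrite preimage_set0.
- by rewrite -preimage_bigcup; exact: measurable_pre.
Qed.

HB.instance Definition _ := isMeasure.Build _ _ _ lebesgue_rVS
  lebesgue_rVS0 lebesgue_rVS_ge0 lebesgue_rVS_sigma_additive.

Let sigma_finite_lebesgue_rVS : sigma_finite setT lebesgue_rVS.
Proof.
have [F [UF mF]] : exists F : (set (measurableTypeR R * 'rV[R]_n))^nat,
    setT = \bigcup_k F k /\
    forall k, measurable (F k) /\ ((@lebesgue_measure R \x m) (F k) < +oo)%E.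
  have /sigma_finiteP[A [TA ndA Aoo]] := sigma_finiteT (@lebesgue_measure R).
  have /sigma_finiteP[B [TB ndB Boo]] := sigma_finiteT m.
  exists (fun k => A k `*` B k); split.
    rewrite -setXTT TA TB predeqE => -[x y]; split.
      move=> [/= [k _ Akx] [l _ Bly]]; exists (maxn k l) => //; split.
      - by move: x Akx; exact/subsetPset/ndA/leq_maxl.
      - by move: y Bly; exact/subsetPset/ndB/leq_maxr.
    by move=> [k _ []/= ? ?]; split; exists k.
  move=> k; have [? ?] := Aoo k; have [? ?] := Boo k.
  split; first exact: measurableX.
  by rewrite product_measure1E// lte_mul_pinfty// ge0_fin_numE.
pose unconsrV (x : 'rV[R]_n.+1) : measurableTypeR R * 'rV[R]_n :=
  (x 0 ord0, \row_j x 0 (lift ord0 j)).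
have consrVK : cancel (@consrV n) unconsrV.
  move=> [t v]; congr pair; first exact: consrVE0.
  by apply/rowP => j; rewrite mxE consrVES.
have munconsrV : measurable_fun setT unconsrV.
  apply: measurable_fun_pair; first exact: measurable_coord.
  apply: measurable_fun_rVP => i.
  rewrite (_ : (fun _ => _) =
    (fun x : 'rV[R]_n.+1 => x 0 (lift ord0 i) : measurableTypeR R)).
    exact: measurable_coord.
  by apply/funext => x; rewrite mxE.
exists (fun k => unconsrV @^-1` F k).
  by rewrite -preimage_bigcup -UF preimage_setT.
move=> k; have [mFk Fk_fin] := mF k; split.
  by rewrite -[X in measurable X]setTI; exact: munconsrV.
rewrite /lebesgue_rVS /pushforward /= (_ : _ @^-1` _ = F k)//.
by apply/funext => p; rewrite /preimage/= consrVK.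
Qed.

HB.instance Definition _ := Measure_isSigmaFinite.Build _ _ _ lebesgue_rVS
  sigma_finite_lebesgue_rVS.
End step.

Fixpoint lebesgue_rV n : {sigma_finite_measure set 'rV[R]_n -> \bar R} :=
  match n with
  | 0 => dirac (0 : 'rV[R]_0)
  | n'.+1 => lebesgue_rVS (lebesgue_rV n')
  end.

Lemma lebesgue_rV_box n (A : 'I_n -> set (measurableTypeR R)) :
  (forall i, measurable (A i)) ->
  lebesgue_rV n [set x | forall i, A i (x 0 i)] =
  (\prod_(i < n) lebesgue_measure (A i))%E.
Proof.
elim: n A => [|n IH] A mA.
  by rewrite big_ord0 /= diracE mem_set//= => -[].
rewrite big_ord_recl -IH//= /lebesgue_rVS /pushforward.
have mbox k (B : 'I_k -> set (measurableTypeR R)) : (forall i, measurable (B i)) ->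
    measurable [set x : 'rV[R]_k | forall i, B i (x 0 i)].
  move=> mB.
  rewrite (_ : mkset _ = \bigcap_(i in [set: 'I_k])
      ((fun x : 'rV[R]_k => x 0 i : measurableTypeR R) @^-1` B i)).
    apply: fin_bigcap_measurable => [|i _]; first exact: (@finite_finset _ setT).
    rewrite -[X in measurable X]setTI.
    exact: (measurable_coord i measurableT (mB i)).
  by apply/seteqP; split=> [x Bx i _|x Bx i]; exact: Bx.
have mB := mbox n (fun j => A (lift ord0 j)) (fun j => mA _).
rewrite -(product_measure1E _ _ (mA ord0) mB).
congr (_ \x _)%E; apply/seteqP; split=> [[t v] /= Atv|[t v] /= [At Av] i].
  split; first by have := Atv ord0; rewrite consrVE0.
  by move=> i; have := Atv (lift ord0 i); rewrite consrVES.
by case: (unliftP ord0 i) => [j|] ->; rewrite ?consrVE0 ?consrVES.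
Qed.

End lebesgue_rV.

Section calculus.
Variables (R : realType) (n : nat).

Definition partial (i : 'I_n) (f : 'rV[R]_n -> R) : 'rV[R]_n -> R :=
  fun x => 'D_(delta_mx 0 i) f x.

Fixpoint Ck (k : nat) (f : 'rV[R]_n -> R) : Prop :=
  continuous f /\
  match k with
  | 0 => True
  | k'.+1 => forall i, (forall x, derivable f x (delta_mx 0 i)) /\
                       Ck k' (partial i f)
  end.

Definition test_function (Omega : set 'rV[R]_n) (phi : 'rV[R]_n -> R) :=
  let supp := closure [set x | phi x != 0] in
  [/\ forall k, Ck k phi, compact supp & supp `<=` Omega].

End calculus.

Definition bounded_domain (R : realType) (n : nat) (Omega : set 'rV[R]_n) :=
  [/\ open Omega, connected Omega, Omega !=set0 & bounded_set Omega].

(* Near each boundary point, up to relabelling and reorienting the coordinate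
   axes, Omega is the region strictly above the graph of a C^2 function of the
   n - 1 other coordinates [col' i x]. *)
Definition C2_boundary (R : realType) (n : nat) (Omega : set 'rV[R]_n) :=
  forall x0, (closure Omega `\` Omega°) x0 ->
  exists (i : 'I_n) (s : bool) (gamma : 'rV[R]_n.-1 -> R),
    Ck 2 gamma /\
    \forall x \near x0, Omega x <-> gamma (col' i x) < (-1) ^+ s * x 0 i.

(* Elements of the function spaces on Omega are represented by functions on
   R^n of which only the values on Omega, up to null sets, matter. *)
Section sobolev.
Variables (R : realType) (n : nat) (Omega : set 'rV[R]_n).

Local Notation mu := (@lebesgue_rV R n).

Definition L2 (u : 'rV[R]_n -> R) := (u \_ Omega) \in Lfun mu 2%:E.

Definition Linfty_norm (u : 'rV[R]_n -> R) : \bar R :=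
  'N[mu]_+oo [EFin \o (u \_ Omega)].

Definition is_weak_partial (i : 'I_n) (u g : 'rV[R]_n -> R) :=
  forall phi, test_function Omega phi ->
    \int[mu]_(x in Omega) (u x * partial i phi x) =
    - \int[mu]_(x in Omega) (g x * phi x).

Definition H1 (u : 'rV[R]_n -> R) :=
  L2 u /\ forall i, exists2 g, L2 g & is_weak_partial i u g.

(* A representative of the i-th weak partial derivative of u \in H^1(Omega),
   unique up to a null subset of Omega. *)
Definition weak_partial (i : 'I_n) (u : 'rV[R]_n -> R) : 'rV[R]_n -> R :=
  xget (cst 0) [set g | L2 g /\ is_weak_partial i u g].

Definition normgrad2 (u : 'rV[R]_n -> R) (x : 'rV[R]_n) : R :=
  \sum_i (weak_partial i u x) ^+ 2.

Definition H1_norm (u : 'rV[R]_n -> R) : R :=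
  Num.sqrt (\int[mu]_(x in Omega) ((u x) ^+ 2) +
            \int[mu]_(x in Omega) (normgrad2 u x)).

Definition H10 (u : 'rV[R]_n -> R) :=
  H1 u /\
  forall e, 0 < e -> exists2 phi, test_function Omega phi & H1_norm (u \- phi) < e.

Definition sobolev_exponent : R := 2 * n%:R / (n%:R - 2).

Local Notation pstar := sobolev_exponent.

Definition sobolev_constant : R :=
  inf [set (\int[mu]_(x in Omega) (normgrad2 u x)) /
           (\int[mu]_(x in Omega) (`|u x| `^ pstar)) `^ (2 / pstar)
      | u in [set u | H10 u /\ ~ ae_eq mu Omega u (cst 0)]].

Definition volume : R := fine (mu Omega).

(* L is meant to be a continuous linear functional on H^1_0(Omega), as the zero
   functional below is. *)
Definition frechet_derivative (J : ('rV[R]_n -> R) -> R) (u : 'rV[R]_n -> R)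
    (L : ('rV[R]_n -> R) -> R) :=
  forall e, 0 < e -> exists2 d, 0 < d &
    forall v, H10 v -> H1_norm v < d ->
      `|J (u \+ v) - J u - L v| <= e * H1_norm v.

Definition critical_point (J : ('rV[R]_n -> R) -> R) (u : 'rV[R]_n -> R) :=
  H10 u /\ frechet_derivative J u (cst 0).

End sobolev.

Definition admissible_beta (R : realType) (beta : R -> R) :=
  [/\ forall k t, derivable (derive1n k beta) t 1,
      forall t, 0 <= beta t <= 2,
      forall t, t <= 0 \/ 1 <= t -> beta t = 0,
      forall t, 0 < t < 1 -> 0 < beta t &
      \int[@lebesgue_measure R]_(s in `[0, 1]) beta s = 1].

Definition primitive (R : realType) (beta : R -> R) (t : R) : R :=
  if 0 <= t then \int[@lebesgue_measure R]_(s in `[0, t]) beta s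
  else - \int[@lebesgue_measure R]_(s in `[t, 0]) beta s.

Section functional.
Variables (R : realType) (N : nat) (Omega : set 'rV[R]_N).

Local Notation mu := (@lebesgue_rV R N).
Local Notation pstar := (sobolev_exponent R N).

(* For u \in H^1_0(Omega) with Omega bounded and N >= 3 the integrand is
   integrable (Sobolev embedding), so that the real-valued integral is the
   genuine one; the same holds in [sobolev_constant]. *)
Definition J (beta : R -> R) (lambda kappa eps : R) (u : 'rV[R]_N -> R) : R :=
  \int[mu]_(x in Omega)
    (2^-1 * normgrad2 Omega u x
     + primitive beta ((u x - 1) / eps)
     - lambda / 2 * (Num.max (u x - 1) 0) ^+ 2
     - kappa / pstar * (Num.max (u x - 1) 0) `^ pstar).

Definition kappa_upper (M : R) : R :=
  (sobolev_constant Omega `^ (N%:R / 2) / (N%:R * (M + volume Omega)))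
    `^ (2 / (N%:R - 2)).

Definition kappa_lower (M : R) : R :=
  (1 - 4 / N%:R ^+ 2) `^ (N%:R / (N%:R - 2)) * kappa_upper M.

End functional.

(* Main.v *)
(* Write p = 2N/(N-2) and v = (u-1)_+.  A critical point is nonnegative, and
   subtracting half of the derivative of J at u in the direction v from J(u)
   gives (kappa/N) int v^p <= M + |Omega|.  Testing with int_0^u h^2, where
   h(t) = s min((t-1)_+, T)^(s-1) and s = N/(N-2) = p/2, and applying the Sobolev
   and Hoelder inequalities, the critical term can be absorbed exactly when
   kappa < kappa_*, since (2s-1)/s^2 = 1 - 4/N^2; letting T go to infinity bounds
   v in L^(ps).  As ps/(p-2) > N/2, a De Giorgi iteration over the levels
   K(2 - 2^-j) then bounds u.  No constant depends on epsilon: the term in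
   beta only enters the first estimate, through t beta(t) <= 2, and does not
   increase J along the downward directions used in the other tests.  The
   Sobolev inequality costs nothing: kappa_* > 0 forces S > 0. *)
Require Import Defs.
From HB Require Import structures.
From mathcomp Require Import all_boot all_order all_algebra.
From mathcomp Require Import all_classical all_reals all_analysis.
From mathcomp Require Import measurable_realfun lra ring.

Set Implicit Arguments.
Unset Strict Implicit.
Unset Printing Implicit Defensive.

Import Order.TTheory GRing.Theory Num.Theory.
Import numFieldNormedType.Exports.

Local Open Scope classical_set_scope.
Local Open Scope ring_scope.

(** * Calculus and measurability on R^n *)

(** Two features of the definitions shape the proof. [weak_partial] picks a representative by
    choice, so H^1_0 is recast as a space of pairs (function, gradient) in which limits can be
    taken; and criticality is a vanishing Fréchet derivative of [J], which is exploited through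
    finite differences along a single direction. Every direction used has the form W(u), with W
    built from the identity and from primitives of bounded Borel functions g vanishing for t <= 0.
    One chain rule for such primitives therefore covers negative parts, level truncations (g the
    indicator of a ray) and truncated powers. The smooth cutoffs it requires, like those of the
    fundamental lemma, all come from one profile: the primitive of beta is itself a smooth step from
    0 to 1. The exponent s = p/2 is tied to the first estimate: with w = int_0^u h one has w <= v^s,
    hence w^2 <= v^p, so the lambda term is controlled by int v^p alone. The truncation at T keeps
    int w^p finite, so that subtracting the critical term is legitimate. *)

Section boxes.
Variables (R : realType) (n : nat).
Implicit Types (a b x y : 'rV[R]_n).

Definition obox a b : set 'rV[R]_n := [set x | forall i, a 0 i < x 0 i < b 0 i].
Definition cbox a b : set 'rV[R]_n := [set x | forall i, a 0 i <= x 0 i <= b 0 i].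

Lemma cbox_compact a b : compact (cbox a b).
Proof.
have := @rV_compact R n (fun i => [set` `[a 0 i, b 0 i]]) _.
rewrite (_ : [set v | _] = cbox a b).
  by apply => i; exact: segment_compact.
by apply/seteqP; split => x /= h i; have := h i; rewrite /= in_itv.
Qed.

Lemma cbox_closed a b : closed (cbox a b).
Proof. by apply: compact_closed; [exact: norm_hausdorff|exact: cbox_compact]. Qed.

Lemma bounded_sub_cbox (A : set 'rV[R]_n) : bounded_set A ->
  exists2 L : R, 0 < L & A `<=` cbox (const_mx (- L)) (const_mx L).
Proof.
move=> [M [_ hM]]; exists (Num.max M 0 + 1).
  by rewrite ltr_wpDl// le_max lexx orbT.
move=> x Ax i; rewrite !mxE -ler_norml.
have Mlt : M < Num.max M 0 + 1 by rewrite ltr_pwDr// le_max lexx.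
apply: le_trans (hM _ Mlt _ Ax).
rewrite /= [leRHS]/Num.norm /= mx_normrE; apply/bigmax_geP; right => /=.
by exists (0, i).
Qed.

Lemma measurable_obox a b : measurable (obox a b).
Proof.
rewrite (_ : obox a b = \bigcap_(i in [set: 'I_n])
    ((fun x : 'rV[R]_n => x 0 i : measurableTypeR R) @^-1` `]a 0 i, b 0 i[)).
  apply: fin_bigcap_measurable => [|i _]; first exact: (@finite_finset _ setT).
  rewrite -[X in measurable X]setTI.
  exact: (measurable_coord i measurableT (measurable_itv _)).
apply/seteqP; split=> [x Bx i _|x Bx i].
  by rewrite /= in_itv/=; exact: Bx.
by have := Bx i Logic.I; rewrite /= in_itv.
Qed.

Lemma obox_measure_lty a b : (lebesgue_rV R n (obox a b) < +oo)%E.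
Proof.
rewrite (_ : obox a b =
  [set x | forall i, (fun i => [set` `]a 0 i, b 0 i[]) i (x 0 i)]); last first.
  by apply/seteqP; split => x /= h i; have := h i; rewrite /= in_itv.
have -> := @lebesgue_rV_box R n (fun i => [set` `]a 0 i, b 0 i[])
  (fun i => measurable_itv _).
have : (0 <= \prod_(i < n) lebesgue_measure (R := R) `]a 0%R i, b 0%R i[ < +oo)%E.
  apply: (big_ind (fun x : \bar R => (0 <= x < +oo)%E)) => //.
  - by rewrite lee_fin ler01 ltry.
  - move=> x y /andP[x0 xy] /andP[y0 yy]; rewrite mule_ge0//= lte_mul_pinfty//.
    by rewrite ge0_fin_numE.
  - move=> i _; rewrite measure_ge0/=.
    apply: (le_lt_trans _ (ltry `|b 0 i - a 0 i|)).
    rewrite lebesgue_measure_itv/=; case: ifP => _ //.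
    by rewrite -EFinD lee_fin ler_norm.
by case/andP.
Qed.

(** Boxes with rational centres and half-sides 1/(m+1) are countably many and form a basis. Keeping
    the closed box inside [O] is what later makes a smooth function supported in it a test
    function. *)
Lemma open_bigcup_obox (O : set 'rV[R]_n) : open O ->
  exists (P : set nat) (a b : nat -> 'rV[R]_n),
   O = \bigcup_(k in P) obox (a k) (b k) /\
   forall k, P k -> cbox (a k) (b k) `<=` O.
Proof.
move=> oO.
(* [dec] enumerates the pairs (centre, m). Codes that decode to nothing receive an arbitrary pair,
   which is harmless because the index set retains only boxes contained in [O]. *)
pose dec k : 'rV[rat]_n * nat := odflt (0, 0%N) (unpickle k).
pose a k : 'rV[R]_n := \row_i (ratr ((dec k).1 0 i) - (dec k).2.+1%:R^-1).
pose b k : 'rV[R]_n := \row_i (ratr ((dec k).1 0 i) + (dec k).2.+1%:R^-1).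
exists [set k | cbox (a k) (b k) `<=` O], a, b; split => //.
apply/seteqP; split => [x Ox|x [k /= sub xk]]; last first.
  by apply: sub => i; have /andP[/ltW -> /ltW ->] := xk i.
have /nbhs_ballP[e /= e0 eO] : nbhs x O by exact: open_nbhs_nbhs.
have [m _ hm] := near_infty_natSinv_lt (PosNum (divr_gt0 e0 (ltr0n R 2))).
have := hm m (leqnn _); rewrite /= => {}hm.
pose d : R := m.+1%:R^-1.
have d0 : 0 < d by rewrite invr_gt0 ltr0n.
have hq i : exists q : rat, x 0 i - d < ratr q < x 0 i + d.
  have [|q] := @rat_in_itvoo R (x 0 i - d) (x 0 i + d); first lra.
  by rewrite in_itv/=; exists q.
have [q hq'] := choice hq.
pose k := pickle ((\row_i q i : 'rV[rat]_n), m).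
have dk : dec k = (\row_i q i, m) by rewrite /dec pickleK.
exists k => /=.
  move=> y yk; apply: eO; split => // i0 i; rewrite (ord1 i0) {i0}.
  rewrite /ball/= ltr_norml.
  have := yk i; rewrite !mxE dk/= !mxE.
  have := hq' i; move: hm; rewrite -/d; set z : R := ratr _; lra.
move=> i; rewrite !mxE dk/= !mxE; have := hq' i; rewrite -/d; lra.
Qed.

Lemma open_measurable_rV (O : set 'rV[R]_n) : open O -> measurable O.
Proof.
move=> /open_bigcup_obox[P [a [b [-> _]]]].
by apply: bigcup_measurable => k _; exact: measurable_obox.
Qed.

Lemma continuous_measurable_rV (f : 'rV[R]_n -> R) : continuous f ->
  measurable_fun setT (f : 'rV[R]_n -> measurableTypeR R).
Proof.
move=> cf; apply: (measurability _ (RGenOInfty.measurableE R)).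
move=> _ [_ [a ->] <-]; rewrite setTI.
by apply: open_measurable_rV; move/continuousP : cf; apply; exact: interval_open.
Qed.

End boxes.

Section Ck_theory.
Variables (R : realType) (n : nat).
Implicit Types (f g : 'rV[R]_n -> R).

Lemma derive_line (V : normedModType R) (f : V -> R) (x v : V) :
  'D_(1 : R) (fun h : R => f (h *: v + x)) 0 = 'D_v f x.
Proof.
rewrite /derive; set g1 := fun h : R => h^-1 *: _; set g2 := fun h : R => h^-1 *: _.
suff -> : g1 = g2 by [].
by apply/funext => h; rewrite /g1 /g2 /= addr0 scale0r add0r [_%:A]mulr1.
Qed.

(** A directional derivative only sees the restriction to a line, so it can be read on another
    space; this transfers partial derivatives from R^(n+1) to the slices of [consrV]. *)
Lemma eq_derive_line (V W : normedModType R) (f : V -> R) (g : W -> R)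
    (x v : V) (y w : W) : (forall h : R, f (h *: v + x) = g (h *: w + y)) ->
  'D_v f x = 'D_w g y /\ (derivable f x v <-> derivable g y w).
Proof.
move=> /funext fg; split; first by rewrite -derive_line fg derive_line.
by rewrite derivable1P fg -derivable1P.
Qed.

(** Restriction to the line through [x] reduces this to the one-variable chain rule. Directional
    derivability of [f] suffices, and it is all that [Ck] records. *)
Lemma is_derive_comp1 (V : normedModType R) (f : V -> R) (G : R -> R) (x v : V) :
  derivable f x v -> derivable G (f x) 1 ->
  is_derive x v (G \o f) ((derive1 G) (f x) * 'D_v f x).
Proof.
move=> df dG.
pose l := fun h : R => f (h *: v + x).
have lE : l 0 = f x by rewrite /l scale0r add0r.
have dl : is_derive (0 : R) 1 l ('D_v f x).
  apply: DeriveDef; first exact: ((derivable1P f x v).1 df).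
  exact: derive_line.
have dGl : is_derive (l 0) 1 G ((derive1 G) (f x)).
  by rewrite lE derive1E; exact: derivableP.
have := is_derive1_comp dGl dl => -[d1 d2]; apply: DeriveDef.
  exact: ((derivable1P (G \o f) x v).2 d1).
by rewrite -d2 -(derive_line (G \o f)).
Qed.

Lemma Ck_pred k f : Ck k.+1 f -> Ck k f.
Proof.
elim: k f => [|k IH] f [cf hf]; first by split.
by split => // i; have [df Cf] := hf i; split => //; exact: IH.
Qed.

Lemma partialD i f g :
  (forall x, derivable f x (delta_mx 0 i)) ->
  (forall x, derivable g x (delta_mx 0 i)) ->
  partial i (f \+ g) = partial i f \+ partial i g.
Proof. by move=> df dg; apply/funext => x; rewrite /partial deriveD. Qed.

Lemma partialM i f g :
  (forall x, derivable f x (delta_mx 0 i)) ->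
  (forall x, derivable g x (delta_mx 0 i)) ->
  partial i (f \* g) = (f \* partial i g) \+ (g \* partial i f).
Proof. by move=> df dg; apply/funext => x; rewrite /partial deriveM. Qed.

Lemma partial_comp i (G : R -> R) f :
  (forall x, derivable f x (delta_mx 0 i)) -> (forall t, derivable G t 1) ->
  partial i (G \o f) = ((derive1 G) \o f) \* partial i f.
Proof.
move=> df dG; apply/funext => x.
by have [_ h] := is_derive_comp1 (df x) (dG (f x)); rewrite /partial h.
Qed.

Lemma CkD k f g : Ck k f -> Ck k g -> Ck k (f \+ g).
Proof.
elim: k f g => [|k IH] f g [cf hf] [cg hg].
  by split => // x; apply: continuousD; [exact: cf|exact: cg].
split; first by move=> x; apply: continuousD; [exact: cf|exact: cg].
move=> i; have [df Cf] := hf i; have [dg Cg] := hg i; split.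
  by move=> x; exact: derivableD.
by rewrite partialD//; exact: IH.
Qed.

Lemma CkM k f g : Ck k f -> Ck k g -> Ck k (f \* g).
Proof.
elim: k f g => [|k IH] f g hf hg.
  by split => // x; apply: continuousM; [exact: hf.1|exact: hg.1].
split; first by move=> x; apply: continuousM; [exact: hf.1|exact: hg.1].
move=> i; have [df Cf] := hf.2 i; have [dg Cg] := hg.2 i; split.
  by move=> x; exact: derivableM.
by rewrite partialM//; apply: CkD; apply: IH => //; exact: Ck_pred.
Qed.

Lemma Ck_cst k (c : R) : Ck k (cst c : 'rV[R]_n -> R).
Proof.
elim: k c => [|k IH] c; first by split => //; exact: cst_continuous.
split; first exact: cst_continuous.
move=> i; split; first by move=> x; exact: derivable_cst.
rewrite (_ : partial i _ = cst 0); first exact: IH.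
by apply/funext => x; rewrite /partial derive_cst.
Qed.

Definition smooth (G : R -> R) := forall k t, derivable (derive1n k G) t 1.

Lemma smooth_derivable G : smooth G -> forall t, derivable G t 1.
Proof. by move=> sG; exact: (sG 0). Qed.

Lemma derivable1_continuous (G : R -> R) :
  (forall t, derivable G t 1) -> continuous G.
Proof.
move=> dG t; exact/differentiable_continuous/derivable1_diffP.
Qed.

Lemma smooth_continuous G : smooth G -> continuous G.
Proof. by move=> /smooth_derivable/derivable1_continuous. Qed.

Lemma smooth_derive1 G : smooth G -> smooth (derive1 G).
Proof. by move=> sG k t; rewrite -derive1Sn; exact: (sG k.+1). Qed.

Lemma derive1_smooth (G g : R -> R) :
  (forall t, is_derive t (1 : R) G (g t)) -> smooth g -> smooth G.
Proof.
move=> dG sg [|k] t; first by have [] := dG t.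
rewrite derive1Sn (_ : (derive1 G) = g)//.
by apply/funext => s; rewrite derive1E; have [] := dG s.
Qed.

Lemma Ck_comp k (G : R -> R) f : smooth G -> Ck k f -> Ck k (G \o f).
Proof.
elim: k G f => [|k IH] G f sG hf.
  split => // x; apply: continuous_comp; first exact: hf.1.
  exact: smooth_continuous.
split.
  move=> x; apply: continuous_comp; first exact: hf.1.
  exact: smooth_continuous.
move=> i; have [df Cf] := hf.2 i; split.
  move=> x; have dG : derivable G (f x) 1 by exact: smooth_derivable.
  by have [] := is_derive_comp1 (df x) dG.
rewrite partial_comp//; last exact: smooth_derivable.
apply: CkM => //; apply: IH; first exact: smooth_derive1.
exact: Ck_pred.
Qed.

Lemma is_derive_coord (i : 'I_n) (x v : 'rV[R]_n) :
  is_derive x v (fun y : 'rV[R]_n => y 0 i) (v 0 i).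
Proof.
have := @derivable_id R R 0 1; move=> _.
have h :
    (fun h : R => h^-1 *: (((fun y : 'rV[R]_n => y 0 i) \o shift x) (h *: v) - x 0 i))
      @ 0^' --> v 0 i.
  apply: (@cvg_trans _ ((cst (v 0 i) : R -> R) @ (0:R)^')); last exact: cvg_cst.
  apply: near_eq_cvg; near=> h => /=.
  rewrite !mxE addrK scalerA mulVf ?scale1r//.
  by near: h; exact: nbhs_dnbhs_neq.
by apply: DeriveDef; [exact: cvgP h|exact: cvg_lim h].
Unshelve. all: by end_near. Qed.

Lemma Ck_coord k (i : 'I_n) : Ck k (fun x : 'rV[R]_n => x 0 i).
Proof.
have cc : continuous (fun x : 'rV[R]_n => x 0 i) by exact: coord_continuous.
case: k => [|k]; first by split.
split => // j; split.
  by move=> x; have [] := is_derive_coord i x (delta_mx 0 j).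
rewrite (_ : partial j _ = cst ((delta_mx 0 j : 'rV[R]_n) 0 i)); first exact: Ck_cst.
by apply/funext => x; have [_] := is_derive_coord i x (delta_mx 0 j).
Qed.

Lemma Ck_prod k (I : Type) (r : seq I) (F : I -> 'rV[R]_n -> R) :
  (forall i, Ck k (F i)) -> Ck k (fun x => \prod_(i <- r) F i x).
Proof.
move=> hF; elim: r => [|i r IH].
  rewrite (_ : (fun _ => _) = cst 1); first exact: Ck_cst.
  by apply/funext => x; rewrite big_nil.
rewrite (_ : (fun _ => _) = F i \* (fun x => \prod_(j <- r) F j x)).
  exact: CkM.
by apply/funext => x; rewrite big_cons.
Qed.

End Ck_theory.

(** * Test functions and the fundamental lemma *)

Section integration_by_parts.
Variable R : realType.

Lemma continuous_rV (T : topologicalType) n (f : T -> 'rV[R]_n) :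
  (forall i, continuous (fun x => f x 0 i)) -> continuous f.
Proof.
move=> cf x; apply/cvg_ballP => e e0.
have h : \forall y \near x, forall i : 'I_n, ball (f x 0 i) e (f y 0 i).
  apply: filter_forall => i.
  exact: (cvg_ball (cf i x) e0).
near=> y; split => // i0 i; rewrite (ord1 i0).
by move: i; near: y.
Unshelve. all: by end_near. Qed.

Lemma continuous_consrVl n (v : 'rV[R]_n) :
  continuous (fun t : R => consrV (t, v)).
Proof.
apply: continuous_rV => i t; case: (unliftP ord0 i) => [j|] ->.
  rewrite (_ : (fun _ => _) = cst (v 0 j)); first exact: cst_continuous.
  by apply/funext => s; rewrite consrVES.
rewrite (_ : (fun _ => _) = id); first exact: cvg_id.
by apply/funext => s; rewrite consrVE0.
Qed.

Lemma continuous_consrVr n (t : R) :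
  continuous (fun v : 'rV[R]_n => consrV (t, v)).
Proof.
apply: continuous_rV => i v; case: (unliftP ord0 i) => [j|] ->.
  rewrite (_ : (fun _ => _) = (fun v : 'rV[R]_n => v 0 j)).
    exact: coord_continuous.
  by apply/funext => s; rewrite consrVES.
rewrite (_ : (fun _ => _) = cst t); first exact: cst_continuous.
by apply/funext => s; rewrite consrVE0.
Qed.

Lemma consrV_addl n (h t : R) (v : 'rV[R]_n) :
  consrV (h *: (1 : R) + t, v) = h *: delta_mx 0 ord0 + consrV (t, v).
Proof.
apply/rowP => i; have -> : (h *: delta_mx 0 ord0 + consrV (t, v)) 0 i =
   h * (i == ord0)%:R + (consrV (t, v) : 'rV[R]_n.+1) 0 i by rewrite 3!mxE.
case: (unliftP ord0 i) => [j|] ->.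
  by rewrite !consrVES /= mulr0 add0r.
by rewrite !consrVE0 !eqxx.
Qed.

Lemma consrV_addr n (h t : R) (v : 'rV[R]_n) (j : 'I_n) :
  consrV (t, h *: delta_mx 0 j + v) = h *: delta_mx 0 (lift ord0 j) + consrV (t, v).
Proof.
apply/rowP => i; have -> : (h *: delta_mx 0 (lift ord0 j) + consrV (t, v)) 0 i =
   h * (i == lift ord0 j)%:R + (consrV (t, v) : 'rV[R]_n.+1) 0 i by rewrite 3!mxE.
case: (unliftP ord0 i) => [k|] ->.
  by rewrite !consrVES /= !mxE eqxx /= (inj_eq lift_inj).
by rewrite !consrVE0 /= mulr0 add0r.
Qed.

Lemma partial_eq0 n (i : 'I_n) (f : 'rV[R]_n -> R) x :
  (\forall y \near x, f y = 0) -> partial i f x = 0.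
Proof.
move=> f0; rewrite /partial (near_eq_derive _ (g := cst 0)) ?derive_cst//.
Qed.

Lemma integrable_bounded_support n (g : 'rV[R]_n -> R) (a b : 'rV[R]_n) :
  continuous g -> (forall x, ~ cbox a b x -> g x = 0) ->
  (lebesgue_rV R n).-integrable setT (EFin \o g).
Proof.
move=> cg g0.
have /compact_bounded[M [_ hM]] : compact (g @` cbox a b).
  apply: continuous_compact; last exact: cbox_compact.
  exact: continuous_subspaceT.
pose K := Num.max M 0 + 1.
have MK : M < K by rewrite /K ltr_pwDr// le_max lexx.
have gK x : `|g x| <= K.
  have [xc|/g0 ->] := pselect (cbox a b x); last first.
    by rewrite normr0 /K addr_ge0// le_max lexx orbT.
  by apply: (hM _ MK); exists x.
(* Enlarging by 1 makes an open box, whose volume is known to be finite, contain the closed box that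
   carries [g]. *)
pose Q := obox (a - const_mx 1) (b + const_mx 1).
have mQ : measurable Q by exact: measurable_obox.
have : (lebesgue_rV R n).-integrable setT (EFin \o (cst K \_ Q)).
  rewrite -restrict_EFin; apply/integrable_restrict => //.
  rewrite setTI.
  apply/integrableP; split; first by apply/measurable_EFinP; exact: measurable_cst.
  rewrite (eq_integral (cst `|K|%:E))// integral_cst//= lte_mul_pinfty//.
  exact: obox_measure_lty.
apply: le_integrable => //.
  by apply/measurable_EFinP; exact: continuous_measurable_rV.
move=> x _ /=; rewrite lee_fin patchE; case: ifPn => [_|].
  by rewrite (le_trans (gK x))// ler_norm.
rewrite notin_setE => xQ; rewrite g0 ?normr0// => xc; apply: xQ => i.
by have := xc i; rewrite !mxE; lra.
Qed.

(** The measure on R^(n+1) is by construction the image of a product measure, so the change of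
    variables for image measures applies: to |g| for integrability, then to g for the value. *)
Lemma integral_rVS n (g : 'rV[R]_n.+1 -> R) :
  measurable_fun setT g ->
  (lebesgue_rV R n.+1).-integrable setT (EFin \o g) ->
  ((@lebesgue_measure R) \x lebesgue_rV R n)%E.-integrable setT
     (EFin \o (g \o @consrV R n)) /\
  (\int[lebesgue_rV R n.+1]_x (g x)%:E =
   \int[(@lebesgue_measure R) \x lebesgue_rV R n]_p (g (consrV p))%:E)%E.
Proof.
move=> mg ig.
have i1 : ((@lebesgue_measure R) \x lebesgue_rV R n)%E.-integrable setT
     (EFin \o (g \o @consrV R n)).
  apply/integrableP; split.
    by apply/measurable_EFinP; apply: measurableT_comp => //; exact: measurable_consrV.
  have /integrableP[_] := ig.
  rewrite (_ : (\int[lebesgue_rV R n.+1]_x _)%E =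
    (\int[(@lebesgue_measure R) \x lebesgue_rV R n]_p `|(g (consrV p))%:E|)%E)//.
  have := @ge0_integral_pushforward _ _ _ _ _ _ (@measurable_consrV R n)
    ((@lebesgue_measure R) \x lebesgue_rV R n)%E setT (fun x => `|(g x)%:E|%E).
  rewrite preimage_setT; apply => //.
  by apply/measurable_EFinP; exact: measurableT_comp.
split => //.
have := @integral_pushforward _ _ _ _ _ _ (@measurable_consrV R n)
    ((@lebesgue_measure R) \x lebesgue_rV R n)%E setT (EFin \o g).
rewrite preimage_setT; apply => //.
exact/measurable_EFinP.
Qed.

Lemma integral_derive_cpt (F : R -> R) (f : R -> R) (L : R) : 0 < L ->
  (forall t, is_derive t (1 : R) F (f t)) -> continuous f ->
  (forall t, ~ (- L <= t <= L) -> F t = 0 /\ f t = 0) ->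
  (\int[@lebesgue_measure R]_t (f t)%:E)%E = 0%E.
Proof.
move=> L0 dF cf F0.
have cF : continuous F by apply: derivable1_continuous => t; have [] := dF t.
(* The interval exceeds [-L, L] by one unit on each side, so that F is known to vanish at its
   endpoints. *)
have -> : (\int[@lebesgue_measure R]_t (f t)%:E =
           \int[@lebesgue_measure R]_(t in `[(- (L + 1))%R, (L + 1)%R]) (f t)%:E)%E.
  rewrite [RHS]integral_mkcond; apply: eq_integral => t _.
  rewrite patchE; case: ifPn => //; rewrite notin_setE /= in_itv/= => h.
  by rewrite (F0 t _).2// => h'; apply: h; lra.
rewrite (@continuous_FTC2 _ f F).
- have [-> _] := F0 (L + 1) ltac:(lra).
  have [-> _] := F0 (- (L + 1)) ltac:(lra).
  by rewrite sube0.
- lra.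
- exact: continuous_subspaceT.
- split.
  + by move=> t _; have [] := dF t.
  + exact: cvg_at_right_filter (cF _).
  + exact: cvg_at_left_filter (cF _).
- by move=> t _; rewrite derive1E; have [] := dF t.
Qed.

(** Fubini and induction on the dimension. If [i] is the first coordinate it is integrated
    innermost, where the fundamental theorem of calculus gives 0; otherwise the inner integral over
    the last n coordinates vanishes by induction on each slice. *)
Lemma integral_partial n (i : 'I_n) (f : 'rV[R]_n -> R) (L : R) : 0 < L ->
  (forall x, derivable f x (delta_mx 0 i)) -> continuous (partial i f) ->
  (forall x, ~ cbox (const_mx (- L)) (const_mx L) x -> f x = 0) ->
  (\int[lebesgue_rV R n]_x (partial i f x)%:E)%E = 0%E.
Proof.
elim: n i f => [|n IH] i f; first by case: i.
move=> L0 df cf f0.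
have pf0 x : ~ cbox (const_mx (- L)) (const_mx L) x -> partial i f x = 0.
  move=> xL; apply: partial_eq0.
  have : open_nbhs x (~` cbox (const_mx (- L)) (const_mx L)).
    by split => //; apply: closed_openC; exact: cbox_closed.
  by move=> /open_nbhs_nbhs; apply: filterS => y yL; exact: f0.
have mp := continuous_measurable_rV cf.
have [i1 ->] := integral_rVS mp (integrable_bounded_support cf pf0).
have outl t v : ~ (- L <= t <= L) ->
    ~ cbox (const_mx (- L)) (const_mx L) (consrV (t, v) : 'rV[R]_n.+1).
  by move=> h /(_ ord0); rewrite consrVE0 !mxE.
have outr t (v : 'rV[R]_n) : ~ cbox (const_mx (- L)) (const_mx L) v ->
    ~ cbox (const_mx (- L)) (const_mx L) (consrV (t, v) : 'rV[R]_n.+1).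
  move=> h h'; apply: h => j; have := h' (lift ord0 j).
  by rewrite consrVES !mxE.
case: (unliftP ord0 i) => [j|] ij.
  rewrite -(integral12_prod_meas1 i1) /fubini_F.
  apply: integral0_eq => t _ /=.
  pose ft := f \o (fun v => consrV (t, v)).
  have E (v : 'rV[R]_n) : 'D_(delta_mx 0 j) ft v = 'D_(delta_mx 0 i) f (consrV (t, v)) /\
      (derivable ft v (delta_mx 0 j) <-> derivable f (consrV (t, v)) (delta_mx 0 i)).
    by apply: eq_derive_line => h; rewrite ij -consrV_addr.
  have pE : partial i f \o (fun v => consrV (t, v)) = partial j ft.
    by apply/funext => v; rewrite /partial (E v).1.
  rewrite -[RHS](IH j ft L0).
  - by rewrite -pE.
  - by move=> v; apply: (E v).2.2.
  - rewrite -pE => v; apply: continuous_comp; last exact: cf.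
    exact: continuous_consrVr.
  - by move=> v vL /=; apply: f0; exact: outr.
rewrite -(integral21_prod_meas1 i1) /fubini_G.
apply: integral0_eq => v _ /=.
pose fv (t : R) := f (consrV (t, v)).
have E (t : R) : 'D_1 fv t = 'D_(delta_mx 0 i) f (consrV (t, v)) /\
    (derivable fv t 1 <-> derivable f (consrV (t, v)) (delta_mx 0 i)).
  by apply: eq_derive_line => h; rewrite /fv ij -consrV_addl.
apply: (@integral_derive_cpt fv _ L) => //.
- by move=> t; have [? h] := E t; apply: DeriveDef => //; exact: h.2.
- move=> t; apply: continuous_comp; last exact: cf.
  exact: continuous_consrVl.
- by move=> t tL; split; [apply: f0|apply: pf0]; exact: outl.
Qed.

End integration_by_parts.

(** * Primitives vanishing on the negative half-line, and smooth cutoffs *)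

Section left_primitive.
Variable R : realType.
Local Notation leb := (@lebesgue_measure R).
Implicit Types (g : R -> R).

(** For t < 0 the interval is empty and the value is 0, so no sign convention intervenes. It agrees
    with [primitive] when g vanishes on the negative half-line. *)
Definition lprim g (t : R) : R := \int[leb]_(s in `[0, t]) g s.

Lemma lprimE g c t : c <= 0 -> (forall s, s <= 0 -> g s = 0) ->
  lprim g t = \int[leb]_(s in `[c, t]) g s.
Proof.
move=> c0 g0; rewrite /lprim Rintegral_mkcond [RHS]Rintegral_mkcond.
congr (Rintegral _ _ _); apply/funext => s; rewrite !patchE !mem_setE !in_itv/=.
case: (leP 0 s) => [s0|/ltW s0] /=; first by rewrite (le_trans c0 s0).
by case: ifP => // _; rewrite g0.
Qed.

Lemma primitiveE g t : (forall s, s <= 0 -> g s = 0) -> primitive g t = lprim g t.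
Proof.
move=> g0; rewrite /primitive; case: (leP 0 t) => // t0.
rewrite /lprim [in RHS]set_itv_ge ?bnd_simp -?ltNge// Rintegral_set0.
rewrite (@eq_Rintegral _ _ _ _ _ (cst 0)) ?Rintegral_cst//= ?mul0r ?oppr0//.
by move=> s; rewrite inE/= in_itv/= => /andP[_ s0]; rewrite g0.
Qed.

Lemma lprim_le0 g t : t <= 0 -> lprim g t = 0.
Proof.
rewrite le_eqVlt => /predU1P[->|t0].
  by rewrite /lprim set_itv1 Rintegral_set1.
by rewrite /lprim set_itv_ge ?bnd_simp -?ltNge// Rintegral_set0.
Qed.

Lemma is_derive_lprim g t : continuous g -> (forall s, s <= 0 -> g s = 0) ->
  is_derive t (1 : R) (lprim g) (g t).
Proof.
(* The fundamental theorem needs a lower endpoint strictly left of [t]. As g vanishes for s <= 0,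
   the endpoint 0 can be lowered to any c <= 0, which also covers t <= 0. *)
move=> cg g0; pose c := Num.min t 0 - 1.
have [c0 ct] : c <= 0 /\ c < t by rewrite /c; case: (leP t 0); lra.
have -> : lprim g = (fun x => \int[leb]_(s in `[c, x]) g s).
  by apply/funext => x; exact: lprimE.
have tt : t < t + 1 by rewrite ltrDl.
have ig : leb.-integrable [set` Interval (BLeft c) (BRight (t + 1))] (EFin \o g).
  apply: continuous_compact_integrable; first exact: segment_compact.
  exact: continuous_subspaceT.
have [] := @continuous_FTC1 R g (BLeft c) t (t + 1) tt ig _ (cg t).
  by rewrite lte_fin.
by move=> d1 d2; exact: (DeriveDef d1 (etrans (esym (derive1E _ _)) d2)).
Qed.

End left_primitive.

Section cutoff.
Variables (R : realType) (beta : R -> R).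
Hypothesis beta_adm : admissible_beta beta.
Local Notation B := (lprim beta).

Lemma beta_smooth : smooth beta. Proof. by case: beta_adm. Qed.

Lemma beta_ge0 t : 0 <= beta t.
Proof. by case: beta_adm => _ /(_ t)/andP[]. Qed.

Lemma beta_le2 t : beta t <= 2.
Proof. by case: beta_adm => _ /(_ t)/andP[]. Qed.

Lemma beta_le0 t : t <= 0 -> beta t = 0.
Proof. by case: beta_adm => _ _ h _ _ t0; apply: h; left. Qed.

Lemma is_derive_B t : is_derive t (1 : R) B (beta t).
Proof.
apply: is_derive_lprim; first exact: smooth_continuous beta_smooth.
exact: beta_le0.
Qed.

Lemma smooth_B : smooth B.
Proof. exact: derive1_smooth is_derive_B beta_smooth. Qed.

Lemma B_le0 t : t <= 0 -> B t = 0. Proof. exact: lprim_le0. Qed.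

Lemma B_ndecr s t : s <= t -> B s <= B t.
Proof.
move=> st.
have cB : {within `[s, t], continuous B}.
  by apply: continuous_subspaceT; exact: smooth_continuous smooth_B.
have [c _ h] := MVT_segment st (fun x _ => is_derive_B x) cB.
by rewrite -subr_ge0 h mulr_ge0 ?beta_ge0 ?subr_ge0.
Qed.

Lemma B_ge1 t : 1 <= t -> B t = 1.
Proof.
move=> t1; have [_ _ b0 _ <-] := beta_adm.
rewrite /lprim Rintegral_mkcond [RHS]Rintegral_mkcond.
congr (Rintegral _ _ _); apply/funext => s; rewrite !patchE !mem_setE !in_itv/=.
case: (leP 0 s) => //= s0; case: (leP s 1) => s1; first by rewrite (le_trans s1 t1).
by case: ifP => // _; rewrite b0//; right; exact: ltW.
Qed.

Lemma B_ge0 t : 0 <= B t.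
Proof.
case: (leP t 0) => [/B_le0 -> //|/ltW t0].
by rewrite -(B_le0 (lexx 0)); exact: B_ndecr.
Qed.

Lemma B_le1 t : B t <= 1.
Proof.
case: (leP 1 t) => [/B_ge1 -> //|/ltW t0].
by rewrite -(B_ge1 (lexx 1)); exact: B_ndecr.
Qed.

Lemma B_lip s t : s <= t -> B t - B s <= 2 * (t - s).
Proof.
move=> st.
have cB : {within `[s, t], continuous B}.
  by apply: continuous_subspaceT; exact: smooth_continuous smooth_B.
have [c _ ->] := MVT_segment st (fun x _ => is_derive_B x) cB.
by rewrite ler_wpM2r ?beta_le2 ?subr_ge0.
Qed.

End cutoff.

Section smooth_affine.
Variable R : realType.

Lemma is_derive_affine (a b t : R) : is_derive t (1 : R) (fun t : R => a * t + b) a.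
Proof.
have := is_deriveD (is_deriveZ a (is_derive_id t (1 : R))) (is_derive_cst b t (1 : R)).
by rewrite addr0 [a *: _]mulr1.
Qed.

Lemma smooth_affine (G : R -> R) (a b : R) : smooth G -> smooth (fun t => G (a * t + b)).
Proof.
(* Each differentiation brings out a factor [a], so the induction on the order must carry an
   arbitrary constant multiple. *)
suff H k c F : smooth F ->
    forall t, derivable (derive1n k (fun t => c * F (a * t + b))) t 1.
  move=> sG k; rewrite (_ : (fun _ => _) = (fun t => 1 * G (a * t + b))); first exact: H.
  by apply/funext => t; rewrite mul1r.
elim: k c F => [|k IH] c {}G sG t.
  have := smooth_derivable sG => /(_ (a * t + b)) dG.
  have dl : is_derive t (1 : R) (fun t : R => a * t + b) a.
    exact: is_derive_affine.
  have [d1 d2] := @is_derive_comp1 _ _ (fun t => a * t + b) G t 1 (@ex_derive _ _ _ _ _ _ _ dl) dG.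
  exact: (derivableM (derivable_cst c t 1) d1).
rewrite derive1Sn (_ : derive1 _ = (fun t => (c * a) * (derive1 G) (a * t + b))).
  by apply: IH; exact: smooth_derive1.
apply/funext => s; have := smooth_derivable sG => /(_ (a * s + b)) dG.
have dl : is_derive s (1 : R) (fun t : R => a * t + b) a.
  exact: is_derive_affine.
have [d1 d2] := @is_derive_comp1 _ _ (fun t => a * t + b) G s 1 (@ex_derive _ _ _ _ _ _ _ dl) dG.
rewrite derive1E; transitivity (c * 'D_1 (G \o (fun t : R => a * t + b)) s).
  exact: (deriveMl c d1).
by rewrite d2; case: dl => _ ->; rewrite [RHS]mulrAC -mulrA.
Qed.

End smooth_affine.

Section test_functions.
Variables (R : realType) (n : nat) (Omega : set 'rV[R]_n).
Local Notation mu := (lebesgue_rV R n).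
Implicit Types (phi psi f : 'rV[R]_n -> R).

Lemma test_functionI phi (K : set 'rV[R]_n) : (forall k, Ck k phi) ->
  compact K -> K `<=` Omega -> (forall x, ~ K x -> phi x = 0) ->
  test_function Omega phi.
Proof.
move=> Cphi cK KO phi0.
have clK : closed K by apply: compact_closed => //; exact: norm_hausdorff.
have sub : closure [set x | phi x != 0] `<=` K.
  rewrite [X in _ `<=` X](closure_id K).1//; apply: closure_subset => x /= /eqP h.
  by apply: contrapT => /phi0.
split => //; last exact: subset_trans KO.
by apply: (subclosed_compact _ cK sub); exact: closed_closure.
Qed.

Lemma test_functionE phi : test_function Omega phi ->
  [/\ forall k, Ck k phi &
   exists K, [/\ compact K, K `<=` Omega & forall x, ~ K x ->
     phi x = 0 /\ forall i, partial i phi x = 0]].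
Proof.
move=> [Cphi cK KO]; split => //; exists (closure [set x | phi x != 0]); split => // x xK.
have h : \forall y \near x, phi y = 0.
  have : open_nbhs x (~` closure [set x | phi x != 0]).
    by split => //; apply: closed_openC; exact: closed_closure.
  move=> /open_nbhs_nbhs; apply: filterS => y yK; apply/eqP; apply: contra_notT yK => h.
  exact: subset_closure.
by split; [exact: nbhs_singleton h|move=> i; exact: partial_eq0].
Qed.

Lemma test_function_cst0 : test_function Omega (cst 0).
Proof. by apply: (test_functionI (K := set0)) => // [k|]; [exact: Ck_cst|exact: compact0]. Qed.

Lemma test_functionD phi psi : test_function Omega phi -> test_function Omega psi ->
  test_function Omega (phi \+ psi).
Proof.
move=> /test_functionE[C1 [K1 [cK1 K1O h1]]] /test_functionE[C2 [K2 [cK2 K2O h2]]].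
apply: (test_functionI (K := K1 `|` K2)).
- by move=> k; apply: CkD.
- exact: compactU.
- by rewrite subUset.
- move=> x /not_orP[x1 x2] /=; rewrite (h1 x x1).1 (h2 x x2).1 addr0//.
Qed.

Lemma test_functionM phi f : test_function Omega phi -> (forall k, Ck k f) ->
  test_function Omega (phi \* f).
Proof.
move=> /test_functionE[C1 [K1 [cK1 K1O h1]]] Cf.
apply: (test_functionI (K := K1)) => // [k|x xK]; first exact: CkM.
by rewrite /= (h1 x xK).1 mul0r.
Qed.

Lemma test_functionZ c phi : test_function Omega phi ->
  test_function Omega (fun x => c * phi x).
Proof.
move=> tphi; rewrite (_ : (fun _ => _) = phi \* cst c).
  by apply: test_functionM => // k; exact: Ck_cst.
by apply/funext => x /=; rewrite mulrC.
Qed.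

Lemma test_function_comp (G : R -> R) phi : smooth G -> G 0 = 0 ->
  test_function Omega phi -> test_function Omega (G \o phi).
Proof.
move=> sG G0 /test_functionE[C1 [K1 [cK1 K1O h1]]].
apply: (test_functionI (K := K1)) => // [k|x xK]; first exact: Ck_comp.
by rewrite /= (h1 x xK).1.
Qed.

Lemma test_function_partial phi i : test_function Omega phi ->
  test_function Omega (partial i phi).
Proof.
move=> /test_functionE[C1 [K1 [cK1 K1O h1]]].
apply: (test_functionI (K := K1)) => // [k|x xK]; last by rewrite (h1 x xK).2.
by have [_ /(_ i)[]] := C1 k.+1.
Qed.

Lemma test_function_derivable phi i x : test_function Omega phi ->
  derivable phi x (delta_mx 0 i).
Proof. by move=> [/(_ 1%N)[_ /(_ i)[]]]. Qed.

Lemma test_function_continuous phi : test_function Omega phi -> continuous phi.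
Proof. by move=> [/(_ 0%N)[]]. Qed.

Lemma test_function_cbox phi : test_function Omega phi ->
  exists2 L : R, 0 < L & forall x, ~ cbox (const_mx (- L)) (const_mx L) x -> phi x = 0.
Proof.
move=> /test_functionE[_ [K [/compact_bounded/bounded_sub_cbox[L L0 KL] _ h]]].
by exists L => // x xL; apply: (h x _).1; apply: contra_not xL => /KL.
Qed.

Lemma test_function_integrable phi : test_function Omega phi ->
  mu.-integrable setT (EFin \o phi).
Proof.
move=> tphi; have [L L0 h] := test_function_cbox tphi.
exact: (integrable_bounded_support (test_function_continuous tphi) h).
Qed.

Lemma test_function_measurable phi D : test_function Omega phi -> measurable D ->
  measurable_fun D phi.
Proof.
move=> /test_function_continuous/continuous_measurable_rV mphi mD.
exact: measurable_funS mphi.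
Qed.

Lemma test_function_Rintegral phi : test_function Omega phi ->
  \int[mu]_(x in Omega) phi x = \int[mu]_x phi x.
Proof.
move=> /test_functionE[_ [K [_ KO h]]].
rewrite Rintegral_mkcond; congr (Rintegral _ _ _); apply/funext => x.
rewrite patchE; case: ifPn => //; rewrite notin_setE => xO.
by rewrite (h x _).1// => /KO.
Qed.

(** The product of two test functions has compact support, so its partial derivative has integral
    zero; the product rule splits that integral into the two sides. *)
Lemma test_function_weak_partial phi i : test_function Omega phi ->
  is_weak_partial Omega i phi (partial i phi).
Proof.
move=> tphi psi tpsi.
have t1 : test_function Omega (phi \* partial i psi).
  by apply: test_functionM => // k; have [+ _ _] := test_function_partial i tpsi.
have t2 : test_function Omega (partial i phi \* psi).
  by apply: test_functionM => [|k]; [exact: test_function_partial|have [] := tpsi].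
have t12 : test_function Omega (phi \* psi).
  by apply: test_functionM => // k; have [] := tpsi.
rewrite (test_function_Rintegral t1) (test_function_Rintegral t2).
apply/eqP; rewrite -addr_eq0 -RintegralD//; do ?exact: test_function_integrable.
have [L L0 h] := test_function_cbox t12.
have d12 x : derivable (phi \* psi) x (delta_mx 0 i) by exact: test_function_derivable.
have := @integral_partial _ _ i _ L L0 d12
   (test_function_continuous (test_function_partial i t12)) h.
move=> E; apply/eqP; rewrite -[RHS](congr1 fine E) /Rintegral; congr fine.
apply: eq_integral => x _; congr EFin; rewrite partialM; last 2 first.
- by move=> y; exact: test_function_derivable.
- by move=> y; exact: test_function_derivable.
by rewrite /= [psi x * _]mulrC.
Qed.

End test_functions.

(** * The fundamental lemma of the calculus of variations *)

Section rV_orthants.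
Variables (R : realType) (n : nat).

Definition orthant (c : 'rV[R]_n) : set 'rV[R]_n := [set x | forall i, c 0 i < x 0 i].

Lemma measurable_orthant c : measurable (orthant c).
Proof.
rewrite (_ : orthant c = \bigcap_(i in [set: 'I_n])
    ((fun x : 'rV[R]_n => x 0 i : measurableTypeR R) @^-1` `]c 0 i, +oo[)).
  apply: fin_bigcap_measurable => [|i _]; first exact: (@finite_finset _ setT).
  rewrite -[X in measurable X]setTI.
  exact: (measurable_coord i measurableT (measurable_itv _)).
apply/seteqP; split=> [x Bx i _|x Bx i].
  by rewrite /= in_itv/= andbT; exact: Bx.
by have := Bx i Logic.I; rewrite /= in_itv/= andbT.
Qed.

(** Orthants are chosen as generators because the intersection of two of them is an orthant, as
    Dynkin's theorem requires, and because an orthant meets a box in a box. *)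
Lemma measurable_rV_orthants :
  (@measurable _ 'rV[R]_n) = <<s [set A | exists c, A = orthant c] >>.
Proof.
apply/seteqP; split; last first.
  apply: smallest_sub; first exact: sigma_algebra_measurable.
  by move=> _ [c ->]; exact: measurable_orthant.
apply: smallest_sub; first exact: smallest_sigma_algebra.
set S := <<s _ >>.
have sS : sigma_algebra setT S by exact: smallest_sigma_algebra.
have [S0 SC SU] := sS.
have SC' A : S A -> S (~` A) by move=> SA; rewrite -setTD; exact: SC.
have SU' (F : nat -> set 'rV[R]_n) : (forall k, S (F k)) -> S (\bigcup_k F k) by exact: SU.
rewrite -bigcup_seq => A [i _ [C mC <-]] /=; rewrite setTI.
suff : @measurable _ (measurableTypeR R) `<=`
    [set C | S ((fun x : 'rV[R]_n => x 0 i) @^-1` C)] by apply.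
have -> : @measurable _ (measurableTypeR R) = (@RGenOInfty.G R).-sigma.-measurable.
  exact: RGenOInfty.measurableE.
apply: smallest_sub.
  split => /=.
  - by rewrite preimage_set0.
  - by move=> B SB; rewrite setTD preimage_setC; exact: SC'.
  - by move=> F SF; rewrite preimage_bigcup; exact: SU'.
move=> _ [a ->] /=.
(* A half-space in direction [i] is the union of the orthants whose other lower bounds are -k; a
   point lies in one of them as soon as k exceeds the absolute values of its coordinates. *)
rewrite (_ : _ @^-1` _ = \bigcup_k
    orthant (\row_j (if j == i then a else - k%:R))).
  by apply: SU' => k; apply: sub_gen_smallest; eexists.
apply/seteqP; split => [x /=|x [k _ /(_ i)]]; last first.
  by rewrite mxE eqxx /= in_itv/= andbT.
rewrite in_itv/= andbT => ax.
pose m := (\max_(j < n) Num.bound `|x 0%R j|)%N.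
exists m => // j; rewrite mxE; case: eqP => [->//|_].
have := @leq_bigmax _ (fun j : 'I_n => Num.bound `|x 0 j|) j; rewrite -/m.
rewrite -(ler_nat R) => h.
rewrite ltrNl; apply: lt_le_trans h.
apply: le_lt_trans (archi_boundP (normr_ge0 _)).
by rewrite -normrN ler_norm.
Qed.

End rV_orthants.

Section fundamental_lemma.
Variables (R : realType) (n : nat) (Omega : set 'rV[R]_n) (beta : R -> R).
Hypotheses (oO : open Omega) (beta_adm : admissible_beta beta).
Local Notation mu := (lebesgue_rV R n).
Local Notation B := (lprim beta).

Let mO : measurable Omega. Proof. exact: open_measurable_rV. Qed.

(** A smoothed indicator of the open box: each factor rises from 0 to 1 over a length 1/k inside the
    box, so the product vanishes off the open box and tends to its indicator. *)
Definition box_cutoff (a b : 'rV[R]_n) (k : nat) (x : 'rV[R]_n) : R :=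
  \prod_(i < n) (B (k%:R * (x 0 i - a 0 i)) * B (k%:R * (b 0 i - x 0 i))).

Lemma box_cutoff_eq0 a b k x : ~ obox a b x -> box_cutoff a b k x = 0.
Proof.
move=> /existsNP[i h]; rewrite /box_cutoff (bigD1 i)//=.
suff -> : B (k%:R * (x 0 i - a 0 i)) * B (k%:R * (b 0 i - x 0 i)) = 0 by rewrite mul0r.
have [ax|xa] := ltP (a 0 i) (x 0 i).
  have bx : b 0 i <= x 0 i.
    by rewrite leNgt; apply/negP => xb; apply: h; rewrite ax.
  by rewrite [X in _ * X]lprim_le0 ?mulr0// mulr_ge0_le0// subr_le0.
by rewrite lprim_le0 ?mul0r// mulr_ge0_le0// subr_le0.
Qed.

Lemma box_cutoff_01 a b k x : 0 <= box_cutoff a b k x <= 1.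
Proof.
rewrite /box_cutoff; apply: (big_ind (fun y : R => 0 <= y <= 1)).
- by rewrite ler01 lexx.
- by move=> y z /andP[y0 y1] /andP[z0 z1]; rewrite mulr_ge0// mulr_ile1.
- move=> i _; rewrite mulr_ge0 ?(B_ge0 beta_adm)//.
  by rewrite mulr_ile1 ?(B_ge0 beta_adm) ?(B_le1 beta_adm).
Qed.

Lemma box_cutoff_cvg a b x :
  box_cutoff a b ^~ x @ \oo --> (\1_(obox a b) x : R).
Proof.
have [xab|xab] := pselect (obox a b x); last first.
  rewrite indicE memNset//; under eq_fun do rewrite box_cutoff_eq0//.
  exact: cvg_cst.
rewrite indicE mem_set//; apply: cvg_near_cst.
have large (d : R) : 0 < d -> \forall k \near \oo, 1 <= k%:R * d.
  move=> d0; near=> k; rewrite -ler_pdivrMr// mul1r.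
  by near: k; exact: nbhs_infty_ger.
have h : \forall k \near \oo, forall i : 'I_n,
    1 <= k%:R * (x 0 i - a 0 i) /\ 1 <= k%:R * (b 0 i - x 0 i).
  apply: filter_forall => i; have /andP[ax xb] := xab i.
  by near=> k; split; near: k; apply: large; rewrite subr_gt0.
apply: filterS h => k h; rewrite /box_cutoff big1// => i _.
by rewrite !(B_ge1 beta_adm) ?mulr1//; have [] := h i.
Unshelve. all: by end_near. Qed.

Lemma test_function_box_cutoff a b k : cbox a b `<=` Omega ->
  test_function Omega (box_cutoff a b k).
Proof.
move=> abO; apply: (test_functionI (K := cbox a b)) => //.
- move=> j; apply: Ck_prod => i; apply: CkM.
    have -> : (fun x : 'rV[R]_n => B (k%:R * (x 0 i - a 0 i))) =
      (fun t => B (k%:R * t + (- (k%:R * a 0 i)))) \o (fun x : 'rV[R]_n => x 0 i).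
      by apply/funext => x /=; rewrite mulrBr.
    apply: Ck_comp; last exact: Ck_coord.
    by apply: smooth_affine; exact: smooth_B.
  have -> : (fun x : 'rV[R]_n => B (k%:R * (b 0 i - x 0 i))) =
    (fun t => B (- k%:R * t + k%:R * b 0 i)) \o (fun x : 'rV[R]_n => x 0 i).
    by apply/funext => x /=; rewrite mulrBr mulNr addrC.
  apply: Ck_comp; last exact: Ck_coord.
  by apply: smooth_affine; exact: smooth_B.
- exact: cbox_compact.
- move=> x xK; apply: box_cutoff_eq0 => xo; apply: xK => i.
  by have /andP[/ltW -> /ltW ->] := xo i.
Qed.

(** The functions [box_cutoff a b k] are test functions with values in [0, 1] that converge to the
    indicator of the box, so the orthogonality passes to the limit by dominated convergence. *)
Lemma integral_obox_eq0 (f : 'rV[R]_n -> R) a b : cbox a b `<=` Omega ->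
  mu.-integrable Omega (EFin \o f) ->
  (forall phi, test_function Omega phi -> \int[mu]_(x in Omega) (f x * phi x) = 0) ->
  (\int[mu]_(x in obox a b) (f x)%:E = 0)%E.
Proof.
move=> abO fi f0.
have mf : measurable_fun Omega f by apply/measurable_EFinP; exact: measurable_int fi.
have aO : obox a b `<=` Omega.
  move=> x xo; apply: abO => i; by have /andP[/ltW -> /ltW ->] := xo i.
have mab := measurable_obox a b.
have mphi k : measurable_fun Omega (box_cutoff a b k).
  by apply: (test_function_measurable (test_function_box_cutoff k abO)).
have [|||||_ _] := @dominated_convergence _ _ _ mu Omega mO
    (fun k x => (f x * box_cutoff a b k x)%:E) (fun x => (f x * \1_(obox a b) x)%:E)
    (fun x => `|(f x)%:E|%E).
- by move=> k; apply/measurable_EFinP; apply: measurable_funM.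
- apply/measurable_EFinP; apply: measurable_funM => //.
- apply/aeW => x _; apply: cvg_EFin; first by near=> k.
  by apply: cvgM; [exact: cvg_cst|exact: box_cutoff_cvg].
- exact: integrable_abse.
- apply/aeW => x k _ /=; rewrite lee_fin normrM ler_piMr//.
  by have /andP[? ?] := box_cutoff_01 a b k x; rewrite ger0_norm.
rewrite (_ : [sequence _]_n = cst 0%E); last first.
  apply/funext => k /=; have := f0 _ (test_function_box_cutoff k abO).
  rewrite /Rintegral => h; rewrite -[LHS]fineK ?h//.
  apply: integrable_fin_num => //.
  apply: (le_integrable mO _ _ fi).
    by apply/measurable_EFinP; apply: measurable_funM.
  move=> x _ /=; rewrite lee_fin normrM ler_piMr//.
  by have /andP[? ?] := box_cutoff_01 a b k x; rewrite ger0_norm.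
move=> /(cvg_unique _ (@cvg_cst _ _ _ _ _ )) => h.
rewrite (_ : obox a b = Omega `&` obox a b); last by rewrite setIidr.
rewrite integral_mkcondr [RHS]h//.
apply: eq_integral => x _; rewrite patchE indicE.
by case: ifP => _; rewrite ?mulr1 ?mulr0.
Unshelve. all: by end_near. Qed.

(** The integral of f vanishes on every orthant cut by the box, such a trace being again a box.
    Dynkin's theorem extends this to all measurable subsets of the box, which forces f = 0 almost
    everywhere there. *)
Lemma ae_eq0_obox (f : 'rV[R]_n -> R) a b : cbox a b `<=` Omega ->
  mu.-integrable Omega (EFin \o f) ->
  (forall phi, test_function Omega phi -> \int[mu]_(x in Omega) (f x * phi x) = 0) ->
  ae_eq mu (obox a b) (EFin \o f) (cst 0%E).
Proof.
move=> abO fi f0.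
have aO : obox a b `<=` Omega.
  move=> x xo; apply: abO => i; by have /andP[/ltW -> /ltW ->] := xo i.
have mQ := measurable_obox a b.
have fQ : mu.-integrable (obox a b) (EFin \o f) by exact: integrableS fi.
apply: integral_ae_eq => // E EQ mE.
rewrite integral0 -(setIidr EQ).
pose P (A : set 'rV[R]_n) := (\int[mu]_(x in obox a b `&` A) (f x)%:E = 0)%E.
have fQA A : measurable A -> mu.-integrable (obox a b `&` A) (EFin \o f).
  by move=> mA; apply: integrableS fQ => //; exact: measurableI.
have PT : P setT by rewrite /P setIT; exact: integral_obox_eq0.
suff : P E by [].
apply: (dynkin_induction (measurable_rV_orthants R n)) => //.
- move=> _ _ [c ->] [d ->]; exists (\row_i Num.max (c 0 i) (d 0 i)).
  apply/seteqP; split => [x [xc xd] i|x h]; first by rewrite mxE gt_max xc xd.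
  by split => i; have := h i; rewrite mxE gt_max => /andP[].
- move=> _ [c ->]; rewrite /P.
  rewrite (_ : _ `&` _ = obox (\row_i Num.max (a 0 i) (c 0 i)) b).
    apply: integral_obox_eq0 => // x h; apply: abO => i; have := h i.
    by rewrite mxE ge_max => /andP[/andP[-> _] ->].
  apply/seteqP; split => [x [xa xc] i|x h].
    by have /andP[xa1 xa2] := xa i; rewrite mxE gt_max xa1 xa2 (xc i).
  by split => i; have := h i; rewrite mxE gt_max => /andP[/andP[xa xc] xb] //; rewrite xa.
- move=> A mA; rewrite /P => PA.
  have E' : obox a b = (obox a b `&` A) `|` (obox a b `&` ~` A).
    by rewrite -setIUr setUv setIT.
  have := PT; rewrite /P setIT {1}E' integral_setU//.
  + by rewrite PA add0e.
  + exact: measurableI.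
  + by apply: measurableI => //; exact: measurableC.
  + by rewrite -E'; apply: measurable_int fQ.
  + by apply/disj_setPS => x [[_ xA] [_]].
- move=> F mF tF PF; rewrite /P setI_bigcupr integral_bigcup.
  + by rewrite eseries0// => k _ _; exact: PF.
  + exact: trivIset_setIl.
  + by move=> k; exact: measurableI.
  + by rewrite -setI_bigcupr; apply: fQA; exact: bigcup_measurable.
- by rewrite -measurable_rV_orthants.
Qed.

Lemma ae_eq0_test (f : 'rV[R]_n -> R) :
  mu.-integrable Omega (EFin \o f) ->
  (forall phi, test_function Omega phi -> \int[mu]_(x in Omega) (f x * phi x) = 0) ->
  ae_eq mu Omega f (cst 0).
Proof.
move=> fi f0; have [P [a [b [OE sub]]]] := open_bigcup_obox oO.
have : mu.-negligible (\bigcup_k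
    [set x | P k /\ obox (a k) (b k) x /\ f x <> 0]).
  apply: negligible_bigcup => k; have [Pk|Pk] := pselect (P k); last first.
    rewrite (_ : mkset _ = set0); first exact: negligible_set0.
    by apply/seteqP; split => x // [].
  have := ae_eq0_obox (sub k Pk) fi f0.
  apply: negligibleS => x /= [_ [xk fx0]] h; apply: fx0.
  by have := h xk => -[].
apply: negligibleS => x /= /not_implyP[]; rewrite {1}OE => -[k Pk xk] fx.
by exists k => //; split.
Qed.

End fundamental_lemma.

(** * Approximation by test functions and the chain rule *)

Section square_integrals.
Context d (T : measurableType d) (R : realType).
Variables (mu : {measure set T -> \bar R}) (D : set T).
Hypothesis mD : measurable D.
Implicit Types f g h : T -> R.

Definition sqint f : \bar R := (\int[mu]_(x in D) ((f x) ^+ 2)%:E)%E.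

Lemma sqint_ge0 f : (0 <= sqint f)%E.
Proof. by apply: integral_ge0 => x _; rewrite lee_fin sqr_ge0. Qed.

Lemma measurable_sqr f : measurable_fun D f ->
  measurable_fun D (fun x => ((f x) ^+ 2)%:E).
Proof. by move=> mf; apply/measurable_EFinP; exact: measurable_funX. Qed.

Lemma sqint_scale f h (c : R) : measurable_fun D f -> measurable_fun D h ->
  (forall x, D x -> `|h x| <= c * `|f x|) -> (sqint h <= (c ^+ 2)%:E * sqint f)%E.
Proof.
move=> mf mh hf; rewrite -ge0_integralZl//.
- apply: ge0_le_integral => //.
  + by move=> x _; rewrite lee_fin sqr_ge0.
  + exact: measurable_sqr.
  + by apply: measurable_funeM; exact: measurable_sqr.
  + move=> x Dx; rewrite -EFinM lee_fin -exprMn -(real_normK (num_real (h x))).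
    rewrite -[leRHS]real_normK ?num_real//.
    rewrite lerXn2r ?nnegrE ?normr_ge0// normrM.
    apply: le_trans (hf x Dx) _; rewrite ler_wpM2r//; exact: ler_norm.
- exact: measurable_sqr.
- by move=> x _; rewrite lee_fin sqr_ge0.
- by rewrite lee_fin sqr_ge0.
Qed.

Lemma sqint_le f h : measurable_fun D f -> measurable_fun D h ->
  (forall x, D x -> `|h x| <= `|f x|) -> (sqint h <= sqint f)%E.
Proof.
move=> mf mh hf; have := @sqint_scale f h 1 mf mh.
by rewrite expr1n mul1e; apply => x Dx; rewrite mul1r hf.
Qed.

(** The factor 2 comes from (a + b)^2 <= 2 (a^2 + b^2). Working with squared norms in the extended
    reals avoids square roots and any prior finiteness. *)
Lemma sqint_tri f g h : measurable_fun D f -> measurable_fun D g ->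
  measurable_fun D h -> (forall x, D x -> `|h x| <= `|f x| + `|g x|) ->
  (sqint h <= 2%:E * (sqint f + sqint g))%E.
Proof.
move=> mf mg mh hfg.
rewrite -ge0_integralD//; try (by move=> x _; rewrite lee_fin sqr_ge0); try exact: measurable_sqr.
rewrite -ge0_integralZl//.
- apply: ge0_le_integral => //.
  + by move=> x _; rewrite lee_fin sqr_ge0.
  + exact: measurable_sqr.
  + by apply: measurable_funeM; apply: emeasurable_funD; exact: measurable_sqr.
  + move=> x Dx; rewrite -EFinD -EFinM lee_fin.
    rewrite -(real_normK (num_real (h x))) -(real_normK (num_real (f x))).
    rewrite -(real_normK (num_real (g x))).
    apply: (@le_trans _ _ ((`|f x| + `|g x|) ^+ 2)).
      by rewrite lerXn2r ?nnegrE ?addr_ge0 ?normr_ge0// hfg.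
    by have := sqr_ge0 (`|f x| - `|g x|); nra.
- by apply: emeasurable_funD; exact: measurable_sqr.
- by move=> x _; rewrite adde_ge0// lee_fin sqr_ge0.
Qed.

Definition L2m f := measurable_fun D f /\ (sqint f < +oo)%E.

Lemma L2mD f g : L2m f -> L2m g -> L2m (f \+ g).
Proof.
move=> [mf f2] [mg g2]; have mfg : measurable_fun D (f \+ g) by exact: measurable_funD.
split => //; apply: le_lt_trans (sqint_tri mf mg mfg _) _.
  by move=> x _; exact: ler_normD.
by rewrite lte_mul_pinfty// lte_add_pinfty.
Qed.

Lemma L2mZ c f : L2m f -> L2m (fun x => c * f x).
Proof.
move=> [mf f2]; have mcf : measurable_fun D (fun x => c * f x) by exact: measurable_funM.
split => //; apply: le_lt_trans (@sqint_scale f _ `|c| mf mcf _) _.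
  by move=> x _; rewrite normrM.
by rewrite lte_mul_pinfty// lee_fin sqr_ge0.
Qed.

Lemma L2mB f g : L2m f -> L2m g -> L2m (f \- g).
Proof.
move=> f2 g2; rewrite (_ : f \- g = f \+ (fun x => -1 * g x)).
  by apply: L2mD => //; exact: L2mZ.
by apply/funext => x /=; rewrite mulN1r.
Qed.

Lemma L2m_integrable_sqr f : L2m f -> mu.-integrable D (fun x => ((f x) ^+ 2)%:E).
Proof.
move=> [mf f2]; apply/integrableP; split; first exact: measurable_sqr.
by under eq_integral do rewrite gee0_abs ?lee_fin ?sqr_ge0//.
Qed.

Lemma L2m_integrableM f g : L2m f -> L2m g -> mu.-integrable D (fun x => (f x * g x)%:E).
Proof.
move=> f2 g2; have [mf _] := f2; have [mg _] := g2.
apply: (le_integrable mD _ _ (integrableD mD (L2m_integrable_sqr f2) (L2m_integrable_sqr g2))).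
  by apply/measurable_EFinP; exact: measurable_funM.
move=> x _ /=; rewrite lee_fin normrM [leRHS]ger0_norm ?addr_ge0 ?sqr_ge0//.
rewrite -(real_normK (num_real (f x))) -(real_normK (num_real (g x))).
have := sqr_ge0 (`|f x| - `|g x|); have := normr_ge0 (f x); have := normr_ge0 (g x).
by nra.
Qed.

Lemma integrable_scale f (c : R) : mu.-integrable D (fun x => (f x)%:E) ->
  mu.-integrable D (fun x => (c * f x)%:E).
Proof. by move=> fi; exact: (integrableZl mD c fi). Qed.

Lemma integrable_add f g : mu.-integrable D (fun x => (f x)%:E) ->
  mu.-integrable D (fun x => (g x)%:E) -> mu.-integrable D (fun x => (f x + g x)%:E).
Proof. by move=> fi gi; exact: (integrableD mD fi gi). Qed.

(** A weighted arithmetic-geometric inequality in place of Cauchy-Schwarz: when the first factor has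
    squared norm at most c^2, the bound is of order c. *)
Lemma Rintegral_amgm f g (c : R) : 0 < c -> L2m f -> L2m g ->
  `|\int[mu]_(x in D) (f x * g x)| <= c^-1 * fine (sqint f) + c * fine (sqint g).
Proof.
move=> c0 f2 g2; apply: le_trans (le_normr_Rintegral mD (L2m_integrableM f2 g2)) _.
have i1 := L2m_integrable_sqr f2; have i2 := L2m_integrable_sqr g2.
rewrite -[fine (sqint f)]/(Rintegral mu D (fun x => (f x) ^+ 2)).
rewrite -[fine (sqint g)]/(Rintegral mu D (fun x => (g x) ^+ 2)).
rewrite -RintegralZl// -RintegralZl// -RintegralD//; last 2 first.
- exact: integrable_scale.
- exact: integrable_scale.
apply: le_Rintegral => //.
- exact: (integrable_norm (L2m_integrableM f2 g2)).
- by apply: integrable_add; exact: integrable_scale.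
- move=> x _; rewrite normrM -(real_normK (num_real (f x))) -(real_normK (num_real (g x))).
  have := sqr_ge0 (c^-1 * `|f x| - `|g x|).
  have ci : c * c^-1 = 1 by rewrite mulfV// gt_eqF.
  have ci0 : 0 < c^-1 by rewrite invr_gt0.
  have := normr_ge0 (f x); have := normr_ge0 (g x).
  move: `|f x| `|g x| (c^-1) ci ci0 => a b e ci ci0 b0 a0 h.
  have := mulr_ge0 (ltW c0) h.
  have -> : c * (e * a - b) ^+ 2 = (c * e) * e * a ^+ 2 - (c * e) * 2 * a * b + c * b ^+ 2 by ring.
  rewrite ci => h'.
  have := mulr_ge0 a0 b0; nra.
Qed.

Lemma sqint_ae f g : measurable_fun D f -> measurable_fun D g ->
  ae_eq mu D f g -> sqint f = sqint g.
Proof.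
move=> mf mg fg; apply: ge0_ae_eq_integral => //.
- exact: measurable_sqr.
- exact: measurable_sqr.
- by move=> x _; rewrite lee_fin sqr_ge0.
- by move=> x _; rewrite lee_fin sqr_ge0.
- by apply: filterS fg => x fg Dx; rewrite fg.
Qed.

Lemma sqint_cvg0 (h : nat -> T -> R) (b : T -> R) : (forall k, measurable_fun D (h k)) ->
  L2m b -> (forall k x, D x -> `|h k x| <= `|b x|) ->
  (forall x, D x -> h k x @[k --> \oo] --> (0 : R)) ->
  forall e : R, 0 < e -> \forall k \near \oo, (sqint (h k) < e%:E)%E.
Proof.
move=> mh b2 hb h0 e e0; have [mb _] := b2.
have [|||||_ _] := @dominated_convergence _ _ _ mu D mD
    (fun k x => ((h k x) ^+ 2)%:E) (fun x => 0%:E) (fun x => ((b x) ^+ 2)%:E).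
- by move=> k; exact: measurable_sqr.
- exact: measurable_cst.
- apply/aeW => x Dx; apply: cvg_EFin; first by near=> k.
  rewrite [X in _ --> X](_ : _ = (0 : R) * 0); last by rewrite mulr0.
  by apply: cvgM; exact: h0.
- exact: L2m_integrable_sqr.
- apply/aeW => x k Dx; rewrite /= lee_fin ger0_norm ?sqr_ge0//.
  rewrite -(real_normK (num_real (h k x))) -(real_normK (num_real (b x))).
  by rewrite lerXn2r ?nnegrE ?normr_ge0// hb.
rewrite integral0 => /fine_cvgP[fin0 /cvgrPdist_lt /(_ e e0)] H.
apply: filterS2 fin0 H => k kf ke; rewrite /sqint -[X in (X < _)%E](fineK kf) lte_fin.
by apply: le_lt_trans ke; rewrite sub0r normrN ler_norm.
Unshelve. all: by end_near. Qed.

End square_integrals.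

(** * H^1_0 as the closure of the gradient graph on test functions *)

Section H10_approximation.
Variables (R : realType) (n : nat) (Omega : set 'rV[R]_n) (beta : R -> R).
Hypotheses (oO : open Omega) (beta_adm : admissible_beta beta).
Local Notation mu := (lebesgue_rV R n).
Hypothesis finO : (mu Omega < +oo)%E.
Implicit Types (u v w phi : 'rV[R]_n -> R) (g h : 'I_n -> 'rV[R]_n -> R).
Local Notation sq f := (sqint mu Omega f%R).
Local Notation L2o := (L2m mu Omega).
Local Notation mfun f := (measurable_fun Omega f).

Let mO : measurable Omega. Proof. exact: open_measurable_rV. Qed.

Lemma L2E u : L2 Omega u <-> L2o u.
Proof.
have sqE : (\int[mu]_x ((u \_ Omega) x ^+ 2)%:E = sq u)%E.
  rewrite /sqint [RHS]integral_mkcond; apply: eq_integral => x _.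
  by rewrite !patchE; case: ifP => _ //; rewrite expr0n.
rewrite /L2 /L2m.
have mE : measurable_fun setT (u \_ Omega) <-> measurable_fun Omega u.
  by rewrite -measurable_restrictT.
have nE : finite_norm mu 2%:E (u \_ Omega) <-> (sq u < +oo)%E.
  rewrite /finite_norm -sqE unlock /=.
  have -> : (\int[mu]_x (`|(u \_ Omega) x| `^ 2)%:E = \int[mu]_x ((u \_ Omega) x ^+ 2)%:E)%E.
    by apply: eq_integral => x _; rewrite powR_mulrn// real_normK ?num_real.
  split => [h|]; last by move=> h; rewrite poweR_lty.
  rewrite ltey; apply/eqP => E; by move: h; rewrite E poweRyr ?invr_eq0 ?pnatr_eq0// ltxx.
split.
  move=> /andP[]; rewrite !inE => /mE mu1 /nE h; split => //.
by move=> [/mE h1 /nE h2]; apply/andP; rewrite !inE.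
Qed.

Lemma test_mfun phi : test_function Omega phi -> mfun phi.
Proof. by move=> tphi; apply: (test_function_measurable tphi). Qed.

Lemma test_L2 phi : test_function Omega phi -> L2o phi.
Proof.
move=> tphi; split; first exact: test_mfun.
have tphi2 : test_function Omega (phi \* phi).
  by apply: test_functionM => // k; have [] := tphi.
have : mu.-integrable Omega (EFin \o (phi \* phi)).
  by apply: (@integrableS _ _ _ _ setT) => //; exact: (@test_function_integrable _ _ Omega).
move=> /integrableP[_]; congr (_ < _)%E; apply: eq_integral => x _.
by rewrite /= ger0_norm -expr2// sqr_ge0.
Qed.

(* The closure of the graph of the gradient on test functions, a form of H^1_0 in
   which no representative of the weak derivatives has to be chosen. *)
Definition H10g u g := [/\ mfun u, forall i, mfun (g i) &
  forall e : R, 0 < e -> exists phi, [/\ test_function Omega phi,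
     (sq (u \- phi) < e%:E)%E & forall i, (sq (g i \- partial i phi) < e%:E)%E]].

Lemma test_H10g phi : test_function Omega phi -> H10g phi (fun i => partial i phi).
Proof.
move=> tphi; split.
- exact: test_mfun.
- by move=> i; apply: test_mfun => //; exact: test_function_partial.
- move=> e e0; exists phi; split => //.
    rewrite /sqint integral0_eq ?lte_fin// => x _ /=.
    by rewrite subrr expr0n.
  move=> i; rewrite /sqint integral0_eq ?lte_fin// => x _ /=.
  by rewrite subrr expr0n.
Qed.

Lemma sq_sub_tri u v w : mfun u -> mfun v -> mfun w ->
  (sq (u \- w) <= 2%:E * (sq (u \- v) + sq (v \- w)))%E.
Proof.
move=> mf mv mw; apply: sqint_tri => //; try exact: measurable_funB.
by move=> x _; rewrite /= (_ : u x - w x = (u x - v x) + (v x - w x)) ?ler_normD//; lra.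
Qed.

Lemma H10g_L2 u g : H10g u g -> L2o u /\ forall i, L2o (g i).
Proof.
move=> [mu' mg /(_ 1 ltr01)[phi [tphi h1 h2]]].
have [mphi phi2] := test_L2 tphi.
split.
  rewrite (_ : u = (u \- phi) \+ phi).
    apply: L2mD => //; split; first exact: measurable_funB.
    exact: lt_trans h1 (ltry _).
  by apply/funext => x /=; rewrite subrK.
move=> i; have [mphi' phi2'] := test_L2 (test_function_partial i tphi).
rewrite (_ : g i = (g i \- partial i phi) \+ partial i phi).
  apply: L2mD => //; split; first exact: measurable_funB.
  exact: lt_trans (h2 i) (ltry _).
by apply/funext => x /=; rewrite subrK.
Qed.

Lemma H10g_closed u g : mfun u -> (forall i, mfun (g i)) ->
  (forall e : R, 0 < e -> exists v h, [/\ H10g v h, (sq (u \- v) < e%:E)%E &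
     forall i, (sq (g i \- h i) < e%:E)%E]) -> H10g u g.
Proof.
move=> mf mg cl; split => // e e0.
(* The factor 2 of the squared triangle inequality turns two errors e/5 into at most 4e/5 < e. *)
have e40 : 0 < e / 5 by rewrite divr_gt0.
have [v [h [[mv mh /(_ _ e40)[phi [tphi p1 p2]]] h1 h2]]] := cl _ e40.
have mphi : mfun phi by exact: test_mfun.
have mpphi i : mfun (partial i phi).
  by apply: test_mfun => //; exact: test_function_partial.
have comb (x y : \bar R) : (0 <= x)%E -> (0 <= y)%E -> (x < (e / 5)%:E)%E -> (y < (e / 5)%:E)%E ->
    (2%:E * (x + y) < e%:E)%E.
  case: x => [x| |]//; case: y => [y| |]//; rewrite !lee_fin !lte_fin => *.
  by lra.
exists phi; split => //.
  by apply: le_lt_trans (sq_sub_tri mf mv mphi) _; rewrite comb// sqint_ge0.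
by move=> i; apply: le_lt_trans (sq_sub_tri (mg i) (mh i) (mpphi i)) _; rewrite comb// sqint_ge0.
Qed.

Lemma H10g_lin u g v h (c : R) : H10g u g -> H10g v h ->
  H10g (fun x => u x + c * v x) (fun i x => g i x + c * h i x).
Proof.
move=> [mu' mg Hu] [mv mh Hv]; split.
- by apply: measurable_funD => //; exact: measurable_funM.
- by move=> i; apply: measurable_funD => //; exact: measurable_funM.
(* With both errors below e/(4K), the squared triangle inequality bounds the combination by 2 (1 +
   c^2) e/(4K) = e/2. *)
move=> e e0; pose K := 1 + c ^+ 2; have K0 : 0 < K by rewrite ltr_wpDr ?sqr_ge0.
have e10 : 0 < e / (4 * K) by rewrite divr_gt0// mulr_gt0.
have [phi [tphi p1 p2]] := Hu _ e10.
have [psi [tpsi q1 q2]] := Hv _ e10.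
have tcpsi := test_functionZ c tpsi.
have comb (f1 f2 f : 'rV[R]_n -> R) : mfun f1 -> mfun f2 -> f = (f1 \+ (fun x => c * f2 x)) ->
    (sq f1 < (e / (4 * K))%:E)%E -> (sq f2 < (e / (4 * K))%:E)%E -> (sq f < e%:E)%E.
  move=> mf1 mf2 ->; have mcf2 : mfun (fun x => c * f2 x) by exact: measurable_funM.
  have s1 := @sqint_tri _ _ _ mu _ mO _ _ _ mf1 mcf2 (measurable_funD mf1 mcf2)
    (fun x _ => ler_normD _ _).
  have s2 : (sq (fun x => c * f2 x) <= (`|c| ^+ 2)%:E * sq f2)%E.
    by apply: sqint_scale => // x _; rewrite normrM.
  move: s1 s2 (sqint_ge0 mu Omega f1) (sqint_ge0 mu Omega f2).
  rewrite real_normK ?num_real//.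
  case: (sq f1) => [a| |]//; case: (sq f2) => [b| |]// s1 s2; rewrite !lee_fin !lte_fin => a0 b0.
  rewrite ltr_pdivlMr ?mulr_gt0// => ha; rewrite ltr_pdivlMr ?mulr_gt0// => hb.
  apply: le_lt_trans s1 _.
  apply: (@le_lt_trans _ _ (2%:E * (a%:E + (c ^+ 2)%:E * b%:E)))%E.
    by rewrite lee_wpmul2l// leeD2l.
  rewrite -[(_ * b%:E)%E]/((c ^+ 2 * b)%:E) -[(a%:E + _)%E]/((a + c ^+ 2 * b)%:E).
  rewrite -[(2%:E * _)%E]/((2 * (a + c ^+ 2 * b))%:E) lte_fin.
  by move: ha hb; rewrite /K; have := sqr_ge0 c; nra.
exists (phi \+ (fun x => c * psi x)); split; first exact: test_functionD.
- apply: (comb (u \- phi) (v \- psi)) => //.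
  + by apply: measurable_funB => //; exact: test_mfun.
  + by apply: measurable_funB => //; exact: test_mfun.
  + by apply/funext => x /=; rewrite mulrBr; ring.
- move=> i; apply: (comb (g i \- partial i phi) (h i \- partial i psi)) => //.
  + apply: measurable_funB => //; apply: test_mfun => //.
    exact: test_function_partial.
  + apply: measurable_funB => //; apply: test_mfun => //.
    exact: test_function_partial.
  + apply/funext => x; rewrite partialD; last 2 first.
      by move=> y; exact: (@test_function_derivable _ _ Omega).
      by move=> y; exact: (@test_function_derivable _ _ Omega).
    rewrite /=; have -> : partial i (fun x => c * psi x) x = c * partial i psi x.
      by rewrite /partial (deriveMl c)//; exact: (@test_function_derivable _ _ Omega).
    by rewrite /= mulrBr; ring.
Qed.

Lemma is_weak_partialB i u v f1 f2 : L2o u -> L2o v -> L2o f1 -> L2o f2 ->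
  is_weak_partial Omega i u f1 -> is_weak_partial Omega i v f2 ->
  is_weak_partial Omega i (u \- v) (f1 \- f2).
Proof.
move=> u2 v2 f12 f22 w1 w2 phi tphi.
have p2 := test_L2 (test_function_partial i tphi); have phi2 := test_L2 tphi.
have -> : \int[mu]_(x in Omega) ((u \- v) x * partial i phi x) =
  \int[mu]_(x in Omega) (u x * partial i phi x) - \int[mu]_(x in Omega) (v x * partial i phi x).
  rewrite -RintegralB//; try exact: L2m_integrableM.
  by apply: eq_Rintegral => x _ /=; rewrite mulrBl.
have -> : \int[mu]_(x in Omega) ((f1 \- f2) x * phi x) =
  \int[mu]_(x in Omega) (f1 x * phi x) - \int[mu]_(x in Omega) (f2 x * phi x).
  rewrite -RintegralB//; try exact: L2m_integrableM.
  by apply: eq_Rintegral => x _ /=; rewrite mulrBl.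
by rewrite (w1 _ tphi) (w2 _ tphi) opprB opprK addrC.
Qed.

Lemma L2_integrable u : L2o u -> mu.-integrable Omega (EFin \o u).
Proof.
move=> u2; have c2 : L2o (cst 1).
  split; first exact: measurable_cst.
  rewrite /sqint (eq_integral (cst 1%E)); last by move=> x _; rewrite /= expr1n.
  by rewrite integral_cst// mul1e.
have := L2m_integrableM mO u2 c2; congr (integrable _ _ _).
by apply/funext => x /=; rewrite mulr1.
Qed.

Lemma weak_partial_unique i u f1 f2 : L2o f1 -> L2o f2 ->
  is_weak_partial Omega i u f1 -> is_weak_partial Omega i u f2 ->
  ae_eq mu Omega f1 f2.
Proof.
move=> f12 f22 w1 w2.
have f3 := L2mB mO f12 f22.
have := ae_eq0_test oO beta_adm (L2_integrable f3).
have h phi : test_function Omega phi -> \int[mu]_(x in Omega) ((f1 \- f2) x * phi x) = 0.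
  move=> tphi; have phi2 := test_L2 tphi.
  have -> : \int[mu]_(x in Omega) ((f1 \- f2) x * phi x) =
    \int[mu]_(x in Omega) (f1 x * phi x) - \int[mu]_(x in Omega) (f2 x * phi x).
    rewrite -RintegralB//; try exact: L2m_integrableM.
    by apply: eq_Rintegral => x _ /=; rewrite mulrBl.
  by apply/eqP; rewrite subr_eq0 -eqr_opp -(w1 _ tphi) -(w2 _ tphi).
move=> /(_ h); apply: filterS => x /= h1 Ox; apply/eqP; rewrite -subr_eq0; apply/eqP.
exact: h1.
Qed.

Lemma H10g_weak_partial u g i : H10g u g -> is_weak_partial Omega i u (g i).
Proof.
move=> Hu psi tpsi; have [u2 g2] := H10g_L2 Hu; have [mu' mg app] := Hu.
have psi2 := test_L2 tpsi; have ppsi2 := test_L2 (test_function_partial i tpsi).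
apply/eqP; rewrite -addr_eq0; apply/eqP.
set I1 := \int[_]_(_ in _) _; set I2 := \int[_]_(_ in _) _.
(* Approximating within c^2 makes the first term of each weighted bound at most c; the total error
   is then at most c (2 + |psi|^2 + |d_i psi|^2) = c K, which is e for c = e/K. *)
pose K := 2 + fine (sq psi) + fine (sq (partial i psi)).
have K0 : 0 < K by rewrite /K !ltr_wpDr// fine_ge0// sqint_ge0.
apply/eqP; rewrite -normr_le0; apply/ler_addgt0Pr => e e0; rewrite add0r.
pose c := e / K; have c0 : 0 < c by rewrite divr_gt0.
have [|phi [tphi p1 p2]] := app (c ^+ 2); first exact: exprn_gt0.
have phi2 := test_L2 tphi; have pphi2 := test_L2 (test_function_partial i tphi).
have w := test_function_weak_partial i tphi tpsi.
have E1 : I1 = \int[mu]_(x in Omega) ((u \- phi) x * partial i psi x)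
           + \int[mu]_(x in Omega) (phi x * partial i psi x).
  rewrite -RintegralD//; try exact: L2m_integrableM.
    by apply: eq_Rintegral => x _ /=; ring.
  by apply: L2m_integrableM => //; exact: L2mB.
have E2 : I2 = \int[mu]_(x in Omega) ((g i \- partial i phi) x * psi x)
           + \int[mu]_(x in Omega) (partial i phi x * psi x).
  rewrite -RintegralD//; try exact: L2m_integrableM.
    by apply: eq_Rintegral => x _ /=; ring.
  by apply: L2m_integrableM => //; exact: L2mB.
rewrite E1 E2 w addrACA addNr addr0.
have b1 := Rintegral_amgm mO c0 (L2mB mO u2 phi2) ppsi2.
have b2 := Rintegral_amgm mO c0 (L2mB mO (g2 i) pphi2) psi2.
apply: le_trans (ler_normD _ _) _; apply: le_trans (lerD b1 b2) _.
have fl f : (sq f < (c ^+ 2)%:E)%E -> c^-1 * fine (sq f) <= c.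
  move=> h; rewrite mulrC ler_pdivrMr// -expr2 -lee_fin fineK ?(ltW h)//.
  by rewrite ge0_fin_numE ?sqint_ge0// (lt_trans h)// ltry.
have := fl _ p1; have := fl _ (p2 i) => h1 h2.
have -> : e = c * K by rewrite /c divfK// gt_eqF.
rewrite /K; move: (fine (sq psi)) (fine (sq (partial i psi))) => a b.
rewrite !mulrDr; lra.
Qed.

Lemma weak_partialP u i : H1 Omega u ->
  L2o (weak_partial Omega i u) /\ is_weak_partial Omega i u (weak_partial Omega i u).
Proof.
move=> [_ /(_ i)[g g2 w]].
have [h1 h2] : [set g | L2 Omega g /\ is_weak_partial Omega i u g] (weak_partial Omega i u).
  by apply: xgetPex; exists g.
by split => //; exact/L2E.
Qed.

Lemma H10g_H1 u g : H10g u g ->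
  H1 Omega u /\ forall i, ae_eq mu Omega (weak_partial Omega i u) (g i).
Proof.
move=> Hu; have [u2 g2] := H10g_L2 Hu.
have H1u : H1 Omega u.
  by split; [exact/L2E|move=> i; exists (g i); [exact/L2E|exact: H10g_weak_partial]].
split => // i; have [w2 w] := weak_partialP i H1u.
by apply: weak_partial_unique w _ => //; exact: H10g_weak_partial.
Qed.

Lemma Rintegral_sum_sqr g : (forall i, L2o (g i)) ->
  mu.-integrable Omega (fun x => (\sum_i (g i x) ^+ 2)%:E) /\
  \int[mu]_(x in Omega) (\sum_i (g i x) ^+ 2) = \sum_i fine (sq (g i)).
Proof.
move=> g2.
have int (r : seq 'I_n) : mu.-integrable Omega (fun x => (\sum_(i <- r) (g i x) ^+ 2)%:E) /\
  \int[mu]_(x in Omega) (\sum_(i <- r) (g i x) ^+ 2) = \sum_(i <- r) fine (sq (g i)).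
  elim: r => [|i r [IH1 IH2]].
    split.
      under eq_fun do rewrite big_nil; exact: integrable0.
    rewrite big_nil; under eq_Rintegral do rewrite big_nil.
    by rewrite /Rintegral integral0.
  have i1 := L2m_integrable_sqr (g2 i).
  split.
    under eq_fun do rewrite big_cons; exact: integrable_add.
  under eq_Rintegral do rewrite big_cons.
  by rewrite big_cons -IH2 RintegralD.
exact: int.
Qed.

Lemma H1_norm_sqr u g : L2o u -> (forall i, L2o (g i)) ->
  (forall i, L2o (weak_partial Omega i u)) ->
  (forall i, ae_eq mu Omega (weak_partial Omega i u) (g i)) ->
  H1_norm Omega u = Num.sqrt (fine (sq u) + \sum_i fine (sq (g i))).
Proof.
move=> u2 g2 w2 wg; rewrite /H1_norm /normgrad2; congr (Num.sqrt (_ + _)).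
rewrite (Rintegral_sum_sqr w2).2; apply: eq_bigr => i _; congr fine.
by apply: sqint_ae => //; [exact: (w2 i).1|exact: (g2 i).1].
Qed.

(** The norm of u - phi is computed with weak derivatives chosen afresh for the difference. By
    uniqueness they agree almost everywhere with [weak_partial Omega i u] minus the partial
    derivative of phi, so smallness of the norm is smallness of each squared distance. *)
Lemma H10_H10g u : H10 Omega u -> H10g u (fun i => weak_partial Omega i u).
Proof.
move=> [H1u app].
have u2 : L2o u by apply/L2E; have [] := H1u.
have w2 i := weak_partialP i H1u.
split; first exact: u2.1.
  by move=> i; exact: (w2 i).1.1.
move=> e e0; have se0 : 0 < Num.sqrt e by rewrite sqrtr_gt0.
have [phi tphi] := app _ se0.
have phi2 := test_L2 tphi; have pphi2 i := test_L2 (test_function_partial i tphi).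
have d2 := L2mB mO u2 phi2.
have dw2 i := L2mB mO (w2 i).1 (pphi2 i).
have wd i : is_weak_partial Omega i (u \- phi) (weak_partial Omega i u \- partial i phi).
  apply: is_weak_partialB => //; [exact: (w2 i).1|exact: (w2 i).2|].
  exact: test_function_weak_partial.
have H1d : H1 Omega (u \- phi).
  split; first exact/L2E.
  by move=> i; exists (weak_partial Omega i u \- partial i phi); [exact/L2E|].
have wae i : ae_eq mu Omega (weak_partial Omega i (u \- phi))
    (weak_partial Omega i u \- partial i phi).
  by have [? ?] := weak_partialP i H1d; apply: weak_partial_unique (wd i).
rewrite (H1_norm_sqr d2 dw2 (fun i => (weak_partialP i H1d).1) wae).
rewrite ltr_sqrt// => h.
have nn f : 0 <= fine (sq f) by rewrite fine_ge0// sqint_ge0.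
have fl f : L2o f -> fine (sq f) < e -> (sq f < e%:E)%E.
  by move=> [_ f2] ?; rewrite -[sq f]fineK ?lte_fin// ge0_fin_numE// sqint_ge0.
exists phi; split => //.
  apply: fl => //; apply: le_lt_trans h; rewrite lerDl sumr_ge0//.
move=> i; apply: fl => //; apply: le_lt_trans h.
rewrite (bigD1 i)//= addrCA lerDl addr_ge0// sumr_ge0//.
Qed.

Lemma H10g_H10 u g : H10g u g -> H10 Omega u.
Proof.
move=> Hu; have [H1u wae] := H10g_H1 Hu; split => // e e0.
have [_ _ app] := Hu; have [u2 g2] := H10g_L2 Hu.
(* The squared norm has n + 1 summands, one for the function and n for the gradient, each below
   e^2/(n + 2). *)
pose K : R := n.+2%:R; have K0 : 0 < K by rewrite ltr0n.
have [|phi [tphi p1 p2]] := app (e ^+ 2 / K); first by rewrite divr_gt0// exprn_gt0.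
exists phi => //.
have Hd : H10g (u \- phi) (fun i => g i \- partial i phi).
  have := H10g_lin (-1) Hu (test_H10g tphi).
  congr (H10g _ _); first by apply/funext => x; rewrite mulN1r.
  by apply/funext => i; apply/funext => x; rewrite mulN1r.
have [H1d wd] := H10g_H1 Hd; have [d2 dg2] := H10g_L2 Hd.
rewrite (H1_norm_sqr d2 dg2 (fun i => (weak_partialP i H1d).1) wd).
rewrite -(gtr0_norm e0) -sqrtr_sqr ltr_sqrt ?exprn_gt0//.
have fl f : (sq f < (e ^+ 2 / K)%:E)%E -> fine (sq f) < e ^+ 2 / K.
  move=> h; rewrite -lte_fin fineK//.
  by rewrite ge0_fin_numE ?sqint_ge0// (lt_trans h)// ltry.
apply: (@lt_le_trans _ _ (e ^+ 2 / K + \sum_(i < n) e ^+ 2 / K)).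
  by rewrite ltr_leD ?fl// ler_sum// => i _; rewrite ltW// fl.
rewrite sumr_const card_ord -mulrS -[leLHS]mulr_natr -mulrA ler_piMr ?sqr_ge0//.
by rewrite mulrC ler_pdivrMr// mul1r ler_nat.
Qed.

End H10_approximation.

(** * The chain rule for primitives of bounded Borel functions *)

Section lprim_theory.
Variable R : realType.
Local Notation leb := (@lebesgue_measure R).
Implicit Types g f : R -> R.

Definition bmeas g := measurable_fun setT g /\ exists C, forall t, `|g t| <= C.

Lemma bmeas_integrable g a b : bmeas g -> leb.-integrable `[a, b] (fun t => (g t)%:E).
Proof.
move=> [mg [C gC]]; apply: measurable_bounded_integrable.
- exact: measurable_itv.
- suff : (leb [set` `[a, b]] < +oo)%E by [].
  by rewrite lebesgue_measure_itv/=; case: ifP => _; rewrite ?ltry// -EFinB ltry.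
- exact: measurable_funS mg.
- exists C; split; first exact: num_real.
  by move=> x Cx t _ /=; rewrite (le_trans (gC t))// ltW.
Qed.

Lemma lprim_bound g C t : measurable_fun setT g -> (forall t, `|g t| <= C) ->
  `|lprim g t| <= C * `|t|.
Proof.
move=> mg gC; have C0 : 0 <= C by apply: le_trans (gC 0).
have [t0|/ltW t0] := leP t 0; first by rewrite lprim_le0// normr0 mulr_ge0.
have bg : bmeas g by split => //; exists C.
apply: (le_trans (le_normr_Rintegral _ (bmeas_integrable 0 t bg))) => //.
apply: (@le_trans _ _ (\int[leb]_(s in `[0, t]) (cst C s))).
  apply: le_Rintegral => //.
  - exact: (integrable_norm (bmeas_integrable 0 t bg)).
  - by apply: (@bmeas_integrable (cst C)); split => //; exists `|C|.
rewrite Rintegral_cst//= lebesgue_measure_itv/= lte_fin ger0_norm//.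
by case: ltP => [_|]; rewrite ?sube0//= => t0'; rewrite mulr0 mulr_ge0.
Qed.

Lemma bmeas_lin f g (c : R) : bmeas f -> bmeas g -> bmeas (fun t => f t + c * g t).
Proof.
move=> [mf [C fC]] [mg [E gE]]; split.
  by apply: measurable_funD => //; exact: measurable_funM.
exists (C + `|c| * E) => t; apply: le_trans (ler_normD _ _) _.
by rewrite lerD// normrM ler_wpM2l.
Qed.

Lemma lprim_lin f g (c : R) : bmeas f -> bmeas g ->
  lprim (fun t => f t + c * g t) = fun t => lprim f t + c * lprim g t.
Proof.
move=> bf bg; apply/funext => t; rewrite /lprim.
have ig := bmeas_integrable 0 t bg; have if' := bmeas_integrable 0 t bf.
by rewrite -RintegralZl// -RintegralD//; exact: integrable_scale.
Qed.

Lemma cvg_norm_le (u : nat -> R) (l C : R) : u @ \oo --> l ->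
  (forall k, `|u k| <= C) -> `|l| <= C.
Proof.
move=> ul uC; have h : `|u k| @[k --> \oo] --> `|l| by exact: cvg_norm.
rewrite -(cvg_lim _ h)//; apply: limr_le.
  by apply/cvg_ex; exists `|l|.
by near=> k.
Unshelve. all: by end_near. Qed.

Lemma lprim_cvg (f : nat -> R -> R) g C t : (forall k, measurable_fun setT (f k)) ->
  measurable_fun setT g ->
  (forall k t, `|f k t| <= C) -> (forall t, f k t @[k --> \oo] --> g t) ->
  lprim (f k) t @[k --> \oo] --> lprim g t.
Proof.
move=> mf mg fC fg.
have C0 : 0 <= C by apply: le_trans (fC 0%N 0).
have [|||||_ _ h] := @dominated_convergence _ _ _ leb `[0, t]%classic (measurable_itv _)
    (fun k t => (f k t)%:E) (fun t => (g t)%:E) (cst C%:E).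
- by move=> k; apply/measurable_EFinP; exact: measurable_funS (mf k).
- by apply/measurable_EFinP; exact: measurable_funS mg.
- by apply/aeW => x _; apply: cvg_EFin; [near=> k|exact: fg].
- by apply: (@bmeas_integrable (cst C)); split => //; exists `|C|.
- by apply/aeW => x k _; rewrite /= lee_fin.
have gb : bmeas g.
  by split => //; exists C => s; exact: (cvg_norm_le (fg s)).
rewrite /lprim /Rintegral; apply: fine_cvg.
rewrite fineK//; apply: integrable_fin_num => //.
exact: bmeas_integrable.
Unshelve. all: by end_near. Qed.

End lprim_theory.

Section chain_rule.
Variables (R : realType) (n : nat) (Omega : set 'rV[R]_n) (beta : R -> R).
Hypotheses (oO : open Omega) (beta_adm : admissible_beta beta).
Local Notation mu := (lebesgue_rV R n).
Hypothesis finO : (mu Omega < +oo)%E.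
Local Notation sq f := (sqint mu Omega f%R).
Local Notation L2o := (L2m mu Omega).
Local Notation mfun f := (measurable_fun Omega f).
Local Notation H10g := (H10g Omega).
Local Notation B := (lprim beta).

Let mO : measurable Omega. Proof. exact: open_measurable_rV. Qed.

(** The chain rule for the primitive of g, stated as a property of g. In this form it is stable
    under linear combinations and bounded pointwise limits; the measurability clauses are what these
    closure properties need for the compositions with u. *)
Definition chainable (g : R -> R) :=
  [/\ bmeas g, measurable_fun setT (lprim g) &
  forall u h, H10g u h -> H10g (lprim g \o u) (fun i x => g (u x) * h i x)].

Lemma mfun_comp (g : R -> R) (u : 'rV[R]_n -> R) : measurable_fun setT g -> mfun u -> mfun (g \o u).
Proof. by move=> mg mu'; exact: measurableT_comp. Qed.

Lemma measurable_continuousR (g : R -> R) : continuous g -> measurable_fun setT g.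
Proof. by move=> cg; exact: continuous_measurable_fun. Qed.

(** The delicate term is (g(u) - g(phi)) h_i, a product of two functions of which only L^2 control
    is available. Where b = sum |h_i| is at most M, the Lipschitz bound gives L M |u - phi|; where b
    > M, the bound 2 C b is a tail of an L^2 function, small for large M. The threshold M is fixed
    before phi is chosen. *)
Lemma chainable_smooth (g : R -> R) (C L : R) : 0 < C -> 0 < L -> smooth g ->
  (forall t, t <= 0 -> g t = 0) -> (forall t, `|g t| <= C) ->
  (forall s t, `|g s - g t| <= L * `|s - t|) -> chainable g.
Proof.
move=> C0 L0 sg g0 gC gL.
have cg := smooth_continuous sg.
have mg := measurable_continuousR cg.
have dG t := is_derive_lprim t cg g0.
have sG : smooth (lprim g) by exact: derive1_smooth dG sg.
have mG : measurable_fun setT (lprim g).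
  by apply: measurable_continuousR; exact: smooth_continuous.
have GC s t : `|lprim g s - lprim g t| <= C * `|s - t|.
  wlog st : s t / t <= s.
    move=> H; have [/H//|/ltW/H] := leP t s.
    by rewrite distrC [X in _ * X]distrC.
  have cG : {within `[t, s], continuous (lprim g)}.
    by apply: continuous_subspaceT; exact: smooth_continuous sG.
  have [c _ ->] := MVT_segment st (fun x _ => dG x) cG.
  by rewrite normrM ler_wpM2r.
split => //; first by split => //; exists C.
move=> u h Hu; have [u2 h2] := H10g_L2 oO Hu; have [mu' mh app] := Hu.
split; first exact: mfun_comp.
  by move=> i; apply: measurable_funM => //; exact: (mfun_comp mg).
move=> e e0.
pose b x := \sum_i `|h i x|.
have b2 : L2o b.
  rewrite /b; elim: (index_enum _) => [|i r IH].
    under eq_fun do rewrite big_nil.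
    by apply: (test_L2 oO); exact: test_function_cst0.
  under eq_fun do rewrite big_cons.
  apply: L2mD => //; have [mhi hi2] := h2 i; split; first exact: measurableT_comp.
  apply: le_lt_trans hi2; apply: sqint_le => //; first exact: measurableT_comp.
  by move=> x _; rewrite normr_id.
pose bk (k : nat) x := b x * \1_[set y : R | k%:R < y] (b x).
have mbk k : mfun (bk k).
  apply: measurable_funM; first exact: b2.1.
  apply: (mfun_comp _ b2.1); apply: measurable_indic.
  rewrite (_ : mkset _ = `]k%:R, +oo[%classic); first exact: measurable_itv.
  by apply/seteqP; split => y /=; rewrite in_itv/= andbT.
have bge0 x : 0 <= b x by rewrite /b sumr_ge0.
have [M hM] : exists M : nat, (sq (bk M) < (e / (16 * C ^+ 2))%:E)%E.
  have e' : 0 < e / (16 * C ^+ 2) by rewrite divr_gt0// mulr_gt0// exprn_gt0.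
  have := @sqint_cvg0 _ _ _ mu Omega mO bk b mbk b2 _ _ _ e'.
  move=> H; apply: (@filter_ex _ \oo); apply: H => [k x _|x _].
    rewrite /bk normrM ler_piMr// indicE; case: (_ \in _) => /=; rewrite ?normr1 ?normr0//.
  apply: cvg_near_cst; near=> k; rewrite /bk indicE memNset ?mulr0//=.
  apply/negP; rewrite -leNgt; near: k; exact: nbhs_infty_ger.
(* Two squared triangle inequalities give at most 4 (C^2 x1 + (L M)^2 x2) + 8 C^2 x3, with x1, x2
   the squared errors of gradient and function and x3 the tail. Errors below e/(8D) and a tail below
   e/(16 C^2) contribute less than e/2 each. *)
pose D := C ^+ 2 + (L * M%:R) ^+ 2.
have D0 : 0 < D by rewrite /D ltr_pwDl ?sqr_ge0// exprn_gt0.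
have e1 : 0 < e / (8 * D) by rewrite divr_gt0// mulr_gt0.
have e2 : 0 < Num.min (e / (8 * D)) (e / C ^+ 2).
  by rewrite lt_min e1 divr_gt0// exprn_gt0.
have [phi [tphi p1 p2]] := app _ e2.
have mphi := test_mfun oO tphi.
have mpphi i := test_mfun oO (test_function_partial i tphi).
exists (lprim g \o phi); split.
- by apply: test_function_comp => //; exact: lprim_le0.
- apply: (@le_lt_trans _ _ ((C ^+ 2)%:E * sq (u \- phi)))%E.
    apply: sqint_scale => //.
    + exact: measurable_funB.
    + by apply: measurable_funB; exact: mfun_comp.
    + by move=> x _; exact: GC.
  have := lt_le_trans p1 (_ : _ <= (e / C ^+ 2)%:E)%E.
  rewrite lee_fin ge_min lexx orbT => /(_ isT).
  have := sqint_ge0 mu Omega (u \- phi).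
  case: (sq _) => [a| |]//; rewrite lee_fin !lte_fin => a0.
  by rewrite ltr_pdivlMr ?exprn_gt0// mulrC.
- move=> i.
  have pE : partial i (lprim g \o phi) = (g \o phi) \* partial i phi.
    rewrite partial_comp.
    + apply/funext => x /=; congr (_ * _); rewrite derive1E.
      by have [_ ->] := dG (phi x).
    + by move=> x; exact: (@test_function_derivable _ _ Omega).
    + by move=> t; have [] := dG t.
  pose f1 x := C * (h i x - partial i phi x).
  pose f2 x := L * M%:R * (u x - phi x).
  pose f3 x := 2 * C * bk M x.
  have mf1 : mfun f1 by apply: measurable_funM => //; exact: measurable_funB.
  have mf2 : mfun f2 by apply: measurable_funM => //; exact: measurable_funB.
  have mf3 : mfun f3 by apply: measurable_funM.
  pose f12 x := `|f1 x| + `|f2 x|.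
  have mf12 : mfun f12 by apply: measurable_funD; exact: measurableT_comp.
  have t12 : (sq f12 <= 2%:E * (sq f1 + sq f2))%E.
    by apply: sqint_tri => // x _; rewrite /f12 ger0_norm// addr_ge0.
  have t3 : (sq (fun x => g (u x) * h i x - (partial i (lprim g \o phi)) x)
      <= 2%:E * (sq f12 + sq f3))%E.
    apply: sqint_tri => //.
      apply: measurable_funB; first by apply: measurable_funM => //; exact: (mfun_comp mg).
      rewrite pE; apply: measurable_funM => //; exact: (mfun_comp mg).
    move=> x _; rewrite pE /=.
    have -> : g (u x) * h i x - g (phi x) * partial i phi x =
      g (phi x) * (h i x - partial i phi x) + (g (u x) - g (phi x)) * h i x by ring.
    apply: le_trans (ler_normD _ _) _.
    have hb : `|h i x| <= b x by rewrite /b (bigD1 i)//= lerDl sumr_ge0.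
    have k1 : `|g (phi x) * (h i x - partial i phi x)| <= `|f1 x|.
      by rewrite /f1 !normrM ler_wpM2r// (le_trans (gC _))// ler_norm.
    have f12n : `|f12 x| = `|f1 x| + `|f2 x| by rewrite ger0_norm// addr_ge0.
    rewrite f12n.
    have [bM|bM] := leP (b x) M%:R.
      have : `|(g (u x) - g (phi x)) * h i x| <= `|f2 x|.
        have -> : `|f2 x| = L * M%:R * `|u x - phi x|.
          by rewrite /f2 normrM ger0_norm// mulr_ge0// ltW.
        by rewrite normrM mulrAC; apply: ler_pM => //; exact: le_trans hb bM.
      by have := normr_ge0 (f3 x); lra.
    have : `|(g (u x) - g (phi x)) * h i x| <= `|f3 x|.
      rewrite /f3 /bk indicE mem_set//= mulr1 normrM.
      have -> : `|2 * C * b x| = 2 * C * b x.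
        by rewrite ger0_norm// !mulr_ge0// ltW.
      apply: ler_pM => //; apply: le_trans (ler_normB _ _) _.
      by have := gC (u x); have := gC (phi x); lra.
    by have := normr_ge0 (f2 x); lra.
  have s1 : (sq f1 <= (C ^+ 2)%:E * sq (h i \- partial i phi))%E.
    apply: sqint_scale => //; first exact: measurable_funB.
    by move=> x _; rewrite /f1 normrM gtr0_norm.
  have s2 : (sq f2 <= ((L * M%:R) ^+ 2)%:E * sq (u \- phi))%E.
    apply: sqint_scale => //; first exact: measurable_funB.
    by move=> x _; rewrite /f2 normrM ger0_norm// mulr_ge0// ltW.
  have s3 : (sq f3 <= ((2 * C) ^+ 2)%:E * sq (bk M))%E.
    apply: sqint_scale => //.
    by move=> x _; rewrite /f3 normrM ger0_norm// mulr_ge0// ltW.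
  have q1 := lt_le_trans p1 (_ : _ <= (e / (8 * D))%:E)%E.
  have q2 := lt_le_trans (p2 i) (_ : _ <= (e / (8 * D))%:E)%E.
  move: q1 q2; rewrite !lee_fin !ge_min !lexx /= => /(_ isT) q1 /(_ isT) q2.
  apply: le_lt_trans t3 _.
  move: t12 s1 s2 s3 hM q1 q2 (sqint_ge0 mu Omega (bk M)) (sqint_ge0 mu Omega (u \- phi))
    (sqint_ge0 mu Omega (h i \- partial i phi)) (sqint_ge0 mu Omega f12)
    (sqint_ge0 mu Omega f1) (sqint_ge0 mu Omega f2) (sqint_ge0 mu Omega f3).
  case: (sq (bk M)) => [x3| |]//; case: (sq (u \- phi)) => [x2| |]//.
  case: (sq (h i \- partial i phi)) => [x1| |]//.
  case: (sq f1) => [y1| |]//; case: (sq f2) => [y2| |]//; case: (sq f3) => [y3| |]//.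
  case: (sq f12) => [y| |]//.
  rewrite -?EFinM -?EFinD -?EFinM ?lee_fin ?lte_fin => h12 h1 h2' h3.
  rewrite !ltr_pdivlMr ?mulr_gt0 ?exprn_gt0// => r3 r2 r1 x30 x20 x10 y0 y10 y20 y30.
  move: h1 h2' h3 r3 r2 r1; rewrite /D !exprMn; have := exprn_gt0 2 C0.
  have := sqr_ge0 (L * M%:R); rewrite exprMn.
  move: (C ^+ 2) (L ^+ 2 * M%:R ^+ 2) => c l l0 c0 h1 h2' h3 r3 r2 r1.
  nra.
Unshelve. all: by end_near. Qed.

(** Primitives of functions bounded by C are at most C |t|, so the differences of compositions and
    of gradients are dominated by 2 C |u| and 2 C |h_i|. Both converge to 0 in L^2 by dominated
    convergence, and the gradient graph is closed. *)
Lemma chainable_cvg (f : nat -> R -> R) (g : R -> R) (C : R) :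
  (forall k, chainable (f k)) -> (forall k t, `|f k t| <= C) ->
  (forall t, f k t @[k --> \oo] --> g t) -> chainable g.
Proof.
move=> cf fC fg.
have C0 : 0 <= C by apply: le_trans (fC 0%N 0).
have mf k : measurable_fun setT (f k) by have [[]] := cf k.
have mF k : measurable_fun setT (lprim (f k)) by have [] := cf k.
have mg : measurable_fun setT g.
  by apply: (measurable_fun_cvg mf) => t _; exact: fg.
have gC t : `|g t| <= C.
  exact: (cvg_norm_le (fg t)).
have FG t : lprim (f k) t @[k --> \oo] --> lprim g t by exact: (lprim_cvg mf mg fC fg).
have mG : measurable_fun setT (lprim g).
  by apply: (measurable_fun_cvg mF) => t _; exact: FG.
split => //; first by split => //; exists C.
move=> u h Hu; have [u2 h2] := H10g_L2 oO Hu; have [mu' mh _] := Hu.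
have mgu : mfun (g \o u) by exact: mfun_comp.
have mfu k : mfun (f k \o u) by exact: mfun_comp.
apply: H10g_closed => //; first exact: mfun_comp.
  by move=> i; exact: measurable_funM.
move=> e e0.
have n1 : \forall k \near \oo, (sq ((lprim g \o u) \- (lprim (f k) \o u)) < e%:E)%E.
  apply: (@sqint_cvg0 _ _ _ mu Omega mO _ (fun x => 2 * C * u x)) => //.
  - by move=> k; apply: measurable_funB; exact: mfun_comp.
  - exact: L2mZ.
  - move=> k x _ /=; rewrite normrM ger0_norm ?mulr_ge0//.
    apply: le_trans (ler_normB _ _) _.
    by have := lprim_bound (u x) mg gC; have := lprim_bound (u x) (mf k) (fC k); lra.
  - move=> x _ /=; rewrite -(subrr (lprim g (u x))).
    by apply: cvgB; [exact: cvg_cst|exact: FG].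
have n2 : \forall k \near \oo, forall i : 'I_n,
    (sq ((fun x => g (u x) * h i x) \- (fun x => f k (u x) * h i x)) < e%:E)%E.
  apply: filter_forall => i.
  apply: (@sqint_cvg0 _ _ _ mu Omega mO _ (fun x => 2 * C * h i x)) => //.
  - by move=> k; apply: measurable_funB;
      [exact: (measurable_funM mgu (mh i))|exact: (measurable_funM (mfu k) (mh i))].
  - by apply: L2mZ.
  - move=> k x _ /=; rewrite -mulrBl normrM [leRHS]normrM.
    rewrite (ger0_norm (mulr_ge0 (ler0n _ 2) C0)) ler_wpM2r//.
    apply: le_trans (ler_normB _ _) _.
    by have := gC (u x); have := fC k (u x); lra.
  - move=> x _ /=; under eq_fun do rewrite -mulrBl.
    have H : (g (u x) - f k (u x)) * h i x @[k --> \oo] --> (g (u x) - g (u x)) * h i x.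
      by apply: cvgM; [apply: cvgB; [exact: cvg_cst|exact: fg]|exact: cvg_cst].
    by rewrite subrr mul0r in H.
have [k [k1 k2]] := filter_ex (filterI n1 n2).
exists (lprim (f k) \o u), (fun i x => f k (u x) * h i x); split => //.
by have [_ _] := cf k; apply.
Unshelve. all: by end_near. Qed.

Lemma chainable_lin (f g : R -> R) (c : R) : chainable f -> chainable g ->
  chainable (fun t => f t + c * g t).
Proof.
move=> [bf mf Hf] [bg mg Hg]; split; first exact: bmeas_lin.
  by rewrite lprim_lin//; apply: measurable_funD => //; exact: measurable_funM.
move=> u h Hu; rewrite lprim_lin//.
have := H10g_lin oO c (Hf _ _ Hu) (Hg _ _ Hu); congr H10g.
by apply/funext => i; apply/funext => x; ring.
Qed.

Lemma lprim0 : lprim (cst 0 : R -> R) = cst 0.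
Proof. by apply/funext => t; rewrite /lprim Rintegral_cst ?mul0r. Qed.

Lemma chainable0 : chainable (cst 0).
Proof.
split.
- by split => //; exists 0 => t; rewrite normr0.
- by rewrite lprim0.
move=> u h Hu; rewrite lprim0.
have := test_H10g oO (test_function_cst0 Omega); congr H10g.
by apply/funext => i; apply/funext => x; rewrite mul0r /partial derive_cst.
Qed.

(** The smooth steps B(k (t - a)) vanish up to and including t = a and are eventually 1 beyond it,
    so their limit is the indicator of the open ray; a >= 0 makes them vanish for t <= 0. *)
Lemma chainable_ray (a : R) : 0 <= a -> chainable (\1_(`]a, +oo[%classic) : R -> R).
Proof.
move=> a0.
pose f (k : nat) (t : R) := B (k%:R * t + - (k%:R * a)).
have fE k t : f k t = B (k%:R * (t - a)) by rewrite /f mulrBr.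
apply: (@chainable_cvg f _ 1).
(* The Lipschitz constant is 2 k; adding 1 keeps it positive when k = 0. *)
- move=> k; apply: (@chainable_smooth _ 1 (2 * k%:R + 1)) => //.
  + by apply: smooth_affine; exact: smooth_B.
  + by move=> t t0; rewrite fE lprim_le0// mulr_ge0_le0// subr_le0 (le_trans t0).
  + by move=> t; rewrite ger0_norm ?(B_ge0 beta_adm) ?(B_le1 beta_adm).
  + move=> s t; wlog st : s t / t <= s.
      move=> H; have [/H//|/ltW/H] := leP t s.
      by rewrite distrC [X in _ * X]distrC.
    have kst : k%:R * t + - (k%:R * a) <= k%:R * s + - (k%:R * a) :> R.
      by rewrite lerD2r ler_wpM2l.
    rewrite ger0_norm; last by rewrite subr_ge0; exact: (B_ndecr beta_adm).
    rewrite ger0_norm ?subr_ge0//.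
    apply: le_trans (B_lip beta_adm kst) _.
    have : 0 <= s - t by rewrite subr_ge0.
    have : 0 <= k%:R :> R by [].
    move: (k%:R : R) => q; nra.
- by move=> k t; rewrite ger0_norm ?(B_ge0 beta_adm) ?(B_le1 beta_adm).
- move=> t; have [ta|at'] := leP t a.
    rewrite indicE memNset; last by rewrite /= in_itv/= andbT; apply/negP; rewrite -leNgt.
    under eq_fun do rewrite fE lprim_le0 ?mulr_ge0_le0 ?subr_le0//.
    exact: cvg_cst.
  rewrite indicE mem_set; last by rewrite /= in_itv/= andbT.
  apply: cvg_near_cst; near=> k; rewrite fE (B_ge1 beta_adm)//.
  rewrite -ler_pdivrMr ?subr_gt0// mul1r; near: k; exact: nbhs_infty_ger.
Unshelve. all: by end_near. Qed.

(** The factor supported on ]0, +oo[ replaces a ray ]a, +oo[ by ]max a 0, +oo[, the case already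
    settled, and makes complements relative to ]0, +oo[. A disjoint countable union is a bounded
    limit of finite sums. *)
Lemma chainable_indic (A : set R) : measurable A ->
  chainable (fun t => \1_A t * \1_(`]0, +oo[%classic) t).
Proof.
pose P (A : set (measurableTypeR R)) := chainable (fun t => \1_A t * \1_(`]0, +oo[%classic) t).
move=> mA.
have eqM : @measurable _ (measurableTypeR R) = (@RGenOInfty.G R).-sigma.-measurable.
  exact: RGenOInfty.measurableE.
suff : P A by [].
apply: (dynkin_induction eqM) => //.
- move=> _ _ [a ->] [b ->]; exists (Num.max a b).
  by apply/seteqP; split => x /=; rewrite !in_itv/= !andbT gt_max;
    [by move=> [-> ->]|by move=> /andP].
- rewrite /P (_ : (fun _ => _) = \1_(`]0, +oo[%classic)); first exact: chainable_ray.
  by apply/funext => t; rewrite indicT mul1r.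
- move=> _ [a ->]; rewrite /P.
  rewrite (_ : (fun _ => _) = \1_(`]Num.max a 0, +oo[%classic)).
    by apply: chainable_ray; rewrite le_max lexx orbT.
  apply/funext => t.
  transitivity ((t \in `]a, +oo[%classic)%:R * (t \in `]0, +oo[%classic)%:R : R); first by [].
  rewrite indicE !mem_setE/= !in_itv/= !andbT gt_max.
  by case: (_ < t); case: (_ < t); rewrite ?mulr0 ?mul0r ?mulr1.
- move=> S mS PS; rewrite /P.
  rewrite (_ : (fun _ => _) = (fun t => \1_(`]0, +oo[%classic) t
      + (-1) * (\1_S t * \1_(`]0, +oo[%classic) t))).
    by apply: chainable_lin => //; exact: chainable_ray.
  apply/funext => t; rewrite !indicE in_setC; case: (t \in S) => /=; ring.
- move=> F mF tF PF; rewrite /P.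
  pose U m := [set t | exists2 k, (k < m)%N & F k t].
  apply: (@chainable_cvg (fun m t => \1_(U m) t * \1_(`]0, +oo[%classic) t) _ 1).
  + elim=> [|m IH].
      rewrite (_ : (fun _ => _) = cst 0); first exact: chainable0.
      apply/funext => t; rewrite indicE memNset ?mul0r// => -[k]//.
    rewrite (_ : (fun _ => _) = (fun t => \1_(U m) t * \1_(`]0, +oo[%classic) t
      + 1 * (\1_(F m) t * \1_(`]0, +oo[%classic) t))).
      by apply: chainable_lin => //; exact: PF.
    apply/funext => t; rewrite mul1r -mulrDl; congr (_ * _); rewrite !indicE.
    have [Fm|Fm] := pselect (F m t).
      rewrite (mem_set Fm) mem_set; last by exists m.
      rewrite memNset ?add0r// => -[k km Fk].
      move/trivIsetP : tF => /(_ k m Logic.I Logic.I).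
      rewrite (ltn_eqF km) => /(_ isT) h.
      by have : (F k `&` F m) t by []; rewrite h.
    rewrite (memNset Fm) addr0; congr (_%:R); congr nat_of_bool.
    apply/idP/idP => /set_mem [k km Fk]; apply/mem_set; exists k => //.
      move: km; rewrite ltnS leq_eqVlt => /predU1P[E|//].
      by exfalso; apply: Fm; rewrite -E.
    exact: ltnW.
  + move=> m t; rewrite !indicE; case: (_ \in _); case: (_ \in _);
      by rewrite ?mulr0 ?mul0r ?mulr1 ?normr0 ?normr1.
  + move=> t; apply: cvgM; last exact: cvg_cst.
    rewrite indicE; have [[k _ Fk]|h] := pselect ((\bigcup_k F k) t).
      rewrite mem_set; last by exists k.
      apply: cvg_near_cst; near=> m; rewrite indicE mem_set//; exists k => //.
      by near: m; exact: nbhs_infty_gt.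
    rewrite memNset//; apply: cvg_near_cst; near=> m; rewrite indicE memNset//.
    by move=> [k _ Fk]; apply: h; exists k.
- by have : (@measurable _ (measurableTypeR R)) A := mA; rewrite eqM.
Unshelve. all: by end_near. Qed.

Import HBNNSimple.

(* Smooth cutoffs give indicators of rays, the Dynkin theorem those of Borel sets,
   and closure under bounded pointwise limits gives every bounded Borel g. *)
Lemma chainable_ge0 (g : R -> R) (C : R) : measurable_fun setT g ->
  (forall t, 0 <= g t <= C) -> (forall t, t <= 0 -> g t = 0) -> chainable g.
Proof.
move=> mg gC g0.
have [||f [ndf fg]] := @approximation _ _ R setT measurableT (EFin \o g).
- exact/measurable_EFinP.
- by move=> t _; rewrite lee_fin; have /andP[] := gC t.
have fg' t : f k t @[k --> \oo] --> g t by exact: (fine_cvg (fg t Logic.I)).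
have fle k t : f k t <= g t.
  have := @nondecreasing_cvgn_le _ (fun k => f k t); rewrite (cvg_lim _ (fg' t))//; apply.
    by move=> p q pq; have /lefP := ndf _ _ pq; apply.
  exact: fg'.
apply: (@chainable_cvg (fun k t => f k t * \1_(`]0, +oo[%classic) t) _ C).
- move=> k.
  rewrite (_ : (fun _ => _) = fun t => \sum_(y <- finmap.enum_fset (fset_set (range (f k))))
       y * (\1_(f k @^-1` [set y]) t * \1_(`]0, +oo[%classic) t)).
    elim: (finmap.enum_fset _) => [|y r IH].
      by under eq_fun do rewrite big_nil; exact: chainable0.
    under eq_fun do rewrite big_cons addrC.
    apply: chainable_lin => //; apply: chainable_indic.
    by rewrite -[X in measurable X]setTI; exact: measurable_funP.
  apply/funext => t; rewrite fimfunE fsbig_finite//= big_distrl/=.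
  by apply: eq_bigr => y _; rewrite mulrA.
- move=> k t; rewrite normrM ger0_norm//.
  have /andP[gt0 gtC] := gC t.
  apply: (@le_trans _ _ (f k t)); last exact: le_trans (fle k t) _.
  by rewrite ler_piMr// indicE; case: (_ \in _); rewrite ?normr1 ?normr0.
- move=> t; have [t0|t0] := leP t 0.
    rewrite g0// indicE memNset; last by rewrite /= in_itv/= andbT; apply/negP; rewrite -leNgt.
    under eq_fun do rewrite mulr0.
    exact: cvg_cst.
  rewrite indicE mem_set; last by rewrite /= in_itv/= andbT.
  by under eq_fun do rewrite mulr1; exact: fg'.
Qed.

End chain_rule.

(** * Critical points *)

Section sobolev_inequality.
Variables (R : realType) (n : nat) (Omega : set 'rV[R]_n) (beta : R -> R).
Hypotheses (oO : open Omega) (beta_adm : admissible_beta beta).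
Local Notation mu := (lebesgue_rV R n).
Hypothesis finO : (mu Omega < +oo)%E.
Local Notation sq f := (sqint mu Omega f%R).
Local Notation mfun f := (measurable_fun Omega f).
Local Notation H10g := (H10g Omega).
Local Notation p := (sobolev_exponent R n).
Local Notation S := (sobolev_constant Omega).

Let mO : measurable Omega. Proof. exact: open_measurable_rV. Qed.

Definition energy (g : 'I_n -> 'rV[R]_n -> R) : R := \sum_i fine (sq (g i)).

Lemma energy_ge0 g : 0 <= energy g.
Proof. by rewrite sumr_ge0// => i _; rewrite fine_ge0// sqint_ge0. Qed.

Lemma H10g_normgrad2 u g : H10g u g ->
  \int[mu]_(x in Omega) (normgrad2 Omega u x) = energy g /\
  mu.-integrable Omega (fun x => (normgrad2 Omega u x)%:E).
Proof.
move=> Hu; have [H1u wae] := H10g_H1 oO beta_adm finO Hu.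
have [u2 g2] := H10g_L2 oO Hu.
have w2 i := (weak_partialP oO i H1u).1.
have [i1 i2] := Rintegral_sum_sqr oO w2.
split => //; rewrite /normgrad2 i2 /energy; apply: eq_bigr => i _; congr fine.
by apply: sqint_ae => //; [exact: (w2 i).1|exact: (g2 i).1].
Qed.

Lemma measurable_powR_abs (u : 'rV[R]_n -> R) (s : R) : mfun u -> mfun (fun x => `|u x| `^ s).
Proof.
move=> mu'; have ma : mfun (fun x => `|u x|) by exact: measurableT_comp.
exact: (measurableT_comp (measurable_powR s) ma).
Qed.

Lemma sobolev_ineq u g : 2 < p -> 0 < S -> H10g u g ->
  mu.-integrable Omega (fun x => (`|u x| `^ p)%:E) /\
  S * (\int[mu]_(x in Omega) (`|u x| `^ p)) `^ (2 / p) <= energy g.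
Proof.
move=> p2 S0 Hu; have p0 : 0 < p by apply: lt_trans p2.
have [mu' _ _] := Hu.
have mup := measurable_powR_abs p mu'.
have int0 I : I = 0 -> I `^ (2 / p) = 0 :> R.
  by move=> ->; rewrite powR0// gt_eqF// divr_gt0.
have [u0|un0] := pselect (ae_eq mu Omega u (cst 0)).
  have I0 : (\int[mu]_(x in Omega) (`|u x| `^ p)%:E = 0)%E.
    rewrite (ae_eq_integral (cst 0%E))//.
    - exact: integral0.
    - exact/measurable_EFinP.
    - apply: filterS u0 => x h Ox; rewrite h//= normr0 powR0// gt_eqF//.
  split; last by rewrite /Rintegral I0 int0// mulr0 energy_ge0.
  apply/integrableP; split; first exact/measurable_EFinP.
  by under eq_integral do rewrite gee0_abs ?lee_fin ?powR_ge0//; rewrite I0.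
have H10u := H10g_H10 oO beta_adm finO Hu.
move: S0; rewrite /sobolev_constant; set E := (X in inf X) => S0.
have lbE : lbound E 0.
  move=> _ [w _ <-]; rewrite divr_ge0// ?powR_ge0//.
  by apply: Rintegral_ge0 => x _; rewrite sumr_ge0// => i _; rewrite sqr_ge0.
have [ngE _] := H10g_normgrad2 Hu.
have Eu : E (energy g / (\int[mu]_(x in Omega) (`|u x| `^ p)) `^ (2 / p)).
  by exists u; rewrite ?ngE.
have SE : inf E <= energy g / (\int[mu]_(x in Omega) (`|u x| `^ p)) `^ (2 / p).
  by apply: ge_inf => //; exists 0.
have Ipos : 0 < \int[mu]_(x in Omega) (`|u x| `^ p).
  rewrite lt_def Rintegral_ge0 ?andbT; last by move=> x _; exact: powR_ge0.
  apply/eqP => I0; move: SE; rewrite int0// invr0 mulr0 leNgt.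
  by rewrite S0.
split; last by rewrite -ler_pdivlMr// powR_gt0.
apply/integrableP; split; first exact/measurable_EFinP.
under eq_integral do rewrite gee0_abs ?lee_fin ?powR_ge0//.
rewrite ltey; apply/eqP => Ioo.
by move: Ipos; rewrite /Rintegral Ioo ltxx.
Qed.

End sobolev_inequality.

(** * First variation of the functional *)

Section critical.
Variables (R : realType) (n : nat) (Omega : set 'rV[R]_n) (beta : R -> R).
Hypotheses (oO : open Omega) (beta_adm : admissible_beta beta).
Local Notation mu := (lebesgue_rV R n).
Hypothesis finO : (mu Omega < +oo)%E.
Local Notation sq f := (sqint mu Omega f%R).
Local Notation L2o := (L2m mu Omega).
Local Notation H10g := (H10g Omega).
Local Notation p := (sobolev_exponent R n).
Local Notation S := (sobolev_constant Omega).
Local Notation B := (lprim beta).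
Variables (lambda kappa eps : R).
Hypotheses (p2 : 2 < p) (S0 : 0 < S).
Local Notation J := (J Omega beta lambda kappa eps).

Let mO : measurable Omega. Proof. exact: open_measurable_rV. Qed.
Let p0 : 0 < p. Proof. exact: lt_trans p2. Qed.

(** The part of the integrand of [J] that does not involve the gradient. *)
Definition pot (t : R) : R := B ((t - 1) / eps)
  - (lambda / 2 * (Num.max (t - 1) 0) ^+ 2 + kappa / p * (Num.max (t - 1) 0) `^ p).

Lemma max_sub1_le (t : R) : 0 <= Num.max (t - 1) 0 <= `|t|.
Proof. by rewrite le_max lexx orbT ge_max normr_ge0 andbT; have := ler_norm t; lra. Qed.

Lemma measurable_B : measurable_fun setT B.
Proof. apply: measurable_continuousR; exact: smooth_continuous (smooth_B beta_adm). Qed.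

Lemma measurable_pot : measurable_fun setT pot.
Proof.
have mmax : measurable_fun setT (fun t : R => Num.max (t - 1) 0).
  by apply: measurable_maxr => //; exact: measurable_funB.
apply: measurable_funB.
  apply: (measurableT_comp measurable_B); apply: measurable_funM => //.
  exact: measurable_funB.
apply: measurable_funD; apply: measurable_funM => //.
  exact: measurable_funX.
exact: (measurableT_comp (measurable_powR p) mmax).
Qed.

(** Growth of order p is what the Sobolev inequality makes integrable; the square comes from L^2 and
    the constant from the finite volume. *)
Lemma growth_integrable u g (m : R -> R) (c0 c1 c2 : R) : H10g u g ->
  measurable_fun setT m ->
  (forall t, `|m t| <= c0 + (c1 * t ^+ 2 + c2 * `|t| `^ p)) ->
  mu.-integrable Omega (fun x => (m (u x))%:E).
Proof.
move=> Hu mm hm; have [u2 g2] := H10g_L2 oO Hu; have [mu' _ _] := Hu.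
have [ip _] := sobolev_ineq oO beta_adm finO p2 S0 Hu.
have i2 := L2m_integrable_sqr u2.
have i1 : mu.-integrable Omega (fun x => c0%:E).
  apply/integrableP; split; first exact/measurable_EFinP.
  by rewrite integral_cst//= lte_mul_pinfty.
have iF := integrable_add mO i1 (integrable_add mO
  (integrable_scale mO c1 i2) (integrable_scale mO c2 ip)).
apply: (le_integrable mO _ _ iF).
  by apply/measurable_EFinP; exact: (measurableT_comp mm mu').
by move=> x _; rewrite /= lee_fin (le_trans (hm _))// ler_norm.
Qed.

Lemma pot_integrable u g : H10g u g -> mu.-integrable Omega (fun x => (pot (u x))%:E).
Proof.
move=> Hu; apply: (growth_integrable (c0 := 1) (c1 := `|lambda|) (c2 := `|kappa / p|) Hu
  measurable_pot).
move=> t; have /andP[m0 mle] := max_sub1_le t.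
rewrite /pot; apply: le_trans (ler_normB _ _) _; apply: lerD.
  by rewrite ger0_norm ?(B_ge0 beta_adm) ?(B_le1 beta_adm).
apply: le_trans (ler_normD _ _) _; apply: lerD.
  rewrite normrM (ger0_norm (sqr_ge0 _)); apply: ler_pM => //.
  - exact: sqr_ge0.
  - rewrite normrM normfV (ger0_norm (ler0n _ 2)) ler_piMr//.
    by rewrite invf_le1// ler1n.
  - by rewrite -(real_normK (num_real t)) lerXn2r ?nnegrE ?normr_ge0.
rewrite normrM (ger0_norm (powR_ge0 _ _)) ler_wpM2l//.
by apply: ge0_ler_powR => //; rewrite ?nnegrE// ltW.
Qed.

Lemma J_split u g : H10g u g ->
  J u = 2^-1 * energy Omega g + \int[mu]_(x in Omega) pot (u x).
Proof.
move=> Hu; have [ng ing] := H10g_normgrad2 oO beta_adm finO Hu.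
have ipot := pot_integrable Hu.
rewrite -ng -RintegralZl// -RintegralD//; last exact: integrable_scale.
apply: eq_Rintegral => x _; rewrite /pot primitiveE; last first.
  by move=> s; exact: beta_le0.
by rewrite opprD !addrA.
Qed.

Lemma H10gZ u g (c : R) : H10g u g -> H10g (fun x => c * u x) (fun i x => c * g i x).
Proof.
move=> Hu; have := H10g_lin oO c (test_H10g oO (test_function_cst0 Omega)) Hu.
congr H10g; first by apply/funext => x; rewrite /= add0r.
by apply/funext => i; apply/funext => x; rewrite /partial derive_cst add0r.
Qed.

(* A one-sided bound on the potential along [W \o u] suffices, so that neither
   beta' nor differentiability of the potential part of J enters. *)
Lemma critical_direction u (W gam h : R -> R) :
  critical_point Omega J u -> bmeas gam ->
  H10g (W \o u) (fun i x => gam (u x) * weak_partial Omega i u x) ->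
  mu.-integrable Omega (fun x => (h (u x))%:E) ->
  (forall s t, 0 < s <= 1 -> pot (t + s * W t) - pot t <= s * h t) ->
  0 <= \sum_i \int[mu]_(x in Omega) (gam (u x) * (weak_partial Omega i u x) ^+ 2)
     + \int[mu]_(x in Omega) h (u x).
Proof.
move=> [H10u crit] bgam HW ih hP.
set wp := fun i => weak_partial Omega i u.
have Hu : H10g u wp := H10_H10g oO beta_adm finO H10u.
have [u2 w2] := H10g_L2 oO Hu; have [W2 gw2] := H10g_L2 oO HW.
set A := \sum_i _; set H := \int[mu]_(x in Omega) h (u x).
pose D := energy Omega (fun i x => gam (u x) * wp i x).
pose n0 := Num.sqrt (fine (sq (W \o u)) + D).
have n00 : 0 <= n0 by exact: sqrtr_ge0.
have D0 : 0 <= D by exact: energy_ge0.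
have Eexp s : energy Omega (fun i x => wp i x + s * (gam (u x) * wp i x)) =
    energy Omega wp + 2 * s * A + s ^+ 2 * D.
  rewrite /energy /A /D /energy !mulr_sumr -!big_split /=; apply: eq_bigr => i _.
  rewrite -[LHS]/(Rintegral mu Omega (fun x => (wp i x + s * (gam (u x) * wp i x)) ^+ 2)).
  rewrite -[fine (sq (wp i))]/(Rintegral mu Omega (fun x => (wp i x) ^+ 2)).
  rewrite -[fine (sq _)]/(Rintegral mu Omega (fun x => (gam (u x) * wp i x) ^+ 2)).
  have j1 := L2m_integrable_sqr (w2 i); have j2 := L2m_integrable_sqr (gw2 i).
  have j3 : mu.-integrable Omega (fun x => (gam (u x) * wp i x ^+ 2)%:E).
    have := L2m_integrableM mO (gw2 i) (w2 i); congr (integrable _ _ _).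
    by apply/funext => x; rewrite -mulrA -expr2.
  rewrite -RintegralZl// -RintegralZl// -RintegralD//; last exact: integrable_scale.
  rewrite -RintegralD//; first by apply: eq_Rintegral => x _; rewrite /wp; ring.
    by apply: integrable_add => //; exact: integrable_scale.
  exact: integrable_scale.
apply/ler_addgt0Pr => eta eta0.
pose e := eta / (2 * (n0 + 1)); have e0 : 0 < e by rewrite divr_gt0// mulr_gt0// ltr_wpDl.
have [d d0 Hd] := crit e e0.
(* The bound d/(n0 + 1) keeps s W(u) within the radius d, and eta/(D + 1) makes the quadratic term s
   D/2 at most eta/2; the choice of [e] makes the remainder e n0 at most eta/2. *)
pose s := Num.min 1 (Num.min (d / (n0 + 1)) (eta / (D + 1))) / 2.
have m0 : 0 < Num.min 1 (Num.min (d / (n0 + 1)) (eta / (D + 1))).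
  by rewrite !lt_min ltr01 !divr_gt0// ltr_wpDl.
have s0 : 0 < s by rewrite divr_gt0.
have sm : s < Num.min 1 (Num.min (d / (n0 + 1)) (eta / (D + 1))) by rewrite /s; lra.
move: sm; rewrite !lt_min => /and3P[s1 sd seta].
pose v x := s * W (u x).
have Hv : H10g v (fun i x => s * (gam (u x) * wp i x)) by exact: H10gZ.
have [v2 sgw2] := H10g_L2 oO Hv.
have [H1v vae] := H10g_H1 oO beta_adm finO Hv.
have nv : H1_norm Omega v = s * n0.
  rewrite (H1_norm_sqr oO v2 sgw2 (fun i => (weak_partialP oO i H1v).1) vae).
  have sqs f : L2o f -> fine (sq (fun x => s * f x)) = s ^+ 2 * fine (sq f).
    move=> f2; rewrite -[LHS]/(Rintegral mu Omega (fun x => (s * f x) ^+ 2)).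
    rewrite -[fine (sq f)]/(Rintegral mu Omega (fun x => (f x) ^+ 2)).
    rewrite -RintegralZl//; last exact: L2m_integrable_sqr.
    by apply: eq_Rintegral => x _; rewrite exprMn.
  rewrite (sqs (W \o u))// (eq_bigr (fun i => s ^+ 2 * fine (sq (fun x => gam (u x) * wp i x)))).
    by rewrite -mulr_sumr -mulrDr sqrtrM ?sqr_ge0// sqrtr_sqr gtr0_norm.
  by move=> i _; rewrite -(sqs _ (gw2 i)).
have := Hd v (H10g_H10 oO beta_adm finO Hv).
have sn0 : s * n0 < d.
  apply: (@le_lt_trans _ _ (s * (n0 + 1))); first by rewrite ler_pM2l// lerDl.
  by rewrite -ltr_pdivlMr// ltr_wpDl.
rewrite nv => /(_ sn0); rewrite /= subr0 => Jd.
have HuV : H10g (u \+ v) (fun i x => wp i x + s * (gam (u x) * wp i x)).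
  have := H10g_lin oO s Hu HW; exact.
have E1 := J_split Hu; have E2 := J_split HuV.
have ipu := pot_integrable Hu; have ipuv := pot_integrable HuV.
have Jge : - (e * (s * n0)) <= J (u \+ v) - J u.
  by move: Jd; rewrite ler_norml => /andP[].
have potle : \int[mu]_(x in Omega) pot ((u \+ v) x) - \int[mu]_(x in Omega) pot (u x) <= s * H.
  rewrite -RintegralB// /H -RintegralZl//; apply: le_Rintegral => //.
  - have := integrableB mO ipuv ipu; exact.
  - exact: integrable_scale.
  - by move=> x _; apply: hP; rewrite s0 ltW.
move: Jge; rewrite E1 E2 Eexp => Jge.
have key : - (e * n0) <= A + s / 2 * D + H.
  rewrite -(ler_pM2l s0).
  have alg (E a D' h' i j e' m' s' : R) :
      - (e' * (s' * m')) <= 2^-1 * (E + 2 * s' * a + s' ^+ 2 * D') + i - (2^-1 * E + j) ->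
      i - j <= s' * h' -> s' * - (e' * m') <= s' * (a + s' / 2 * D' + h').
    move=> h1 h2.
    have -> : s' * - (e' * m') = - (e' * (s' * m')) by ring.
    have -> : s' * (a + s' / 2 * D' + h') =
      2^-1 * (E + 2 * s' * a + s' ^+ 2 * D') + i - (2^-1 * E + j) + (s' * h' - (i - j)) by field.
    by apply: le_trans h1 _; rewrite lerDl subr_ge0.
  exact: alg Jge potle.
have h1 : e * n0 <= eta / 2.
  rewrite /e mulrAC ler_pdivrMr ?mulr_gt0 ?ltr_wpDl//.
  by rewrite mulrA divfK ?pnatr_eq0// ler_wpM2l ?lerDl// ltW.
have h2 : s / 2 * D <= eta / 2.
  have : s * (D + 1) < eta by rewrite -ltr_pdivlMr// ltr_wpDl.
  move=> hs; rewrite mulrAC ler_pM2r ?invr_gt0//; apply: ltW; apply: le_lt_trans hs.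
  by rewrite ler_pM2l// lerDl.
have alg2 (a b c d' t : R) : - a <= c + b + d' -> a <= t / 2 -> b <= t / 2 ->
    0 <= c + d' + t.
  move=> g1 g2 g3; have -> : c + d' + t = (c + b + d' + a) + (t / 2 - a) + (t / 2 - b) by field.
  by rewrite addr_ge0 ?subr_ge0// addr_ge0 ?subr_ge0// -lerBlDr sub0r.
exact: alg2 key h1 h2.
Qed.

End critical.

Section powR_facts.
Variable R : realType.
Implicit Types a b s : R.

Lemma powR_split a s : 0 < s -> 0 <= a -> a `^ s = a `^ (s - 1) * a.
Proof.
move=> s0; rewrite le_eqVlt => /predU1P[<-|a0].
  by rewrite mulr0 powR0// gt_eqF.
by rewrite -[X in _ * X]powRr1 ?ltW// -powRD ?subrK// (gt_eqF a0) implybT.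
Qed.

(** This is Young's inequality for b and a^(p-1) with the conjugate exponents p and p/(p-1), hence
    valid at a = 0 without any derivative there. *)
Lemma powR_tangent a b (p : R) : 1 < p -> 0 <= a -> 0 <= b ->
  a `^ p + p * a `^ (p - 1) * (b - a) <= b `^ p.
Proof.
move=> p1 a0 b0; have p0 : 0 < p by apply: lt_trans p1.
pose q := p / (p - 1); have q0 : 0 < q by rewrite divr_gt0// subr_gt0.
have pq : p^-1 + q^-1 = 1.
  by rewrite /q invf_div mulrBl mul1r mulfV ?gt_eqF// addrC subrK.
have := conjugate_powR b0 (powR_ge0 a (p - 1)) p0 q0 pq.
have -> : (a `^ (p - 1)) `^ q = a `^ p.
  by rewrite -powRrM /q mulrC divfK// gt_eqF// subr_gt0.
have qi : q^-1 = 1 - p^-1 by rewrite -pq [_ + q^-1]addrC addrK.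
rewrite qi -(ler_pM2l p0) mulrDr => h.
have ap := powR_split p0 a0.
have e1 : p * (b `^ p / p) = b `^ p by rewrite mulrC divfK// gt_eqF.
have e2 : p * (a `^ p * (1 - p^-1)) = p * a `^ p - a `^ p.
  by rewrite mulrBr mulr1 mulrBr mulrCA mulfV ?gt_eqF// mulr1.
rewrite e1 e2 in h; rewrite mulrBr -[p * _ * a]mulrA -ap.
move: h; rewrite [b * _]mulrC mulrA; lra.
Qed.

End powR_facts.

Section lprim_indicator.
Variable R : realType.
Local Notation leb := (@lebesgue_measure R).

Lemma bmeas_indic (A : set R) : measurable A -> bmeas (\1_A : R -> R).
Proof.
move=> mA; split; first exact: measurable_indic.
by exists 1 => t; rewrite indicE; case: (_ \in _); rewrite ?normr1 ?normr0.
Qed.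

Lemma lprim_ray (a t : R) : 0 <= a -> lprim (\1_(`]a, +oo[%classic)) t = Num.max (t - a) 0.
Proof.
move=> a0; have [ta|at'] := leP t a.
  rewrite max_r ?subr_le0// /lprim (@eq_Rintegral _ _ _ _ _ (cst 0)) ?Rintegral_cst ?mul0r//.
  move=> s; rewrite inE/= in_itv/= => /andP[_ st]; rewrite indicE memNset//=.
  by rewrite in_itv/= andbT; apply/negP; rewrite -leNgt (le_trans st).
rewrite max_l ?subr_ge0 ?ltW// /lprim /Rintegral integral_indic//.
rewrite (_ : _ `&` _ = `]a, t]%classic).
  have E : (leb [set` `]a, t]] = (t - a)%:E)%E.
    by rewrite lebesgue_measure_itv/= lte_fin at'.
  exact: (congr1 fine E).
apply/seteqP; split => s /=; rewrite !in_itv/= ?andbT.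
  by move=> [-> /andP[]].
by move=> /andP[as' ->]; rewrite as' (le_trans a0 (ltW as')).
Qed.

End lprim_indicator.

(** * Sign, subsolution inequality and energy bound for critical points *)

Section critical_estimates.
Variables (R : realType) (n : nat) (Omega : set 'rV[R]_n) (beta : R -> R).
Hypotheses (oO : open Omega) (beta_adm : admissible_beta beta).
Local Notation mu := (lebesgue_rV R n).
Hypothesis finO : (mu Omega < +oo)%E.
Local Notation sq f := (sqint mu Omega f%R).
Local Notation H10g := (H10g Omega).
Local Notation p := (sobolev_exponent R n).
Local Notation S := (sobolev_constant Omega).
Local Notation B := (lprim beta).
Variables (lambda kappa eps : R).
Hypotheses (p2 : 2 < p) (S0 : 0 < S).
Hypotheses (lambda0 : 0 < lambda) (kappa0 : 0 < kappa) (eps0 : 0 < eps).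
Local Notation J := (J Omega beta lambda kappa eps).
Local Notation pot := (pot n beta lambda kappa eps).
Variable u : 'rV[R]_n -> R.
Hypothesis ucrit : critical_point Omega J u.
Local Notation wp := (fun i => weak_partial Omega i u).

Let mO : measurable Omega. Proof. exact: open_measurable_rV. Qed.
Let p0 : 0 < p. Proof. exact: lt_trans p2. Qed.
Let p1 : 1 < p. Proof. by apply: lt_trans p2; rewrite ltr1n. Qed.
Let Hu : H10g u wp. Proof. by case: ucrit => h _; exact: (H10_H10g oO beta_adm finO). Qed.

Definition vplus (t : R) : R := Num.max (t - 1) 0.
(** As functions of (u-1)_+, [force] is the derivative of [forcep], the sum of the two power terms
    of [J]. *)
Definition force (t : R) : R := lambda * vplus t + kappa * vplus t `^ (p - 1).
Definition forcep (t : R) : R := lambda / 2 * vplus t ^+ 2 + kappa / p * vplus t `^ p.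

Lemma vplus_ge0 t : 0 <= vplus t. Proof. by rewrite /vplus le_max lexx orbT. Qed.

Lemma vplus_le t : vplus t <= `|t|. Proof. by have /andP[] := max_sub1_le t. Qed.

Lemma vplus_le1 t : t <= 1 -> vplus t = 0.
Proof. by move=> t1; rewrite /vplus max_r// subr_le0. Qed.

Lemma vplus_ge1 t : 1 <= t -> vplus t = t - 1.
Proof. by move=> t1; rewrite /vplus max_l// subr_ge0. Qed.

Lemma measurable_vplus : measurable_fun setT vplus.
Proof. by apply: measurable_maxr => //; exact: measurable_funB. Qed.

Lemma measurable_vplus_powR (s : R) : measurable_fun setT (fun t => vplus t `^ s).
Proof. exact: (measurableT_comp (measurable_powR s) measurable_vplus). Qed.

Lemma measurable_force : measurable_fun setT force.
Proof.
apply: measurable_funD; apply: measurable_funM => //; first exact: measurable_vplus.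
exact: measurable_vplus_powR.
Qed.

Lemma force_ge0 t : 0 <= force t.
Proof.
rewrite /force addr_ge0// mulr_ge0 ?powR_ge0 ?vplus_ge0//; exact: ltW.
Qed.

(** [forcep] is convex in (u-1)_+: the quadratic part leaves a square, the power part is the tangent
    inequality. *)
Lemma forcep_tangent s t : force t * (vplus s - vplus t) <= forcep s - forcep t.
Proof.
have := powR_tangent p1 (vplus_ge0 t) (vplus_ge0 s); rewrite /force /forcep.
move: (vplus s) (vplus t) (vplus s `^ p) (vplus t `^ p) (vplus t `^ (p - 1)) => x y a b c h.
have h1 : kappa / p * (b + p * c * (x - y)) <= kappa / p * a by rewrite ler_wpM2l// divr_ge0// ltW.
have e1 : kappa / p * (b + p * c * (x - y)) = kappa / p * b + kappa * c * (x - y).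
  by rewrite mulrDr -[p * c * _]mulrA mulrA divfK ?gt_eqF// mulrA.
rewrite e1 in h1.
have h2 : 0 <= lambda / 2 * (x - y) ^+ 2 by rewrite mulr_ge0 ?sqr_ge0// divr_ge0// ltW.
have e2 : lambda / 2 * x ^+ 2 - lambda / 2 * y ^+ 2 - lambda * y * (x - y) =
  lambda / 2 * (x - y) ^+ 2 by field.
rewrite -e2 in h2.
rewrite mulrDl; move: h1 h2; move: (kappa / p * a) (kappa / p * b) => ? ?; lra.
Qed.

Lemma force_vplus t : force t * vplus t = lambda * vplus t ^+ 2 + kappa * vplus t `^ p.
Proof. by rewrite /force mulrDl -!mulrA -expr2 -powR_split// vplus_ge0. Qed.

Lemma vplus_sqr_le t : vplus t ^+ 2 <= t ^+ 2.
Proof. by rewrite -(real_normK (num_real t)) lerXn2r ?nnegrE ?normr_ge0 ?vplus_ge0 ?vplus_le. Qed.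

Lemma vplus_powR_le (s : R) t : 0 <= s -> vplus t `^ s <= `|t| `^ s.
Proof. by move=> s0; apply: ge0_ler_powR => //; rewrite ?nnegrE ?vplus_ge0 ?vplus_le. Qed.

Lemma vplus_p_integrable : mu.-integrable Omega (fun x => (vplus (u x) `^ p)%:E).
Proof.
apply: (growth_integrable oO beta_adm finO p2 S0 (c0 := 0) (c1 := 0) (c2 := 1) Hu
  (m := fun t => vplus t `^ p)).
  exact: measurable_vplus_powR.
by move=> t; rewrite mul0r !add0r mul1r ger0_norm ?powR_ge0// vplus_powR_le ?ltW.
Qed.

Lemma vplus_sqr_integrable : mu.-integrable Omega (fun x => (vplus (u x) ^+ 2)%:E).
Proof.
apply: (growth_integrable oO beta_adm finO p2 S0 (c0 := 0) (c1 := 1) (c2 := 0) Hu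
  (m := fun t => vplus t ^+ 2)).
  by apply: measurable_funX; exact: measurable_vplus.
by move=> t; rewrite mul0r !add0r addr0 mul1r ger0_norm ?sqr_ge0// vplus_sqr_le.
Qed.

Lemma potE t : pot t = B ((t - 1) / eps) - forcep t. Proof. by []. Qed.

Lemma pot_le1 t : t <= 1 -> pot t = 0.
Proof.
move=> t1; rewrite potE lprim_le0; last by rewrite mulr_le0_ge0 ?subr_le0 ?invr_ge0// ltW.
by rewrite /forcep vplus_le1// expr0n powR0 ?gt_eqF// !mulr0 addr0 subr0.
Qed.

Lemma H10g_lprim (g : R -> R) (C : R) : measurable_fun setT g -> (forall t, 0 <= g t <= C) ->
  (forall t, t <= 0 -> g t = 0) -> H10g (lprim g \o u) (fun i x => g (u x) * wp i x).
Proof.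
by move=> mg gC g0; have [_ _] := chainable_ge0 oO beta_adm mg gC g0; apply.
Qed.

Lemma measurable_lprim (g : R -> R) (C : R) : measurable_fun setT g -> (forall t, 0 <= g t <= C) ->
  (forall t, t <= 0 -> g t = 0) -> measurable_fun setT (lprim g).
Proof.
by move=> mg gC g0; have [_ + _] := chainable_ge0 oO beta_adm mg gC g0.
Qed.

Lemma ray01 (a t : R) : 0 <= (\1_(`]a, +oo[%classic) t : R) <= 1.
Proof. by rewrite indicE; case: (_ \in _); rewrite /= ?lexx ler01. Qed.

Lemma ray_le (a t : R) : t <= a -> \1_(`]a, +oo[%classic) t = 0 :> R.
Proof. by move=> ta; rewrite indicE memNset//= in_itv/= andbT; apply/negP; rewrite -leNgt. Qed.

Lemma ray_gt (a t : R) : a < t -> \1_(`]a, +oo[%classic) t = 1 :> R.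
Proof. by move=> ta; rewrite indicE mem_set//= in_itv/= andbT. Qed.

(** The direction is the negative part, written -t + t_+ so that the chain rule for primitives
    applies. For s <= 1 a negative value moves toward 0 without crossing it, where [pot] vanishes;
    hence the energy of the negative part is at most 0, and the Sobolev inequality makes it
    vanish. *)
Lemma critical_ge0 : \forall x \ae mu, Omega x -> 0 <= u x.
Proof.
pose r : R -> R := \1_(`]0, +oo[%classic).
pose gam t : R := -1 + 1 * r t.
pose W t : R := -1 * t + 1 * lprim r t.
have WE t : W t = - Num.min t 0.
  rewrite /W lprim_ray// subr0 mul1r; case: (leP t 0) => t0.
    by rewrite addr0 mulN1r.
  by rewrite mulN1r addNr oppr0.
have HW : H10g (W \o u) (fun i x => gam (u x) * wp i x).
  have mr : measurable_fun setT r by exact: measurable_indic.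
  have H1 := H10g_lprim mr (ray01 0) (@ray_le 0).
  have := H10g_lin oO 1 (H10gZ oO (-1) Hu) H1; congr H10g.
  by apply/funext => i; apply/funext => x; rewrite /gam; ring.
have bg : bmeas gam.
  apply: bmeas_lin; last exact: bmeas_indic.
  by split; [exact: measurable_cst|exists 1 => t; rewrite normrN1].
have i0 : mu.-integrable Omega (fun x => (cst 0 (u x))%:E) by exact: integrable0.
have := @critical_direction _ _ _ _ oO beta_adm finO lambda kappa eps p2 S0 u W gam (cst 0)
  ucrit bg HW i0.
have hP s t : 0 < s <= 1 -> pot (t + s * W t) - pot t <= s * cst 0 t.
  move=> /andP[s0 s1]; rewrite mulr0 WE; case: (leP t 0) => t0; last first.
    by rewrite oppr0 mulr0 addr0 subrr.
  rewrite !pot_le1 ?subrr//; first by apply: le_trans t0 _.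
  have : 0 <= (1 - s) * - t by rewrite mulr_ge0 ?subr_ge0// oppr_ge0.
  lra.
move=> /(_ hP); rewrite {2}/Rintegral /= integral0 addr0 => le0.
have [_ sob] := sobolev_ineq oO beta_adm finO p2 S0 HW.
have E0 : energy Omega (fun i x => gam (u x) * wp i x) <= 0.
  rewrite -oppr_ge0 -sumrN; apply: le_trans le0 _.
  rewrite le_eqVlt; apply/orP; left; apply/eqP; apply: eq_bigr => i _.
  rewrite -[fine (sq _)]/(Rintegral mu Omega (fun x => (gam (u x) * wp i x) ^+ 2)).
  have [_ g2] := H10g_L2 oO HW.
  rewrite -mulN1r -RintegralZl//; last exact: (L2m_integrable_sqr (g2 i)).
  apply: eq_Rintegral => x _; rewrite /gam /r; case: (leP (u x) 0) => h.
    by rewrite ray_le//; ring.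
  by rewrite ray_gt//; ring.
have I0 : \int[mu]_(x in Omega) `|(W \o u) x| `^ p = 0.
  apply: contrapT => /eqP I0; have := le_trans sob E0.
  rewrite pmulr_rle0// leNgt powR_gt0// lt_def I0 /=; apply: Rintegral_ge0 => x _; exact: powR_ge0.
have [iW _] := sobolev_ineq oO beta_adm finO p2 S0 HW.
have I0' : (\int[mu]_(x in Omega) `|(`|(W \o u) x| `^ p)%:E| = 0)%E.
  under eq_integral do rewrite gee0_abs ?lee_fin ?powR_ge0//.
  rewrite -(fineK (integrable_fin_num mO iW)).
  by move: I0; rewrite /Rintegral => ->.
have /integrableP[mW _] := iW.
have /(ae_eq_integral_abs mu mO mW) := I0'.
apply: filterS => x h Ox; have := h Ox => -[] /powR_eq0_eq0/eqP.
rewrite normr_eq0 /= WE oppr_eq0; case: (leP (u x) 0) => [_ /eqP ->//|/ltW//].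
Qed.

(** Weak form of -Laplace u <= force(u), tested with [lprim g] of u. Along the downward direction
    the monotone beta term can only decrease, and convexity of [forcep] together with the
    1-Lipschitz map t -> (t-1)_+ bounds the rest. *)
Lemma critical_upper (g : R -> R) (C : R) : measurable_fun setT g ->
  (forall t, 0 <= g t <= C) -> (forall t, t <= 1 -> g t = 0) ->
  mu.-integrable Omega (fun x => (force (u x) * lprim g (u x))%:E) /\
  \sum_i \int[mu]_(x in Omega) (g (u x) * wp i x ^+ 2) <=
  \int[mu]_(x in Omega) (force (u x) * lprim g (u x)).
Proof.
move=> mg gC g1; have g0 t : t <= 0 -> g t = 0 by move=> t0; rewrite g1// (le_trans t0).
have C0 : 0 <= C by have /andP[h1 h2] := gC 0; exact: le_trans h2.
have mG := measurable_lprim mg gC g0.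
have gC' t : `|g t| <= C by have /andP[? ?] := gC t; rewrite ger0_norm.
have bG t := lprim_bound t mg gC'.
have G0 t : 0 <= lprim g t by apply: Rintegral_ge0 => s _; have /andP[] := gC s.
have iF : mu.-integrable Omega (fun x => (force (u x) * lprim g (u x))%:E).
  apply: (growth_integrable oO beta_adm finO p2 S0 (c0 := 0) (c1 := lambda * C)
    (c2 := kappa * C) Hu (m := fun t => force t * lprim g t)).
    by apply: measurable_funM => //; exact: measurable_force.
  move=> t; rewrite add0r normrM (ger0_norm (force_ge0 t)).
  apply: (@le_trans _ _ ((lambda * `|t| + kappa * `|t| `^ (p - 1)) * (C * `|t|))).
    apply: ler_pM => //; first exact: force_ge0.
    apply: lerD; rewrite ler_wpM2l ?(ltW lambda0) ?(ltW kappa0) ?vplus_le//.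
    by rewrite vplus_powR_le// subr_ge0 ltW.
  rewrite (powR_split p0 (normr_ge0 t)) -(real_normK (num_real t)).
  by rewrite le_eqVlt; apply/orP; left; apply/eqP; ring.
split => //.
pose gam t : R := -1 * g t.
have HW : H10g ((fun t => -1 * lprim g t) \o u) (fun i x => gam (u x) * wp i x).
  have := H10gZ oO (-1) (H10g_lprim mg gC g0); congr H10g.
  by apply/funext => i; apply/funext => x; rewrite /gam; ring.
have bg : bmeas gam.
  by split; [exact: measurable_funM|exists C => t; rewrite /gam mulN1r normrN].
have hP s t : 0 < s <= 1 -> pot (t + s * (-1 * lprim g t)) - pot t <= s * (force t * lprim g t).
  move=> /andP[s0 s1]; rewrite mulN1r mulrN.
  have sG : 0 <= s * lprim g t by rewrite mulr_ge0// ltW.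
  have Bm : B ((t - s * lprim g t - 1) / eps) <= B ((t - 1) / eps).
    by apply: (B_ndecr beta_adm); rewrite ler_wpM2r ?invr_ge0 ?(ltW eps0)//; lra.
  have ft := forcep_tangent (t - s * lprim g t) t.
  have vl : vplus t - vplus (t - s * lprim g t) <= s * lprim g t.
    rewrite /vplus; move: (s * lprim g t) sG => y y0.
    by case: (leP (t - 1) 0); case: (leP (t - y - 1) 0); lra.
  have fv : force t * (vplus t - vplus (t - s * lprim g t)) <= force t * (s * lprim g t).
    by rewrite ler_wpM2l// force_ge0.
  rewrite !potE mulrCA; move: Bm ft fv; rewrite !mulrBr.
  by move: (force t * _) (force t * _) (force t * _) => ? ? ?; lra.
have := @critical_direction _ _ _ _ oO beta_adm finO lambda kappa eps p2 S0 u
  (fun t => -1 * lprim g t) gam (fun t => force t * lprim g t) ucrit bg HW iF hP.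
rewrite addrC -lerBlDr sub0r -sumrN; apply: le_trans.
rewrite le_eqVlt; apply/orP; left; apply/eqP; apply: eq_bigr => i _.
have [_ w2] := H10g_L2 oO Hu; have [_ g2] := H10g_L2 oO (H10g_lprim mg gC g0).
rewrite -mulN1r -RintegralZl//.
  by apply: eq_Rintegral => x _; rewrite /gam; ring.
have := integrable_scale mO (-1) (L2m_integrableM mO (g2 i) (w2 i)); congr (integrable _ _ _).
by apply/funext => x; rewrite /gam /=; congr EFin; ring.
Qed.

(** In the direction (u-1)_+, half of the first variation inequality is added to J(u) <= M. The
    gradient over {u > 1} is at most the full energy, the integral of the beta term in J is
    nonnegative and dropped, and the lambda terms cancel. The beta increment contributes 2 |Omega|,
    halved to |Omega|. *)
Lemma critical_level (M : R) : J u <= M ->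
  kappa * (2^-1 - p^-1) * \int[mu]_(x in Omega) (vplus (u x) `^ p) <= M + volume Omega.
Proof.
move=> JM.
pose r : R -> R := \1_(`]1, +oo[%classic).
have mr : measurable_fun setT r by exact: measurable_indic.
have r0 t : t <= 0 -> r t = 0 by move=> t0; rewrite /r ray_le// (le_trans t0).
have HW := H10g_lprim mr (ray01 1) r0.
have WE t : lprim r t = vplus t by rewrite lprim_ray.
pose h t := 2 - force t * vplus t.
have i2 := vplus_sqr_integrable; have ip := vplus_p_integrable.
have ic (c : R) : mu.-integrable Omega (fun x => c%:E).
  apply/integrableP; split; first exact/measurable_EFinP.
  by rewrite integral_cst//= lte_mul_pinfty.
have ifv : mu.-integrable Omega (fun x => (force (u x) * vplus (u x))%:E).
  under eq_fun do rewrite force_vplus.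
  by apply: integrable_add => //; exact: integrable_scale.
have ih : mu.-integrable Omega (fun x => (h (u x))%:E).
  have := integrable_add mO (ic 2) (integrable_scale mO (-1) ifv).
  by congr (integrable _ _ _); apply/funext => x; rewrite /h mulN1r.
have hP s t : 0 < s <= 1 -> pot (t + s * lprim r t) - pot t <= s * h t.
  move=> /andP[s0 s1]; rewrite WE.
  have [t1|t1] := leP t 1.
    rewrite vplus_le1// mulr0 addr0 subrr /h vplus_le1// mulr0 subr0.
    by apply: mulr_ge0 => //; exact: ltW.
  have v0 := vplus_ge0 t; have vt : vplus t = t - 1 by rewrite vplus_ge1// ltW.
  have vs : vplus (t + s * vplus t) = vplus t + s * vplus t.
    have sv : 0 <= s * vplus t by rewrite mulr_ge0// ltW.
    by rewrite {1}vplus_ge1 ?vt; [ring|rewrite -vt; lra].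
  have ft := forcep_tangent (t + s * vplus t) t; rewrite vs in ft.
  (* A finite-difference form of t beta(t) <= 2: either both values of B are 1, or (t-1)/eps < 1 and
     the Lipschitz bound gives 2 s (t-1)/eps <= 2 s. This is where eps disappears. *)
  have Bm : B ((t + s * vplus t - 1) / eps) - B ((t - 1) / eps) <= 2 * s.
    have [te|te] := leP 1 ((t - 1) / eps).
      have te' : 1 <= (t + s * vplus t - 1) / eps.
        apply: le_trans te _; rewrite ler_wpM2r ?invr_ge0 ?(ltW eps0)//.
        by have := mulr_ge0 (ltW s0) v0; lra.
      by rewrite !(B_ge1 beta_adm)// subrr mulr_ge0// ltW.
    have le1 : (t - 1) / eps <= (t + s * vplus t - 1) / eps.
      rewrite ler_wpM2r ?invr_ge0 ?(ltW eps0)//.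
      by have := mulr_ge0 (ltW s0) v0; lra.
    apply: le_trans (B_lip beta_adm le1) _; rewrite ler_wpM2l//.
    rewrite -mulrBl (_ : t + s * vplus t - 1 - (t - 1) = s * (t - 1)); last by rewrite vt; ring.
    by rewrite -mulrA ler_piMr// ltW.
  rewrite !potE /h mulrBr; move: Bm ft.
  rewrite (_ : vplus t + s * vplus t - vplus t = s * vplus t); last by ring.
  rewrite [force t * (s * _)]mulrCA.
  move: (s * (force t * _)) (B _) (B _) (forcep _) (forcep _) => ? ? ? ? ?; lra.
have key := @critical_direction _ _ _ _ oO beta_adm finO lambda kappa eps p2 S0 u
  (lprim r) r h ucrit (bmeas_indic (measurable_itv _)) HW ih hP.
have JE := J_split oO beta_adm finO lambda kappa eps p2 S0 Hu.
have ipot := pot_integrable oO beta_adm finO lambda kappa eps p2 S0 Hu.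
have [_ w2] := H10g_L2 oO Hu; have [_ g2] := H10g_L2 oO HW.
have En : \sum_i \int[mu]_(x in Omega) (r (u x) * wp i x ^+ 2) <= energy Omega wp.
  apply: ler_sum => i _.
  rewrite -[fine (sq _)]/(Rintegral mu Omega (fun x => (wp i x) ^+ 2)).
  apply: le_Rintegral => //.
  - have := L2m_integrableM mO (g2 i) (w2 i); congr (integrable _ _ _).
    by apply/funext => x; congr EFin; ring.
  - exact: L2m_integrable_sqr.
  - move=> x _; rewrite ler_piMl ?sqr_ge0//; by have /andP[] := ray01 1 (u x).
have hE : \int[mu]_(x in Omega) h (u x) = 2 * volume Omega -
    \int[mu]_(x in Omega) (force (u x) * vplus (u x)).
  have e2 : \int[mu]_(x in Omega) (2 : R) = 2 * volume Omega by rewrite Rintegral_cst.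
  rewrite -e2 -RintegralB//; exact: ic.
have potge : \int[mu]_(x in Omega) (-1 * forcep (u x)) <= \int[mu]_(x in Omega) pot (u x).
  apply: le_Rintegral => //.
    apply: integrable_scale => //; apply: integrable_add => //; exact: integrable_scale.
  move=> x _; rewrite potE mulN1r lerDr; exact: (B_ge0 beta_adm).
have fpE : \int[mu]_(x in Omega) (-1 * forcep (u x)) =
    -1 * (lambda / 2 * \int[mu]_(x in Omega) (vplus (u x) ^+ 2)
     + kappa / p * \int[mu]_(x in Omega) (vplus (u x) `^ p)).
  rewrite RintegralZl//; last by apply: integrable_add => //; exact: integrable_scale.
  by congr (_ * _); rewrite -!RintegralZl// -RintegralD//; exact: integrable_scale.
have fvE : \int[mu]_(x in Omega) (force (u x) * vplus (u x)) =
    lambda * \int[mu]_(x in Omega) (vplus (u x) ^+ 2)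
     + kappa * \int[mu]_(x in Omega) (vplus (u x) `^ p).
  rewrite -!RintegralZl// -RintegralD//; try exact: integrable_scale.
  by apply: eq_Rintegral => x _; exact: force_vplus.
rewrite hE fvE in key; rewrite fpE in potge; rewrite JE in JM.
have alg (E s i2' ip' V P k : R) : 0 <= s + (2 * V - (lambda * i2' + k * ip')) ->
   s <= E -> -1 * (lambda / 2 * i2' + k / p * ip') <= P -> 2^-1 * E + P <= M ->
   k * (2^-1 - p^-1) * ip' <= M + V.
  move=> a1 a2 a3 a4.
  have -> : k * (2^-1 - p^-1) * ip' = 2^-1 * (lambda * i2' + k * ip')
     + -1 * (lambda / 2 * i2' + k / p * ip') by field; rewrite gt_eqF.
  move: a1 a3; move: (lambda * i2' + k * ip') (lambda / 2 * i2' + k / p * ip') => x y a1 a3.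
  lra.
exact: alg key En potge JM.
Qed.

End critical_estimates.

(** * Higher integrability and boundedness *)

Section truncated_powers.
Variable R : realType.

Lemma continuous_max0_powR (s : R) : 0 < s -> continuous (fun t : R => Num.max t 0 `^ s).
Proof.
move=> s0 t; have [t0|t0|->] := ltgtP t 0.
- rewrite /continuous_at (max_r (ltW t0)).
  apply: cvg_near_cst; near=> x; rewrite max_r//.
  by apply: ltW; near: x; exact: lt_nbhsl.
- rewrite /continuous_at (max_l (ltW t0)).
  apply: (@cvg_trans _ (@powR R ^~ s @ t)).
    apply: near_eq_cvg; near=> x; rewrite max_l//.
    by apply: ltW; near: x; exact: lt_nbhsr.
  have /derivable1_diffP/differentiable_continuous : derivable (@powR R ^~ s) t 1.
    by apply: derivable_powR; rewrite in_itv/= andbT.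
  exact.
- apply/left_right_continuousP; rewrite maxxx powR0 ?gt_eqF//; split.
    by apply: cvg_near_cst; near=> x; rewrite max_r ?powR0 ?gt_eqF//.
  apply: (@cvg_trans _ (@powR R ^~ s @ 0^'+)); last exact: powR_cvg0.
  apply: near_eq_cvg; near=> x; rewrite max_l//.
Unshelve. all: by end_near. Qed.

(** By the mean value theorem, [lprim f] - F is constant on [a, b]. Differentiability of F is asked
    only in the open interval, so pieces can be glued at the kinks. *)
Lemma lprim_piece (f F : R -> R) (a b : R) : continuous f -> (forall t, t <= 0 -> f t = 0) ->
  a <= b -> continuous F -> (forall x, a < x < b -> is_derive x (1 : R) F (f x)) ->
  lprim f b - lprim f a = F b - F a.
Proof.
move=> cf f0 ab cF dF.
have dl x := is_derive_lprim x cf f0.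
have [|c|c _ ] := @MVT_segment R (lprim f - F) (fun x => f x - f x) a b ab.
- move=> x /[!in_itv]/= /dF dFx; exact: is_deriveB.
- move: c; apply: continuous_subspaceT => x; apply: cvgB; last exact: cF.
  by apply/differentiable_continuous/derivable1_diffP; case: (dl x).
by rewrite subrr mul0r !fctE; lra.
Qed.

Definition tpow (T m t : R) : R := Num.min (vplus t) T `^ m.

Lemma tpow_le1 T m t : 0 < T -> 0 < m -> t <= 1 -> tpow T m t = 0.
Proof. by move=> T0 m0 t1; rewrite /tpow vplus_le1// min_l ?ltW// powR0// gt_eqF. Qed.

Lemma tpow_bound T m t : 0 < T -> 0 < m -> 0 <= tpow T m t <= T `^ m.
Proof.
move=> T0 m0; rewrite powR_ge0 /=; apply: ge0_ler_powR; rewrite ?nnegrE ?(ltW m0) ?(ltW T0)//.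
  by rewrite le_min vplus_ge0 ltW.
by rewrite ge_min lexx orbT.
Qed.

Lemma continuous_tpow T m : 0 < T -> 0 < m -> continuous (tpow T m).
Proof.
move=> T0 m0 t.
have -> : tpow T m = (fun x => Num.max x 0 `^ m) \o (fun t => Num.min (t - 1) T).
  apply/funext => s; rewrite /tpow /vplus /=; congr (_ `^ _).
  by rewrite min_maxl (min_l (ltW T0)).
apply: continuous_comp; last exact: continuous_max0_powR.
apply: continuous_min; last exact: cvg_cst.
by apply: cvgB; [exact: cvg_id|exact: cvg_cst].
Qed.

(** The primitive is 0 up to 1, a power on [1, 1 + T], and linear with slope T^m beyond, glued from
    antiderivatives on the three pieces. *)
Lemma lprim_tpow (T m t : R) : 0 < T -> 0 < m ->
  lprim (tpow T m) t =
  Num.min (vplus t) T `^ (m + 1) / (m + 1) + T `^ m * Num.max (vplus t - T) 0.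
Proof.
move=> T0 m0; have m1 : 0 < m + 1 by rewrite addr_gt0.
have cf := continuous_tpow T0 m0.
have cX : continuous (fun x : R => Num.max (x - 1) 0 `^ (m + 1)).
  move=> x; apply: (@continuous_comp _ _ _ (fun x : R => x - 1) (fun x => Num.max x 0 `^ (m + 1))).
    by apply: cvgB; [exact: cvg_id|exact: cvg_cst].
  exact: continuous_max0_powR.
have f0 s : s <= 0 -> tpow T m s = 0 by move=> s0; rewrite tpow_le1// (le_trans s0).
have l1 s : s <= 1 -> lprim (tpow T m) s = 0.
  move=> s1; rewrite /lprim (@eq_Rintegral _ _ _ _ _ (cst 0)) ?Rintegral_cst ?mul0r//.
  by move=> r; rewrite inE/= in_itv/= => /andP[_ rs]; rewrite tpow_le1// (le_trans rs).
have l2 s : 1 <= s <= 1 + T -> lprim (tpow T m) s = (s - 1) `^ (m + 1) / (m + 1).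
  move=> /andP[s1 sT].
  have := @lprim_piece _ (fun x => (m + 1)^-1 * Num.max (x - 1) 0 `^ (m + 1)) 1 s cf f0 s1.
  rewrite (l1 1)// subr0 subrr maxxx powR0 ?gt_eqF// mulr0 subr0 mulrC max_l ?subr_ge0//.
  rewrite [RHS]mulrC; apply.
    by move=> x; apply: cvgM; [exact: cvg_cst|exact: cX].
  move=> x /andP[x1 xs].
  have x10 : 0 < x - 1 by rewrite subr_gt0.
  have tE : tpow T m x = (m + 1)^-1 *: ((m + 1) * (x - 1) `^ (m + 1 - 1) * 1).
    rewrite mulr1 addrK scalerA mulVf ?gt_eqF// scale1r /tpow vplus_ge1 ?(ltW x1)//.
    by rewrite min_l//; lra.
  rewrite tE.
  have dB : is_derive x (1 : R) (fun x : R => x - 1) 1.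
    by rewrite -[X in is_derive _ _ _ X]subr0; apply: is_deriveB.
  have dP := is_derive1_powR (m + 1) x10.
  have dC := @is_derive1_comp R (@powR R ^~ (m + 1)) (fun x => x - 1) x _ _ dP dB.
  have dZ := is_deriveZ (m + 1)^-1 dC.
  apply: near_eq_is_derive dZ.
  near=> y; rewrite max_l//= subr_ge0; apply: ltW; near: y; exact: lt_nbhsr.
have [t1|t1] := leP t 1.
  rewrite l1// vplus_le1// min_l ?(ltW T0)// powR0 ?gt_eqF// mul0r add0r max_r ?mulr0//.
  by rewrite subr_le0 ltW.
rewrite vplus_ge1 ?(ltW t1)//.
have [tT|tT] := leP (t - 1) T.
  rewrite l2 ?max_r ?mulr0 ?addr0 ?subr_le0//; apply/andP; split; [exact: ltW|lra].
have tT' : 1 + T <= t by lra.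
have := @lprim_piece _ (fun x => T `^ m * x) (1 + T) t cf f0 tT'.
rewrite (l2 (1 + T)) ?(addrC 1 T) ?addrK; last by apply/andP; split; lra.
rewrite -mulrBr max_l; last by lra.
move=> H; rewrite (_ : t - 1 - T = t - (T + 1)); last by lra.
rewrite addrC; apply/eqP; rewrite -subr_eq; apply/eqP; apply: H.
  by move=> x; apply: cvgM; [exact: cvg_cst|exact: cvg_id].
move=> x /andP[Tx xt].
have -> : tpow T m x = T `^ m *: 1.
  rewrite scaler1 /tpow vplus_ge1 ?min_r//; lra.
exact: is_deriveZ.
Unshelve. all: by end_near. Qed.

End truncated_powers.

(** * The truncated power test function *)

Section power_test.
Variable R : realType.
Variables (s T : R).
Hypotheses (s1 : 1 < s) (T0 : 0 < T).

Let m0 : 0 < s - 1. Proof. by rewrite subr_gt0. Qed.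
Let s0 : 0 < s. Proof. exact: lt_trans s1. Qed.

Definition ptest (t : R) : R := s * tpow T (s - 1) t.

Lemma bmeas_tpow m : 0 < m -> bmeas (tpow T m).
Proof.
move=> m0'; split; first by apply: measurable_continuousR; exact: continuous_tpow.
by exists (T `^ m) => t; have /andP[h0 h1] := tpow_bound t T0 m0'; rewrite ger0_norm.
Qed.

Lemma lprim_scale (c : R) g : bmeas g -> lprim (fun t => c * g t) = fun t => c * lprim g t.
Proof.
move=> bg; have b0 : bmeas (cst 0 : R -> R).
  by split; [exact: measurable_cst|exists 0 => t; rewrite normr0].
have := lprim_lin c b0 bg; rewrite lprim0.
rewrite (_ : (fun t => cst 0 t + c * g t) = (fun t => c * g t)) => [->|].
  by apply/funext => t; rewrite add0r.
by apply/funext => t; rewrite add0r.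
Qed.

Lemma ptest_bound t : 0 <= ptest t <= s * T `^ (s - 1).
Proof.
have /andP[h0 h1] := tpow_bound t T0 m0.
by rewrite mulr_ge0 ?(ltW s0)//= ler_wpM2l// ltW.
Qed.

Lemma ptest_le1 t : t <= 1 -> ptest t = 0.
Proof. by move=> t1; rewrite /ptest tpow_le1// mulr0. Qed.

Lemma measurable_ptest : measurable_fun setT ptest.
Proof. by apply: measurable_funM => //; have [] := bmeas_tpow m0. Qed.

(** Beyond T the power v^s is continued by its tangent line at T; convexity therefore keeps the
    primitive below v^s. *)
Lemma lprim_ptest t : lprim ptest t =
  Num.min (vplus t) T `^ s + s * T `^ (s - 1) * Num.max (vplus t - T) 0.
Proof.
rewrite lprim_scale; last exact: bmeas_tpow.
by rewrite lprim_tpow// subrK mulrDr [s * (_ / s)]mulrC divfK ?gt_eqF// mulrA.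
Qed.

Lemma lprim_ptest_sqr t : lprim (fun t => ptest t ^+ 2) t =
  s ^+ 2 * (Num.min (vplus t) T `^ (2 * s - 1) / (2 * s - 1) +
            (T `^ (s - 1)) ^+ 2 * Num.max (vplus t - T) 0).
Proof.
have m20 : 0 < (s - 1) * 2%:R by rewrite mulr_gt0.
have E : (fun t => ptest t ^+ 2) = fun t => s ^+ 2 * tpow T ((s - 1) * 2%:R) t.
  by apply/funext => x; rewrite /ptest exprMn /tpow powRrM powR_mulrn// powR_ge0.
rewrite E lprim_scale; last exact: bmeas_tpow.
rewrite lprim_tpow// powRrM powR_mulrn ?powR_ge0//.
by rewrite (_ : (s - 1) * 2%:R + 1 = 2 * s - 1) //; ring.
Qed.

Lemma lprim_ptest_ge t : Num.min (vplus t) T `^ s <= lprim ptest t.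
Proof.
rewrite lprim_ptest lerDl !mulr_ge0 ?powR_ge0 ?(ltW s0)//.
by rewrite le_max lexx orbT.
Qed.

Lemma lprim_ptest_le t : lprim ptest t <= vplus t `^ s.
Proof.
rewrite lprim_ptest; case: (leP (vplus t) T) => h.
  by rewrite max_r ?mulr0 ?addr0// subr_le0.
rewrite max_l ?subr_ge0 ?(ltW h)//; apply: powR_tangent => //; [exact: ltW|exact: vplus_ge0].
Qed.

(** Equality for v <= T, where both sides are multiples of v^(2s). For v > T the difference is the
    square (s (s-1) T^(s-1) (v-T))^2 divided by 2s - 1. The constant is the reciprocal of
    (2s-1)/s^2, which thus survives truncation. *)
Lemma ptest_key t : vplus t * lprim (fun t => ptest t ^+ 2) t <=
  s ^+ 2 / (2 * s - 1) * lprim ptest t ^+ 2.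
Proof.
have v0 := vplus_ge0 t; have s21 : 0 < 2 * s - 1 by move: s1; lra.
rewrite lprim_ptest_sqr lprim_ptest; move: (vplus t) v0 => v v0.
have [vT|vT] := leP v T.
  rewrite max_r ?subr_le0// !mulr0 !addr0.
  rewrite -[(v `^ s) ^+ 2]powR_mulrn ?powR_ge0// -powRrM [s * 2%:R]mulrC.
  rewrite (@powR_split _ v (2%:R * s)) ?mulr_gt0// le_eqVlt; apply/orP; left; apply/eqP; ring.
rewrite max_l ?subr_ge0 ?(ltW vT)//.
have Ts : T `^ s = T `^ (s - 1) * T by rewrite -powR_split// ltW.
have T2s : T `^ (2 * s - 1) = (T `^ (s - 1)) ^+ 2 * T.
  rewrite (@powR_split _ T (2 * s - 1)) ?(ltW T0)//.
  rewrite -powR_mulrn ?powR_ge0// -powRrM; congr (_ `^ _ * _); ring.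
rewrite Ts T2s; move: (T `^ (s - 1)) => a; rewrite -subr_ge0.
have -> : s ^+ 2 / (2 * s - 1) * (a * T + s * a * (v - T)) ^+ 2 -
  v * (s ^+ 2 * (a ^+ 2 * T / (2 * s - 1) + a ^+ 2 * (v - T))) =
  (s * (s - 1) * a * (v - T)) ^+ 2 / (2 * s - 1).
  by field; rewrite gt_eqF.
by rewrite divr_ge0 ?sqr_ge0// ltW.
Qed.

End power_test.

Section hoelder_bound.
Context d (X : measurableType d) (R : realType) (nu : {measure set X -> \bar R}).

Lemma young_bound (th A B a b : R) : 0 < th < 1 -> 0 < A -> 0 < B -> 0 <= a -> 0 <= b ->
  a `^ th * b `^ (1 - th) <= A `^ th * B `^ (1 - th) * (th / A * a + (1 - th) / B * b).
Proof.
move=> /andP[th0 th1] A0 B0 a0 b0; have th1' : 0 < 1 - th by rewrite subr_gt0.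
have := @conjugate_powR _ ((a / A) `^ th) ((b / B) `^ (1 - th)) th^-1 (1 - th)^-1
  (powR_ge0 _ _) (powR_ge0 _ _).
rewrite !invr_gt0 !invrK -!powRrM !mulfV ?gt_eqF// => /(_ th0 th1').
rewrite addrC subrK => /(_ erefl).
rewrite !powRr1 ?divr_ge0 ?(ltW A0) ?(ltW B0)// => h.
have e1 : a `^ th = A `^ th * (a / A) `^ th.
  by rewrite -powRM ?divr_ge0 ?(ltW A0)// mulrC divfK// gt_eqF.
have e2 : b `^ (1 - th) = B `^ (1 - th) * (b / B) `^ (1 - th).
  by rewrite -powRM ?divr_ge0 ?(ltW B0)// mulrC divfK// gt_eqF.
rewrite e1 e2 mulrACA ler_wpM2l ?mulr_ge0 ?powR_ge0//; apply: le_trans h _.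
by rewrite le_eqVlt; apply/orP; left; apply/eqP; field; rewrite !gt_eqF.
Qed.

(** Integrating Young's inequality normalised at (A, B) gives Hoelder's inequality directly with
    positive upper bounds of the two integrals, so neither integral is ever divided by. *)
Lemma hoelder_bound (D : set X) (f g h : X -> R) (th A B c : R) : measurable D ->
  0 < th < 1 -> 0 < A -> 0 < B -> 0 <= c ->
  nu.-integrable D (EFin \o f) -> nu.-integrable D (EFin \o g) ->
  nu.-integrable D (EFin \o h) ->
  (forall x, 0 <= f x) -> (forall x, 0 <= g x) ->
  (forall x, D x -> h x <= c * (f x `^ th * g x `^ (1 - th))) ->
  \int[nu]_(x in D) f x <= A -> \int[nu]_(x in D) g x <= B ->
  \int[nu]_(x in D) h x <= c * (A `^ th * B `^ (1 - th)).
Proof.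
move=> mD /andP[th0 th1] A0 B0 c0 fi gi hi f0 g0 hle fA gB.
pose k := c * (A `^ th * B `^ (1 - th)).
have k0 : 0 <= k by rewrite !mulr_ge0 ?powR_ge0.
have i1 := integrable_scale mD (k * (th / A)) fi.
have i2 := integrable_scale mD (k * ((1 - th) / B)) gi.
apply: (@le_trans _ _ (\int[nu]_(x in D) (k * (th / A) * f x + k * ((1 - th) / B) * g x))).
  apply: le_Rintegral => //; first exact: integrable_add.
  move=> x Dx; apply: le_trans (hle x Dx) _.
  apply: (@le_trans _ _ (c * (A `^ th * B `^ (1 - th) * (th / A * f x + (1 - th) / B * g x)))).
    by rewrite ler_wpM2l// young_bound// th0.
  by rewrite mulrA -/k mulrDr !mulrA.
rewrite RintegralD// !RintegralZl//.
have h1 : k * (th / A) * \int[nu]_(x in D) f x <= k * th.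
  rewrite -mulrA ler_wpM2l// -mulrA ler_piMr ?(ltW th0)// mulrC ler_pdivrMr// mul1r.
  exact: fA.
have h2 : k * ((1 - th) / B) * \int[nu]_(x in D) g x <= k * (1 - th).
  rewrite -mulrA ler_wpM2l// -mulrA ler_piMr ?subr_ge0 ?(ltW th1)// mulrC ler_pdivrMr// mul1r.
  exact: gB.
by apply: le_trans (lerD h1 h2) _; rewrite -mulrDr addrC subrK mulr1.
Qed.

End hoelder_bound.

Section critical_sobolev.
Variables (R : realType) (n : nat) (Omega : set 'rV[R]_n) (beta : R -> R).
Hypotheses (oO : open Omega) (beta_adm : admissible_beta beta).
Local Notation mu := (lebesgue_rV R n).
Hypothesis finO : (mu Omega < +oo)%E.
Local Notation p := (sobolev_exponent R n).
Local Notation S := (sobolev_constant Omega).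
Variables (lambda kappa eps : R).
Hypotheses (p2 : 2 < p) (S0 : 0 < S).
Hypotheses (lambda0 : 0 < lambda) (kappa0 : 0 < kappa) (eps0 : 0 < eps).
Local Notation J := (J Omega beta lambda kappa eps).
Variable u : 'rV[R]_n -> R.
Hypothesis ucrit : critical_point Omega J u.
Local Notation force := (force n lambda kappa).

(* Sobolev's inequality for the primitive of [g], whose energy is bounded by testing
   with the primitive of [g ^+ 2]. *)
Lemma critical_sobolev (g : R -> R) (C : R) : measurable_fun setT g ->
  (forall t, 0 <= g t <= C) -> (forall t, t <= 1 -> g t = 0) ->
  [/\ mu.-integrable Omega (fun x => (lprim g (u x) `^ p)%:E),
   mu.-integrable Omega (fun x => (force (u x) * lprim (fun t => g t ^+ 2) (u x))%:E) &
   S * (\int[mu]_(x in Omega) lprim g (u x) `^ p) `^ (2 / p) <=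
   \int[mu]_(x in Omega) (force (u x) * lprim (fun t => g t ^+ 2) (u x))].
Proof.
move=> mg gC g1; have g0 t : t <= 0 -> g t = 0 by move=> t0; rewrite g1// (le_trans t0).
have G0 t : 0 <= lprim g t by apply: Rintegral_ge0 => s _; have /andP[] := gC s.
have HW := H10g_lprim oO beta_adm finO ucrit mg gC g0.
have [iW sob] := sobolev_ineq oO beta_adm finO p2 S0 HW.
have gE : (fun x => `|(lprim g \o u) x| `^ p) = fun x => lprim g (u x) `^ p.
  by apply/funext => x /=; rewrite ger0_norm.
have gE' : (fun x => (`|(lprim g \o u) x| `^ p)%:E) = fun x => (lprim g (u x) `^ p)%:E.
  by apply/funext => x /=; rewrite ger0_norm.
rewrite gE in sob; rewrite gE' in iW.
have mg2 : measurable_fun setT (fun t => g t ^+ 2) by apply: measurable_funX.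
have g2C t : 0 <= g t ^+ 2 <= C ^+ 2.
  by have /andP[h0 h1] := gC t; rewrite sqr_ge0 /= lerXn2r// nnegrE (le_trans h0).
have g21 t : t <= 1 -> g t ^+ 2 = 0 by move=> t1; rewrite g1// expr0n.
have [iF up] := critical_upper oO beta_adm finO p2 S0 lambda0 kappa0 eps0 ucrit mg2 g2C g21.
split => //; apply: le_trans sob _; apply: le_trans up.
rewrite le_eqVlt; apply/orP; left; apply/eqP; apply: eq_bigr => i _.
by rewrite /Rintegral; congr fine; apply: eq_integral => x _; rewrite exprMn.
Qed.

End critical_sobolev.

(* (2s - 1) / s^2 at s = y / 2; it equals 1 - 4 / N^2 when y = 2N / (N - 2). *)
Lemma half_power_factor (R : realType) (y : R) : 2 < y ->
  ((y / 2) ^+ 2 / (2 * (y / 2) - 1))^-1 = 4 * (y - 1) / y ^+ 2.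
Proof.
move=> y2; rewrite (_ : 2 * (y / 2) - 1 = y - 1); last by field.
have y0 : 0 < y by lra.
have y1 : 0 < y - 1 by lra.
by field; rewrite !gt_eqF.
Qed.

(** * Higher integrability from the subcriticality gap *)

Section energy_bootstrap.
Variables (R : realType) (n : nat) (Omega : set 'rV[R]_n) (beta : R -> R).
Hypotheses (oO : open Omega) (beta_adm : admissible_beta beta).
Local Notation mu := (lebesgue_rV R n).
Hypothesis finO : (mu Omega < +oo)%E.
Local Notation p := (sobolev_exponent R n).
Local Notation S := (sobolev_constant Omega).
Variables (lambda kappa eps : R).
Hypotheses (p2 : 2 < p) (S0 : 0 < S).
Hypotheses (lambda0 : 0 < lambda) (kappa0 : 0 < kappa) (eps0 : 0 < eps).
Local Notation J := (J Omega beta lambda kappa eps).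
Variable u : 'rV[R]_n -> R.
Hypothesis ucrit : critical_point Omega J u.
Local Notation force := (force n lambda kappa).
Variable A : R.
Hypotheses (A0 : 0 < A) (vA : \int[mu]_(x in Omega) (vplus (u x) `^ p) <= A).
Local Notation delta := (S * (4 * (p - 1) / p ^+ 2) - kappa * A `^ (1 - 2 / p)).

Let mO : measurable Omega. Proof. exact: open_measurable_rV. Qed.
Let p0 : 0 < p. Proof. exact: lt_trans p2. Qed.
Let p1 : 1 < p. Proof. by apply: lt_trans p2; rewrite ltr1n. Qed.
Let ivp := vplus_p_integrable oO beta_adm finO p2 S0 ucrit.

(** Write w for the primitive of [ptest], W for int w^p and c = s^2/(2s-1). Testing gives S W^(2/p)
    <= c (kappa int v^(p-2) w^2 + lambda int w^2). Since w^2 <= v^p, the last integral is at most A;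
    Hoelder bounds the first by A^(1-2/p) W^(2/p), which is absorbed on the left because 1/c =
    4(p-1)/p^2 and [delta] is positive. The resulting bound is free of T. *)
Lemma truncated_bound (T : R) : 0 < T -> 0 < delta ->
  mu.-integrable Omega (fun x => (Num.min (vplus (u x)) T `^ (p / 2 * p))%:E) /\
  \int[mu]_(x in Omega) (Num.min (vplus (u x)) T `^ (p / 2 * p)) <=
    (lambda * A / delta) `^ (p / 2).
Proof.
move=> T0 d0; pose s := p / 2.
have s1 : 1 < s by rewrite /s ltr_pdivlMr// mul1r.
have [iW iF sob] := critical_sobolev oO beta_adm finO p2 S0 lambda0 kappa0 eps0 ucrit
  (measurable_ptest s1 T0) (ptest_bound s1 T0) (ptest_le1 s1 T0).
pose w x := lprim (ptest s T) (u x); pose W := \int[mu]_(x in Omega) w x `^ p.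
pose phi t := lprim (fun t => ptest s T t ^+ 2) t.
have w0 x : 0 <= w x.
  by apply: le_trans (powR_ge0 _ _) (lprim_ptest_ge s1 T0 (u x)).
have minw x : Num.min (vplus (u x)) T `^ (p / 2 * p) <= w x `^ p.
  rewrite powRrM; apply: ge0_ler_powR; rewrite ?nnegrE ?powR_ge0 ?(ltW p0)//.
  exact: lprim_ptest_ge.
have mu_ : measurable_fun Omega u.
  by have [] := ucrit => /(H10_H10g oO beta_adm finO) /(H10g_L2 oO)[[]].
have mmin : measurable_fun Omega (fun x => Num.min (vplus (u x)) T `^ (p / 2 * p)).
  have mt : measurable_fun setT (fun t => Num.min (vplus t) T `^ (p / 2 * p)).
    apply: (measurableT_comp (measurable_powR _)).
    by apply: measurable_minr => //; exact: measurable_vplus.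
  exact: (measurableT_comp mt mu_).
have imin : mu.-integrable Omega (fun x => (Num.min (vplus (u x)) T `^ (p / 2 * p))%:E).
  apply: le_integrable iW => //; first exact/measurable_EFinP.
  by move=> x _; rewrite /= lee_fin !ger0_norm ?powR_ge0//; exact: minw.
split => //; apply: (@le_trans _ _ W); first by apply: le_Rintegral => // x _; exact: minw.
have W0 : 0 <= W by apply: Rintegral_ge0 => x _; exact: powR_ge0.
(* The case W = 0 is separated because Hoelder's inequality is normalised by W. *)
move: W0; rewrite le_eqVlt => /predU1P[<-|W0]; first exact: powR_ge0.
pose c := s ^+ 2 / (2 * s - 1).
have c0 : 0 < c by rewrite divr_gt0 ?exprn_gt0//; lra.
(* The lambda part, bounded by c lambda v^p, is moved to the left so that the right side is a single
   product of powers. *)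
have key x : force (u x) * phi (u x) + (- (c * lambda)) * vplus (u x) `^ p <=
    c * kappa * ((vplus (u x) `^ p) `^ (1 - 2 / p) * (w x `^ p) `^ (1 - (1 - 2 / p))).
  have v0 := vplus_ge0 (u x).
  have e1 : (vplus (u x) `^ p) `^ (1 - 2 / p) = vplus (u x) `^ (p - 1 - 1).
    by rewrite -powRrM; congr (_ `^ _); field; rewrite gt_eqF.
  have e2 : (w x `^ p) `^ (1 - (1 - 2 / p)) = w x ^+ 2.
    by rewrite -powRrM -powR_mulrn//; congr (_ `^ _); field; rewrite gt_eqF.
  have w2 : w x ^+ 2 <= vplus (u x) `^ p.
    have -> : vplus (u x) `^ p = (vplus (u x) `^ s) ^+ 2.
      by rewrite -powR_mulrn ?powR_ge0// -powRrM divfK.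
    by rewrite lerXn2r ?nnegrE ?powR_ge0// lprim_ptest_le.
  have vphi : vplus (u x) * phi (u x) <= c * w x ^+ 2 by exact: ptest_key.
  rewrite e1 e2 /force (@powR_split _ (vplus (u x)) (p - 1)) ?subr_gt0//.
  have a0 : 0 <= vplus (u x) `^ (p - 1 - 1) by exact: powR_ge0.
  move: (vplus (u x) `^ (p - 1 - 1)) (vplus (u x) `^ p) a0 w2 => a b a0 w2.
  have h1 : (lambda + kappa * a) * (vplus (u x) * phi (u x)) <=
      (lambda + kappa * a) * (c * w x ^+ 2).
    by rewrite ler_wpM2l// addr_ge0 ?mulr_ge0// ltW.
  have h2 : c * lambda * w x ^+ 2 <= c * lambda * b by rewrite ler_wpM2l// mulr_ge0// ltW.
  have alg (l k v f y c' : R) : (l + k * a) * (v * f) <= (l + k * a) * (c' * y) ->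
      c' * l * y <= c' * l * b -> (l * v + k * (a * v)) * f + - (c' * l) * b <= c' * k * (a * y).
    move=> {}h1 {}h2; rewrite -subr_ge0.
    have -> : c' * k * (a * y) - ((l * v + k * (a * v)) * f + - (c' * l) * b) =
      ((l + k * a) * (c' * y) - (l + k * a) * (v * f)) + (c' * l * b - c' * l * y) by ring.
    by rewrite addr_ge0 ?subr_ge0.
  exact: alg h1 h2.
have i1 := integrable_scale mO (- (c * lambda)) ivp.
have th : 0 < 1 - 2 / p < 1.
  by rewrite subr_gt0 ltr_pdivrMr// mul1r p2 /= ltrBlDr ltrDl divr_gt0.
have ck : 0 <= c * kappa by rewrite mulr_ge0 ?ltW.
have hb := hoelder_bound mO th A0 W0 ck ivp iW (integrable_add mO iF i1)
  (fun x => powR_ge0 _ _) (fun x => powR_ge0 _ _) (fun x _ => key x) vA (lexx W).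
move: hb; rewrite RintegralD// RintegralZl// => hb.
have e3 : 1 - (1 - 2 / p) = 2 / p by ring.
rewrite e3 in hb.
pose F := \int[mu]_(x in Omega) (force (u x) * phi (u x)).
have h : S * W `^ (2 / p) <= F by exact: sob.
have hA : c * lambda * \int[mu]_(x in Omega) vplus (u x) `^ p <= c * lambda * A.
  by rewrite ler_wpM2l// mulr_ge0 ?ltW.
have h3 : S * W `^ (2 / p) <= c * (kappa * A `^ (1 - 2 / p) * W `^ (2 / p) + lambda * A).
  apply: le_trans h _; move: hb hA; rewrite -/F.
  clear.
  have alg (f I c' l k a b : R) : f + - (c' * l) * I <= c' * k * (a * b) ->
      c' * l * I <= c' * l * A -> f <= c' * (k * a * b + l * A).
    by move=> h1 h2; rewrite -subr_ge0 (_ : c' * (k * a * b + l * A) - f =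
      (c' * k * (a * b) - (f + - (c' * l) * I)) + (c' * l * A - c' * l * I));
      [rewrite addr_ge0 ?subr_ge0|ring].
  exact: alg.
have cE : c^-1 = 4 * (p - 1) / p ^+ 2.
  exact: half_power_factor.
have h4 : delta * W `^ (2 / p) <= lambda * A.
  rewrite mulrBl -cE lerBlDr -(ler_pM2l c0) addrC.
  by apply: le_trans h3; rewrite mulrA mulrCA divff ?gt_eqF// mulr1.
have h5 : W `^ (2 / p) <= lambda * A / delta by rewrite ler_pdivlMr// mulrC.
have -> : W = (W `^ (2 / p)) `^ (p / 2).
  have pp : 2 / p * (p / 2) = 1 by rewrite mulrA divfK ?gt_eqF// mulfV.
  by rewrite -powRrM pp powRr1 ?ltW.
have h2 : 0 <= p / 2 by apply: divr_ge0 => //; exact: ltW.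
have q0 : 0 <= lambda * A / delta by apply: divr_ge0; [apply: mulr_ge0|]; exact: ltW.
by apply: ge0_ler_powR => //; rewrite nnegrE powR_ge0.
Qed.

(** The bound for truncations does not depend on T, so monotone convergence along T = k + 1,
    positive for every k, removes the truncation. *)
Lemma vplus_high_bound : 0 < delta ->
  mu.-integrable Omega (fun x => (vplus (u x) `^ (p / 2 * p))%:E) /\
  \int[mu]_(x in Omega) (vplus (u x) `^ (p / 2 * p)) <= (lambda * A / delta) `^ (p / 2).
Proof.
move=> d0; pose D := (lambda * A / delta) `^ (p / 2).
pose f (k : nat) x := (Num.min (vplus (u x)) k.+1%:R `^ (p / 2 * p))%:E.
have m0 : 0 < p / 2 * p by apply: mulr_gt0 => //; exact: divr_gt0.
have hk k := truncated_bound (ltr0Sn R k) d0.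
have mf k : measurable_fun Omega (f k) by have [/integrableP[]] := hk k.
have min0 (k : nat) t : 0 <= Num.min (vplus t) k.+1%:R :> R by rewrite le_min vplus_ge0 ler0n.
have f0 k x : Omega x -> (0 <= f k x)%E by move=> _; rewrite lee_fin powR_ge0.
have ndf x : Omega x -> {homo f^~ x : k l / (k <= l)%N >-> (k <= l)%E}.
  move=> _ k l kl; rewrite lee_fin; apply: ge0_ler_powR; rewrite ?nnegrE ?(ltW m0)//.
  by rewrite le_min ge_min lexx /= ge_min ler_nat ltnS kl orbT.
have cf x : f k x @[k --> \oo] --> (vplus (u x) `^ (p / 2 * p))%:E.
  apply: cvg_near_cst; near=> k; rewrite /f min_l//.
  apply: (@le_trans _ _ k%:R); last by rewrite ler_nat.
  by apply: ltW; near: k; exact: nbhs_infty_gtr.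
have mcv := cvg_monotone_convergence mO mf f0 ndf.
have lf x : limn (f ^~ x) = (vplus (u x) `^ (p / 2 * p))%:E by apply/cvg_lim.
have fD k : (\int[mu]_(x in Omega) f k x <= D%:E)%E.
  have [ik kD] := hk k; rewrite -(fineK (integrable_fin_num mO ik)) lee_fin; exact: kD.
have iD : (\int[mu]_(x in Omega) (vplus (u x) `^ (p / 2 * p))%:E <= D%:E)%E.
  rewrite -(eq_integral _ _ (fun x _ => lf x)).
  by apply: cvge_to_le (mcv mu) _; exact: nearW.
have mh : measurable_fun Omega (fun x => (vplus (u x) `^ (p / 2 * p))%:E).
  rewrite -(funext lf); apply: emeasurable_fun_cvg mf _ => x _.
  by rewrite lf.
have ih : mu.-integrable Omega (fun x => (vplus (u x) `^ (p / 2 * p))%:E).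
  apply/integrableP; split=> //.
  under eq_integral do rewrite gee0_abs ?lee_fin ?powR_ge0//.
  by apply: le_lt_trans iD _; exact: ltry.
split => //; rewrite -lee_fin; apply: le_trans iD.
by rewrite /Rintegral fineK// integrable_fin_num.
Unshelve. all: by end_near. Qed.

End energy_bootstrap.

(** * De Giorgi iteration *)

Section fast_decay.
Variable R : realType.

Lemma powR_exprn (x c : R) j : 0 <= x -> (x ^+ j) `^ c = (x `^ c) ^+ j.
Proof. by move=> x0; rewrite -(powR_mulrn j x0) powRAC powR_mulrn ?powR_ge0. Qed.

(** The coefficient grows like b^(j+1) with b = 2 * 2^eta, while the superlinear exponent
    contributes r^(j eta/2). The ratio r is chosen with r^(eta/2) = 1/b, so the two cancel, and what
    remains is a factor K^(-eta) made small by K. Both K and r depend only on E, Y and eta. *)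
Lemma fast_decay (E Y eta : R) : 0 < E -> 0 < Y -> 0 < eta ->
  exists2 K, 2 <= K & exists2 r, 0 < r < 1 & forall j,
    E * 2 ^+ j.+1 * (K / 2 ^+ j.+1) `^ (- eta) * (Y * r ^+ j) `^ (1 + eta / 2) <= Y * r ^+ j.+1.
Proof.
move=> E0 Y0 eta0.
pose b : R := 2 * 2 `^ eta; pose r := b `^ (- (2 / eta)).
have b1 : 1 < b.
  apply: (@lt_le_trans _ _ 2); first by rewrite ltr1n.
  by rewrite /b ler_peMr//; have := ler_powR (ler1n R 2) (ltW eta0); rewrite powRr0.
have b0 : 0 < b by exact: lt_trans b1.
have r0 : 0 < r by exact: powR_gt0.
have e2 : 0 < eta / 2 by exact: divr_gt0.
have rb : r `^ (eta / 2) = b^-1.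
  by rewrite /r -powRrM -(powR_inv1 (ltW b0)); congr (_ `^ _); field; rewrite gt_eqF.
have r1 : r < 1.
  have h : r `^ (eta / 2) < 1 by rewrite rb invf_lt1.
  rewrite ltNge; apply/negP => r1; move: h; apply/negP; rewrite -leNgt.
  by have := ler_powR r1 (ltW e2); rewrite powRr0.
(* After cancellation the left side is Y r^j (Q r / K^eta), so K^eta >= Q is the required condition;
   the maximum with 2 gives the stated lower bound on K. *)
pose Q := E * b * Y `^ (eta / 2) / r.
have Q0 : 0 < Q by apply: divr_gt0 => //; apply: mulr_gt0; [exact: mulr_gt0|exact: powR_gt0].
exists (Num.max 2 (Q `^ eta^-1)); first by rewrite le_max lexx.
exists r; first by rewrite r0.
move=> j; set K := Num.max _ _.
have K0 : 0 < K by rewrite lt_max ltr0n.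
have KQ : Q <= K `^ eta.
  have -> : Q = (Q `^ eta^-1) `^ eta by rewrite -powRrM mulVf ?gt_eqF// powRr1// ltW.
  apply: ge0_ler_powR; rewrite ?nnegrE ?powR_ge0 ?(ltW eta0) ?(ltW K0)//.
  by rewrite le_max lexx orbT.
have K1 : 0 < K `^ eta by exact: powR_gt0.
have tw : 0 < (2 : R) ^+ j.+1 by rewrite exprn_gt0.
have rj : 0 < r ^+ j by rewrite exprn_gt0.
have -> : (K / 2 ^+ j.+1) `^ (- eta) = (2 `^ eta) ^+ j.+1 / K `^ eta.
  rewrite powRN powRM ?invr_ge0 ?(ltW K0) ?(ltW tw)// invfM mulrC; congr (_ / _).
  by rewrite -powR_inv1 ?(ltW tw)// powRAC powR_inv1 ?powR_ge0// invrK powR_exprn.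
have -> : (Y * r ^+ j) `^ (1 + eta / 2) = Y * r ^+ j * (Y `^ (eta / 2) / b ^+ j).
  rewrite powRD; last by rewrite (gt_eqF (mulr_gt0 Y0 rj)) implybT.
  rewrite powRr1 ?mulr_ge0 ?(ltW Y0) ?(ltW rj)//; congr (_ * _).
  by rewrite powRM ?(ltW Y0) ?(ltW rj)// powR_exprn ?(ltW r0)// rb exprVn.
have -> : E * 2 ^+ j.+1 * ((2 `^ eta) ^+ j.+1 / K `^ eta) *
    (Y * r ^+ j * (Y `^ (eta / 2) / b ^+ j)) =
    Y * r ^+ j * (Q * r / K `^ eta).
  have bj : 2 ^+ j.+1 * (2 `^ eta) ^+ j.+1 = b * b ^+ j by rewrite -exprMn exprS.
  have -> : E * 2 ^+ j.+1 * ((2 `^ eta) ^+ j.+1 / K `^ eta) =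
    E * (2 ^+ j.+1 * (2 `^ eta) ^+ j.+1) / K `^ eta by rewrite !mulrA.
  rewrite bj /Q; have : b ^+ j != 0 by rewrite expf_neq0// gt_eqF.
  move: (b ^+ j) (Y `^ _) (K `^ _) K1 (r ^+ j) => y z k k0 s y0.
  by field; rewrite y0 !gt_eqF.
rewrite [r ^+ j.+1]exprSr [Y * (_ * r)]mulrA; apply: ler_wpM2l; first by rewrite mulr_ge0 ?ltW.
by rewrite mulrAC ler_piMl ?(ltW r0)// ler_pdivrMr// mul1r.
Qed.

End fast_decay.

Section boundedness.
Variables (R : realType) (n : nat) (Omega : set 'rV[R]_n) (beta : R -> R).
Hypotheses (oO : open Omega) (beta_adm : admissible_beta beta).
Local Notation mu := (lebesgue_rV R n).
Hypothesis finO : (mu Omega < +oo)%E.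
Local Notation p := (sobolev_exponent R n).
Local Notation S := (sobolev_constant Omega).
Variables (lambda kappa eps : R).
Hypotheses (p2 : 2 < p) (S0 : 0 < S).
Hypotheses (lambda0 : 0 < lambda) (kappa0 : 0 < kappa) (eps0 : 0 < eps).
Local Notation J := (J Omega beta lambda kappa eps).
Variable u : 'rV[R]_n -> R.
Hypothesis ucrit : critical_point Omega J u.
Local Notation force := (force n lambda kappa).
Variables D : R.
Hypotheses (D0 : 0 < D)
  (iv : mu.-integrable Omega (fun x => (vplus (u x) `^ (p / 2 * p))%:E))
  (vD : \int[mu]_(x in Omega) (vplus (u x) `^ (p / 2 * p)) <= D).
Local Notation theta := ((p - 2) / (p / 2 * p)).
Local Notation eta := (p * (1 - theta) - 2).

Let mO : measurable Omega. Proof. exact: open_measurable_rV. Qed.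
Let p0 : 0 < p. Proof. exact: lt_trans p2. Qed.
Let p1 : 1 < p. Proof. by apply: lt_trans p2; rewrite ltr1n. Qed.
Let m0 : 0 < p / 2 * p. Proof. by apply: mulr_gt0 => //; exact: divr_gt0. Qed.

Definition level_mass (k : R) := \int[mu]_(x in Omega) Num.max (u x - k) 0 `^ p.

(** In fact eta = (p-2)^2/p. With s = p/2 its positivity amounts to ps/(p-2) > p/(p-2) = N/2, the
    integrability threshold that makes the iteration superlinear. *)
Lemma eta_gt0 : 0 < eta.
Proof.
have E (y : R) : 2 < y -> y * (1 - (y - 2) / (y / 2 * y)) - 2 = (y - 2) ^+ 2 / y.
  by move=> y2; field; rewrite gt_eqF//; apply: lt_trans y2.
by rewrite E//; apply: divr_gt0 => //; apply: exprn_gt0; rewrite subr_gt0.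
Qed.

Lemma theta_itv : 0 < theta < 1.
Proof.
have t0 : 0 < theta.
  by apply: divr_gt0; [rewrite subr_gt0|apply: mulr_gt0 => //; exact: divr_gt0].
rewrite t0 /= -subr_gt0 -(pmulr_rgt0 _ p0).
by apply: lt_trans eta_gt0 _; rewrite ltrBlDr ltrDl.
Qed.

(** The indicator of a ray equals its square, so the Sobolev side and the tested side involve the
    same primitive (u-k)_+. *)
Lemma level_sobolev (k : R) : 1 <= k ->
  [/\ mu.-integrable Omega (fun x => (Num.max (u x - k) 0 `^ p)%:E),
   mu.-integrable Omega (fun x => (force (u x) * Num.max (u x - k) 0)%:E) &
   S * level_mass k `^ (2 / p) <=
   \int[mu]_(x in Omega) (force (u x) * Num.max (u x - k) 0)].
Proof.
move=> k1; have k0 : 0 <= k by apply: le_trans k1.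
pose r : R -> R := \1_(`]k, +oo[%classic).
have mr : measurable_fun setT r by exact: measurable_indic.
have r1 t : t <= 1 -> r t = 0 by move=> t1; rewrite /r ray_le// (le_trans t1).
have := critical_sobolev oO beta_adm finO p2 S0 lambda0 kappa0 eps0 ucrit mr (ray01 k) r1.
have -> : (fun t => r t ^+ 2) = r.
  by apply/funext => t; rewrite /r indicE; case: (_ \in _); rewrite ?expr1n ?expr0n.
by rewrite (_ : lprim r = fun t => Num.max (t - k) 0)//; apply/funext => t; exact: lprim_ray.
Qed.

(* On {u > l} one has (u-1)_+ <= l / (l-k) (u-k) and
   (u-k)^2 <= (l-k)^-eta (u-k)^(p (1-theta)); Hoelder's inequality pairs the latter
   power with (u-1)_+^(p-2), and (p/2) (1-theta) = 1 + eta/2 > 1. *)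
Lemma level_step (k l B : R) : 1 <= k -> k < l -> 2 <= l -> 0 < B -> level_mass k <= B ->
  S * level_mass l `^ (2 / p) <=
  (lambda + kappa) * (l / (l - k)) * (l - k) `^ (- eta) * (D `^ theta * B `^ (1 - theta)).
Proof.
move=> k1 kl l2 B0 aB; have l1 : 1 <= l by apply: le_trans l2; rewrite ler1n.
have [ik _ _] := level_sobolev k1; have [_ il sob] := level_sobolev l1.
apply: le_trans sob _.
have lk0 : 0 < l - k by rewrite subr_gt0.
have L0 : 0 <= l / (l - k) by rewrite divr_ge0 ?(ltW lk0)// (le_trans _ l1).
have lk_ : 0 <= lambda + kappa by rewrite addr_ge0 ?ltW.
have c0 : 0 <= (lambda + kappa) * (l / (l - k)) * (l - k) `^ (- eta).
  by apply: mulr_ge0 (powR_ge0 _ _); exact: mulr_ge0.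
apply: (hoelder_bound mO theta_itv D0 B0 c0 iv ik il (fun x => powR_ge0 _ _)
  (fun x => powR_ge0 _ _) _ vD aB) => x _.
have [xl|lx] := leP (u x) l.
  by rewrite [X in _ * X]max_r ?subr_le0// mulr0 mulr_ge0// mulr_ge0 ?powR_ge0.
move: (u x) lx => t lt; have kt : k < t by exact: lt_trans lt.
rewrite !max_l ?subr_ge0 ?(ltW lt) ?(ltW kt)//.
have t1 : 1 <= t by apply: le_trans (ltW lt).
have v1 : 1 <= vplus t by rewrite vplus_ge1// lerBrDr; apply: le_trans (ltW lt).
have v0 := vplus_ge0 t; have U0 : 0 < t - k by rewrite subr_gt0.
have tk : t - l <= t - k by rewrite lerD2l lerN2 ltW.
have tl0 : 0 <= t - l by rewrite subr_ge0 ltW.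
(* Above the level l >= 2 one has (u-1)_+ >= 1, so the linear term is dominated by the power p -
   1. *)
have ff : force t <= (lambda + kappa) * (vplus t `^ (p - 1 - 1) * vplus t).
  have p11 : 1 <= p - 1 by rewrite lerBrDr ltW.
  rewrite -powR_split ?subr_gt0// /force mulrDl lerD2r ler_wpM2l ?(ltW lambda0)//.
  exact: le1r_powR.
have vL : vplus t <= l / (l - k) * (t - k).
  rewrite mulrAC ler_pdivlMr// vplus_ge1// -subr_ge0.
  have -> : l * (t - k) - (t - 1) * (l - k) = k * (t - l) + (l - k) by ring.
  by rewrite addr_ge0 ?(ltW lk0)// mulr_ge0// (le_trans _ k1).
have U2 : (t - k) ^+ 2 <= (l - k) `^ (- eta) * (t - k) `^ (p * (1 - theta)).
  have -> : (t - k) ^+ 2 = (t - k) `^ (- eta) * (t - k) `^ (p * (1 - theta)).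
    rewrite -powRD; last by rewrite (gt_eqF U0) implybT.
    by rewrite -powR_mulrn ?(ltW U0)//; congr (_ `^ _); rewrite opprB subrK.
  rewrite ler_wpM2r ?powR_ge0// !powRN lef_pV2 ?posrE ?powR_gt0//.
  apply: ge0_ler_powR; rewrite ?nnegrE ?(ltW lk0) ?(ltW U0) ?(ltW eta_gt0)//.
  by rewrite lerD2r ltW.
have e1 : (vplus t `^ (p / 2 * p)) `^ theta = vplus t `^ (p - 1 - 1).
  rewrite -powRrM; congr (_ `^ _); rewrite mulrC divfK ?(gt_eqF m0)//.
  by rewrite -addrA -opprD.
have e2 : ((t - k) `^ p) `^ (1 - theta) = (t - k) `^ (p * (1 - theta)) by rewrite powRrM.
rewrite e1 e2.
apply: (@le_trans _ _ ((lambda + kappa) *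
  (vplus t `^ (p - 1 - 1) * (l / (l - k) * (t - k))) * (t - k))).
  apply: ler_pM => //; first exact: force_ge0.
  by apply: le_trans ff _; rewrite ler_wpM2l// ler_wpM2l// powR_ge0.
have a0 : 0 <= (lambda + kappa) * (l / (l - k)) * vplus t `^ (p - 1 - 1).
  by apply: mulr_ge0 (powR_ge0 _ _); exact: mulr_ge0.
have := ler_wpM2l a0 U2.
move: (vplus t `^ _) (_ `^ (- eta)) (_ `^ (p * _)) (l / (l - k)) => a b c L.
by congr (_ <= _); ring.
Qed.

Lemma level_mass_anti (k l : R) : 1 <= k -> k <= l -> level_mass l <= level_mass k.
Proof.
move=> k1 kl; have [ik _ _] := level_sobolev k1.
have [il _ _] := level_sobolev (le_trans k1 kl).
apply: le_Rintegral => // x _; apply: ge0_ler_powR; rewrite ?nnegrE ?(ltW p0)//.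
- by rewrite le_max lexx orbT.
- by rewrite le_max lexx orbT.
- by rewrite ge_max !le_max lexx orbT andbT lerD2l lerN2 kl.
Qed.

(** Consecutive levels differ by K/2^(j+1) and stay below 2K, so l/(l-k) <= 2 * 2^(j+1); with
    (p/2)(1 - theta) = 1 + eta/2 the level step becomes the recursion solved by the geometric
    sequence. At j = 0 the level K >= 1 gives a mass at most int (u-1)_+^p <= A. *)
Lemma level_mass_decay (A K r : R) : 0 < A ->
  \int[mu]_(x in Omega) (vplus (u x) `^ p) <= A -> 2 <= K -> 0 < r ->
  (forall j, (lambda + kappa) * 2 * D `^ theta / S * 2 ^+ j.+1 *
     (K / 2 ^+ j.+1) `^ (- eta) * (A `^ (2 / p) * r ^+ j) `^ (1 + eta / 2) <=
     A `^ (2 / p) * r ^+ j.+1) ->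
  forall j, level_mass (K * (2 - 2 ^- j)) <= (A `^ (2 / p) * r ^+ j) `^ (p / 2).
Proof.
move=> A0 vA K2 r0 dec; have K0 : 0 < K by apply: lt_le_trans K2.
have K1 : 1 <= K by apply: le_trans K2; rewrite ler1n.
have pp : 2 / p * (p / 2) = 1 by rewrite mulrA divfK ?gt_eqF// mulfV.
have Y0 j : 0 < A `^ (2 / p) * r ^+ j by rewrite mulr_gt0 ?powR_gt0 ?exprn_gt0.
have h2 : 0 <= p / 2 by apply: divr_ge0 => //; exact: ltW.
elim=> [|j IH].
  rewrite mulr1 -(powRrM A) pp (powRr1 (ltW A0)).
  have -> : K * (2 - 2 ^- 0) = K by rewrite expr0 invr1; ring.
  have [iK _ _] := level_sobolev K1.
  apply: le_trans vA; apply: le_Rintegral => //.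
    exact: vplus_p_integrable ucrit.
  move=> x _; apply: ge0_ler_powR; rewrite ?nnegrE ?(ltW p0) ?vplus_ge0//.
    by rewrite le_max lexx orbT.
  by rewrite /vplus ge_max !le_max lexx orbT andbT lerD2l lerN2 K1.
have t0 : 0 < (2 : R) ^+ j.+1 by rewrite exprn_gt0.
have ti : 2 ^- j = 2 * 2 ^- j.+1 :> R.
  by rewrite exprS invfM mulrA mulfV ?mul1r// pnatr_eq0.
have tl1 : 2 ^- j.+1 <= 2^-1 :> R.
  by rewrite lef_pV2 ?posrE// exprS ler_peMr// exprn_ege1// ler1n.
have td : 0 < 2 ^- j.+1 :> R by rewrite invr_gt0.
set k := K * (2 - 2 ^- j) in IH *; set l := K * (2 - 2 ^- j.+1).
have lk : l - k = K / 2 ^+ j.+1 by rewrite /l /k ti; ring.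
have k1 : 1 <= k.
  by rewrite /k ti; apply: le_trans K1 _; rewrite ler_peMr ?(ltW K0)//; lra.
have kl : k < l by rewrite -subr_gt0 lk mulr_gt0.
have l2 : 2 <= l.
  by apply: le_trans K2 _; rewrite /l ler_peMr ?(ltW K0)//; lra.
have := level_step k1 kl l2 (powR_gt0 _ (Y0 j)) IH.
rewrite lk -powRrM (_ : p / 2 * (1 - theta) = 1 + eta / 2); last first.
  have e (y t : R) : y / 2 * (1 - t) = 1 + (y * (1 - t) - 2) / 2 by field.
  exact: e.
have lL : l / (K / 2 ^+ j.+1) <= 2 * 2 ^+ j.+1.
  rewrite ler_pdivrMr ?mulr_gt0//.
  have -> : 2 * 2 ^+ j.+1 * (K / 2 ^+ j.+1) = K * 2 by field; rewrite gt_eqF.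
  by rewrite ler_wpM2l ?(ltW K0)// gerBl ltW.
move=> step.
have : level_mass l `^ (2 / p) <= A `^ (2 / p) * r ^+ j.+1.
  apply: le_trans (dec j); rewrite -(ler_pM2l S0); apply: le_trans step _.
  have lk_ : 0 <= lambda + kappa by rewrite addr_ge0 ?ltW.
  have {}lL := ler_wpM2l lk_ lL.
  have h0 : 0 <= (K / 2 ^+ j.+1) `^ (- eta) *
    (D `^ theta * (A `^ (2 / p) * r ^+ j) `^ (1 + eta / 2)).
    by rewrite !mulr_ge0 ?powR_ge0.
  move: (ler_wpM2r h0 lL).
  move: (2 ^+ j.+1) (_ `^ (1 + _)) (D `^ _) (_ `^ (- eta)) (l / _) => w z y x L.
  rewrite (_ : S * _ = (lambda + kappa) * (2 * w) * (x * (y * z))); first by rewrite !mulrA.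
  by field; rewrite gt_eqF.
move=> h; have l0 : 0 <= level_mass l by apply: Rintegral_ge0 => x _; exact: powR_ge0.
have -> : level_mass l = (level_mass l `^ (2 / p)) `^ (p / 2) by rewrite -powRrM pp powRr1.
by apply: ge0_ler_powR => //; rewrite nnegrE ?powR_ge0 ?(ltW (Y0 _)).
Qed.

(** All levels lie below 2K, so the mass above 2K is at most every term of a geometric sequence
    tending to 0; it vanishes, hence u <= 2K almost everywhere. *)
Lemma critical_le (A K r : R) : 0 < A ->
  \int[mu]_(x in Omega) (vplus (u x) `^ p) <= A -> 2 <= K -> 0 < r < 1 ->
  (forall j, (lambda + kappa) * 2 * D `^ theta / S * 2 ^+ j.+1 *
     (K / 2 ^+ j.+1) `^ (- eta) * (A `^ (2 / p) * r ^+ j) `^ (1 + eta / 2) <=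
     A `^ (2 / p) * r ^+ j.+1) ->
  \forall x \ae mu, Omega x -> u x <= 2 * K.
Proof.
move=> A0 vA K2 /andP[r0 r1] dec; have K0 : 0 < K by apply: lt_le_trans K2.
have K1 : 1 <= K by apply: le_trans K2; rewrite ler1n.
have hj := level_mass_decay A0 vA K2 r0 dec.
have K21 : 1 <= 2 * K by apply: le_trans K1 _; rewrite ler_peMl ?(ltW K0)// ler1n.
have h2 : 0 < p / 2 by exact: divr_gt0.
have m2 j : level_mass (2 * K) <= (A `^ (2 / p)) `^ (p / 2) * (r `^ (p / 2)) ^+ j.
  have -> : (A `^ (2 / p)) `^ (p / 2) * (r `^ (p / 2)) ^+ j = (A `^ (2 / p) * r ^+ j) `^ (p / 2).
    by rewrite powRM ?powR_ge0 ?exprn_ge0 ?(ltW r0)// powR_exprn// ltW.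
  apply: le_trans (hj j); apply: level_mass_anti.
    apply: le_trans K1 _; rewrite ler_peMr ?(ltW K0)// lerBrDr -lerBrDl.
    by rewrite (_ : 2 - 1 = 1) ?invf_le1 ?exprn_gt0 ?exprn_ege1 ?ler1n//; ring.
  by rewrite mulrC ler_wpM2r ?(ltW K0)// gerBl invr_ge0 exprn_ge0.
have rp : 0 <= r `^ (p / 2) < 1.
  have : r `^ (p / 2) < 1 `^ (p / 2) by apply: gt0_ltr_powR; rewrite ?nnegrE ?(ltW r0).
  by rewrite powR1 powR_ge0.
have c0 : (A `^ (2 / p)) `^ (p / 2) * (r `^ (p / 2)) ^+ j @[j --> \oo] --> (0 : R).
  rewrite -[X in _ --> X](mulr0 ((A `^ (2 / p)) `^ (p / 2))).
  apply: cvgM; first exact: cvg_cst.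
  by apply: cvg_expr; have /andP[? ?] := rp; rewrite ger0_norm.
have m0' : level_mass (2 * K) = 0.
  apply/eqP; rewrite eq_le; apply/andP; split.
    by apply: cvgr_to_ge c0 _; exact: nearW.
  by apply: Rintegral_ge0 => x _; exact: powR_ge0.
have [iW _ _] := level_sobolev K21.
have I0' : (\int[mu]_(x in Omega) `|(Num.max (u x - 2 * K) 0 `^ p)%:E| = 0)%E.
  under eq_integral do rewrite gee0_abs ?lee_fin ?powR_ge0//.
  rewrite -(fineK (integrable_fin_num mO iW)).
  by move: m0'; rewrite /level_mass /Rintegral => ->.
have /integrableP[mW _] := iW.
have /(ae_eq_integral_abs mu mO mW) := I0'.
apply: filterS => x h Ox; have := h Ox => -[] /powR_eq0_eq0/eqP.
by case: (leP (u x - 2 * K) 0) => [|h1 /eqP h3]; [rewrite subr_le0|rewrite h3 ltxx in h1].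
Qed.

End boundedness.

(** * The threshold on kappa and the conclusion *)

Section statement_facts.
Variable R : realType.

(** Raising the assumption to the power (N-2)/N undoes both outer exponents and leaves k^((N-2)/N)
    Q^(2/N) < c S, whose left side is k (Q/k)^(2/N). For c = 1 - 4/N^2 this says that the gap used
    for absorption is positive. *)
Lemma subcritical_bound (N S Q c k : R) : 2 < N -> 0 < S -> 0 < Q -> 0 < c -> 0 < k ->
  k < c `^ (N / (N - 2)) * (S `^ (N / 2) / Q) `^ (2 / (N - 2)) ->
  k * (Q / k) `^ (2 / N) < c * S.
Proof.
move=> N2 S0 Q0 c0 k0 h; have N0 : 0 < N by lra.
have N20 : 0 < N - 2 by lra.
have t0 : 0 < (N - 2) / N by rewrite divr_gt0.
have e1 : (c `^ (N / (N - 2))) `^ ((N - 2) / N) = c.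
  by rewrite -powRrM mulrA divfK ?gt_eqF// mulfV ?gt_eqF// powRr1// ltW.
have e2 : (S `^ (N / 2) / Q) `^ (2 / (N - 2)) `^ ((N - 2) / N) = S / Q `^ (2 / N).
  rewrite -powRrM mulrA divfK ?gt_eqF// powRM ?powR_ge0 ?invr_ge0 ?(ltW Q0)//.
  rewrite -powRrM mulrA divfK// mulfV ?gt_eqF// powRr1 ?(ltW S0)//.
  by rewrite -(powR_inv1 (ltW Q0)) powRAC powR_inv1 ?powR_ge0.
have : k `^ ((N - 2) / N) < c * (S / Q `^ (2 / N)).
  rewrite -{1}e1 -e2 -powRM ?powR_ge0//; apply: gt0_ltr_powR => //; rewrite nnegrE ?ltW//.
  by apply: mulr_gt0; apply: powR_gt0 => //; rewrite divr_gt0 ?powR_gt0.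
rewrite mulrA ltr_pdivlMr ?powR_gt0// => h1.
have -> : k * (Q / k) `^ (2 / N) = k `^ ((N - 2) / N) * Q `^ (2 / N) => //.
rewrite powRM ?invr_ge0 ?(ltW Q0) ?(ltW k0)// mulrCA mulrC; congr (_ * _).
rewrite -(powR_inv1 (ltW k0)) -powRrM -{1}(powRr1 (ltW k0)) -powRD.
  by congr (_ `^ _); field; rewrite gt_eqF.
by rewrite (gt_eqF k0) implybT.
Qed.

Variables (n : nat) (Omega : set 'rV[R]_n).
Local Notation mu := (lebesgue_rV R n).

Lemma sobolev_constant_ge0 : 0 <= sobolev_constant Omega.
Proof.
rewrite /sobolev_constant; set A := mkset _.
(* The infimum of the empty set is 0 by convention. *)
have [->|/set0P A0] := eqVneq A set0; first by rewrite image_set0 inf0.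
apply: lb_le_inf; first by have [v Av] := A0; eexists; exists v.
move=> _ [v _ <-]; rewrite divr_ge0 ?powR_ge0//.
by apply: Rintegral_ge0 => x _; apply: sumr_ge0 => i _; exact: sqr_ge0.
Qed.

Lemma kappa_lower_gt0 (M : R) : (2 < n)%N ->
  0 < kappa_lower Omega M -> 0 < sobolev_constant Omega.
Proof.
move=> n2 k0; rewrite lt_def sobolev_constant_ge0 andbT; apply: contraTneq k0 => S0.
have n2' : 0 < n%:R - 2 :> R by rewrite subr_gt0 ltr_nat.
have n0 : 0 < n%:R :> R by rewrite ltr0n (ltn_trans _ n2).
by rewrite /kappa_lower /kappa_upper S0 powR0 ?gt_eqF ?divr_gt0// mul0r powR0 ?mulr0 ?ltxx//
  gt_eqF ?divr_gt0.
Qed.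

Lemma sobolev_exponent_gt2 : (2 < n)%N -> 2 < sobolev_exponent R n.
Proof.
move=> n2; have n2' : 0 < n%:R - 2 :> R by rewrite subr_gt0 ltr_nat.
by rewrite /sobolev_exponent ltr_pdivlMr// ltr_pM2l// gtrBl.
Qed.

Lemma bounded_lebesgue_lty : bounded_set Omega -> open Omega -> (mu Omega < +oo)%E.
Proof.
move=> bO oO; have [L L0 sub] := bounded_sub_cbox bO.
apply: le_lt_trans (obox_measure_lty (const_mx (- (L + 1))) (const_mx (L + 1))).
apply: le_measure; rewrite ?inE; [exact: open_measurable_rV|exact: measurable_obox|].
move=> x /sub /= h i; have := h i; rewrite !mxE => /andP[h1 h2]; apply/andP; split; lra.
Qed.

Lemma Linfty_norm_le (u : 'rV[R]_n -> R) (C : R) : 0 <= C ->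
  (\forall x \ae mu, Omega x -> 0 <= u x <= C) -> (Linfty_norm Omega u <= C%:E)%E.
Proof.
move=> C0 uC; rewrite /Linfty_norm unlock /=; case: ifP => _; last by rewrite lee_fin.
apply/ess_sup_inf.ess_supP; apply: filterS uC => x ux /=; rewrite lee_fin patchE.
case: ifPn => [/set_mem/ux/andP[h0 h1]|_]; first by rewrite ger0_norm.
by rewrite normr0.
Qed.

End statement_facts.

Theorem proposition1p5 (R : realType) (N : nat) (Omega : set 'rV[R]_N)
    (beta : R -> R) (lambda M kappa : R) :
  (3 <= N)%N ->
  bounded_domain Omega ->
  C2_boundary Omega ->
  admissible_beta beta ->
  0 < lambda ->
  0 < M ->
  0 < kappa < kappa_lower Omega M ->
  exists C : R, 0 < C /\
    forall (eps : R) (u : 'rV[R]_N -> R),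
      0 < eps ->
      critical_point Omega (J Omega beta lambda kappa eps) u ->
      J Omega beta lambda kappa eps u <= M ->
      (Linfty_norm Omega u <= C%:E)%E.
Proof.
move=> N3 [oO _ _ bO] _ badm l0 M0 /andP[k0 kk].
have S0 := kappa_lower_gt0 N3 (lt_trans k0 kk).
have p2 := sobolev_exponent_gt2 R N3.
have finO := bounded_lebesgue_lty bO oO.
set p := sobolev_exponent R N in p2; set S := sobolev_constant Omega in S0.
have p0 : 0 < p by apply: lt_trans p2.
have Nr : 2 < N%:R :> R by rewrite ltr_nat.
have N0 : 0 < N%:R :> R by apply: lt_trans Nr.
have V0 : 0 <= volume Omega by apply: fine_ge0.
pose Q := N%:R * (M + volume Omega).
have Q0 : 0 < Q by rewrite mulr_gt0// ltr_wpDr.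
(* The first estimate, (kappa/N) int v^p <= M + |Omega|, rearranged. *)
pose A := Q / kappa; have A0 : 0 < A by exact: divr_gt0.
have [n0 n2] : N%:R != 0 :> R /\ N%:R - 2 != 0 :> R by rewrite subr_eq0 !gt_eqF.
have eN : 1 - 2 / p = 2 / N%:R.
  by rewrite /p /sobolev_exponent; field; rewrite n0 n2.
have ec : 4 * (p - 1) / p ^+ 2 = 1 - 4 / N%:R ^+ 2.
  by rewrite /p /sobolev_exponent; field; rewrite n0 n2.
pose delta := S * (4 * (p - 1) / p ^+ 2) - kappa * A `^ (1 - 2 / p).
have d0 : 0 < delta.
  rewrite subr_gt0 eN ec [S * _]mulrC; apply: subcritical_bound => //.
  rewrite subr_gt0 ltr_pdivrMr ?exprn_gt0// mul1r expr2.
  have -> : 4 = 2 * 2 :> R by rewrite -natrM.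
  by apply: ltr_pM.
pose D := (lambda * A / delta) `^ (p / 2).
have D0 : 0 < D by rewrite powR_gt0// divr_gt0// mulr_gt0.
pose E := (lambda + kappa) * 2 * D `^ ((p - 2) / (p / 2 * p)) / S.
have E0 : 0 < E.
  apply: divr_gt0 => //; apply: mulr_gt0; last exact: powR_gt0.
  by apply: mulr_gt0 => //; exact: addr_gt0.
have [K K2 [r r01 dec]] := fast_decay E0 (powR_gt0 (2 / p) A0) (eta_gt0 p2).
have K0 : 0 < K by apply: lt_le_trans K2.
(* K is determined by N, Omega, M, kappa and lambda, before eps and u are introduced. *)
exists (2 * K); split; first by rewrite mulr_gt0.
move=> eps u eps0 ucrit JM.
have vA : \int[lebesgue_rV R N]_(x in Omega) (vplus (u x) `^ p) <= A.
  have := critical_level oO badm finO p2 S0 l0 k0 eps0 ucrit JM.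
  have -> : 2^-1 - (sobolev_exponent R N)^-1 = N%:R^-1.
    by rewrite /sobolev_exponent; field; rewrite n0 n2.
  rewrite -/p mulrAC ler_pdivrMr// mulrC => h.
  by rewrite /A ler_pdivlMr// [leRHS]mulrC.
have [iv vD] := vplus_high_bound oO badm finO p2 S0 l0 k0 eps0 ucrit A0 vA d0.
have ge := critical_ge0 oO badm finO p2 S0 eps0 ucrit.
have le := critical_le oO badm finO p2 S0 l0 k0 eps0 ucrit D0 iv vD A0 vA K2 r01 dec.
apply: Linfty_norm_le; first by rewrite mulr_ge0// ltW.
by apply: filterS2 ge le => x h1 h2 Ox; rewrite h1// h2.
Qed.
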